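(* Let $\alpha=(\alpha_\pi)_{\pi\in\mathcal P}$ be an admissible family of weights. Then there exists a unique symmetric multi-faced universal product $\odot$ whose highest coefficients are $(\alpha_\pi)_{\pi\in\mathcal P}$.
   Context: Algebras are complex associative, not necessarily unital; $\sqcup$ is the free product (coproduct of algebras). Fix a finite set $\mathcal F$ of faces. A multi-faced algebra is an algebra $A$ with subalgebras $A^{\mathsf Q}$ ($\mathsf Q\in\mathcal F$) such that the canonical map $\bigsqcup_{\mathsf Q}A^{\mathsf Q}\to A$ is an isomorphism; multi-faced homomorphisms map $A^{\mathsf Q}$ into $B^{\mathsf Q}$; $A_1\sqcup A_2$ has faces $A_1^{\mathsf Q}\sqcup A_2^{\mathsf Q}$. A multi-faced universal product assigns to linear functionals $\varphi_i$ on multi-faced algebras $A_i$ a linear functional $\varphi_1\odot\varphi_2$ on $A_1\sqcup A_2$ with universality $(\varphi_1\circ h_1)\odot(\varphi_2\circ h_2)=(\varphi_1\odot\varphi_2)\circ(h_1\sqcup h_2)$ for multi-faced homomorphisms $h_i$, associativity, and $(\varphi_1\odot\varphi_2)|_{A_i}=\varphi_i$; it is symmetric if $\varphi_1\odot\varphi_2=\varphi_2\odot\varphi_1$ (under $A_1\sqcup A_2\cong A_2\sqcup A_1$). For $\mathbf s=\mathbf b\times\mathbf f\in([k]\times\mathcal F)^n$ and $A=A_1\sqcup\cdots\sqcup A_k$, $A^{\mathbf s}=\{a_1\cdots a_n:a_\ell\in A^{\mathbf f(\ell)}_{\mathbf b(\ell)}\}$. We say $\odot$ has highest coefficients $(\alpha_\pi)$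 if for all $k$, all multi-faced algebras $A_\kappa$ with linear functionals $\varphi_\kappa$, all $\mathbf s=\mathbf b\times\mathbf f$ with $\mathbf b$ onto $[k]$, and all $a=a_1\cdots a_n\in A^{\mathbf s}$, one has $\frac{\partial^k}{\partial t_1\cdots\partial t_k}\big((t_1\varphi_1)\odot\cdots\odot(t_k\varphi_k)\big)(a)|_{t=0}=\alpha_{\pi}\prod_\kappa\varphi_\kappa\big(\overrightarrow{\prod}_{\mathbf b(\ell)=\kappa}a_\ell\big)$, where $\pi\in\mathcal P(\mathbf f)$ has blocks $\{\ell:\mathbf b(\ell)=\kappa\}$ and $\overrightarrow\prod$ is the product in increasing order. Partitions: for $\mathbf f\in\mathcal F^n$, $[n]_{\mathbf f}$ is $\{1,\dots,n\}$ with faces $\mathbf f(\ell)$; $\mathcal P(\mathbf f)$ are its set partitions, $\mathcal P=\bigcup_{\mathbf f}\mathcal P(\mathbf f)$; finite totally ordered sets with face maps are identified with $[m]_{|S|}$ via the order-preserving bijection. $1_{\mathbf f}$: one-block partition; $\pi_{\beta_1\smile\beta_2}=(\pi\setminus\{\beta_1,\beta_2\})\cup\{\beta_1\cup\beta_2\}$; $\{\beta_1,\beta_2\}$ is a partition of the multi-faced set $\beta_1\cup\beta_2$. Reduction $\pi_{\mathrm{red}}$: quotient by $s\sim t$ ($s\le t$) iff all $r\in[s,t]$ have the same face and lie in the same block. Mirror: $\overline{\mathbf f}(i)=\mathbf f(n+1-i)$, $\overline\pi=\{\{n+1-i:i\in\beta\}:\beta\in\pi\}$. Admissible: $\alpha\subset\mathbb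 C$ with (i) $\alpha_{1_{\mathbf f}}=1$; (ii) $\alpha_{\{\{1\},\{2\}\}}=1$ for $\mathbf f\in\mathcal F^2$; (iii) $\alpha_\pi=\alpha_{\pi_{\mathrm{red}}}$; (iv) if $\pi\in\mathcal P(\mathbf f)$ has blocks $\beta_1\ne\beta_2$, $i\in\beta_1$, $i+1\in\beta_2$, $\mathbf f(i)=\mathbf f(i+1)$, then $\alpha_\pi=\alpha_{\pi_{\beta_1\smile\beta_2}}\alpha_{\{\beta_1,\beta_2\}}$; (v) $\alpha_\pi=\alpha_\sigma$ if $\pi\in\mathcal P(\mathbf f)$, $\sigma\in\mathcal P(\mathbf g)$ have the same set partition and $\mathbf f(\ell)=\mathbf g(\ell)$ for $1<\ell<n$; (vi) $\alpha_{\overline\pi}=\overline{\alpha_\pi}$. *)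

(* Defs.v *)
From HB Require Import structures.
From mathcomp Require Import all_boot all_order all_algebra.
From mathcomp Require Import interval_inference reals.
From mathcomp Require Import topology tvs normedtype landau derive.
From mathcomp Require Import complex.

Set Implicit Arguments.
Unset Strict Implicit.
Unset Printing Implicit Defensive.

Import GRing.Theory Num.Theory numFieldNormedType.Exports.
Local Open Scope ring_scope.

Section Defs.
Variable R : realType.
Local Notation C := (complex R).

Record nalg := NAlg {
  nalg_sort :> lmodType C;
  nmul : nalg_sort -> nalg_sort -> nalg_sort;
  nmulA : forall x y z, nmul x (nmul y z) = nmul (nmul x y) z;
  nmulDl : forall x y z, nmul (x + y) z = nmul x z + nmul y z;
  nmulDr : forall x y z, nmul x (y + z) = nmul x y + nmul x z;
  nmulZl : forall (c : C) x y, nmul (c *: x) y = c *: nmul x y;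
  nmulZr : forall (c : C) x y, nmul x (c *: y) = c *: nmul x y }.

Definition nhom (A B : nalg) (h : A -> B) : Prop :=
  (forall (c : C) x y, h (c *: x + y) = c *: h x + h y) /\
  (forall x y, h (nmul x y) = nmul (h x) (h y)).

Definition lin_fun (A : nalg) (phi : A -> C) : Prop :=
  forall (c : C) x y, phi (c *: x + y) = c * phi x + phi y.

Definition subalg (A : nalg) (S : A -> Prop) : Prop :=
  [/\ S 0, (forall (c : C) x y, S x -> S y -> S (c *: x + y))
         & (forall x y, S x -> S y -> S (nmul x y))].

Definition hom_on (A B : nalg) (S : A -> Prop) (g : A -> B) : Prop :=
  (forall (c : C) x y, S x -> S y -> g (c *: x + y) = c *: g x + g y) /\
  (forall x y, S x -> S y -> g (nmul x y) = nmul (g x) (g y)).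

(* A, together with the inclusions of the subalgebras S j, is the free      *)
(* product (coproduct of algebras) of the S j, i.e. the canonical map       *)
(* \bigsqcup_j S j -> A is an isomorphism.                                   *)
Definition coprod_of_subalgs (A : nalg) (J : Type) (S : J -> A -> Prop) : Prop :=
  forall (D : nalg) (g : J -> A -> D), (forall j, hom_on (S j) (g j)) ->
    (exists h : A -> D, nhom h /\ forall j x, S j x -> h x = g j x) /\
    (forall h1 h2 : A -> D, nhom h1 -> nhom h2 ->
       (forall j x, S j x -> h1 x = g j x) ->
       (forall j x, S j x -> h2 x = g j x) -> forall x, h1 x = h2 x).

Definition genalg (A : nalg) (X : A -> Prop) : A -> Prop :=
  fun x => forall S : A -> Prop, subalg S -> (forall y, X y -> S y) -> S x.

Variable Fc : finType.

Record mfalg := MFAlg {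
  mf_alg :> nalg;
  mf_face : Fc -> mf_alg -> Prop;
  mf_face_sub : forall Q, subalg (mf_face Q);
  mf_coprod : coprod_of_subalgs mf_face }.
Arguments mf_face : clear implicits.

Definition mfhom (A B : mfalg) (h : A -> B) : Prop :=
  nhom h /\ forall Q x, mf_face A Q x -> mf_face B Q (h x).

(* A free product A1 \sqcup A2 of multi-faced algebras: the coproduct of the *)
(* underlying algebras, with faces (the images of) A1^Q \sqcup A2^Q, i.e.    *)
(* the subalgebras generated by in1(A1^Q) and in2(A2^Q).                     *)
Record mffp (A1 A2 : mfalg) := MFFP {
  fp_alg :> mfalg;
  fp_in1 : A1 -> fp_alg;
  fp_in2 : A2 -> fp_alg;
  fp_hom1 : nhom fp_in1;
  fp_hom2 : nhom fp_in2;
  fp_coprod : forall (D : nalg) (g1 : A1 -> D) (g2 : A2 -> D), nhom g1 -> nhom g2 ->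
    (exists h : fp_alg -> D, nhom h /\ (forall x, h (fp_in1 x) = g1 x)
                                    /\ (forall x, h (fp_in2 x) = g2 x)) /\
    (forall h h' : fp_alg -> D, nhom h -> nhom h' ->
       (forall x, h (fp_in1 x) = g1 x) -> (forall x, h (fp_in2 x) = g2 x) ->
       (forall x, h' (fp_in1 x) = g1 x) -> (forall x, h' (fp_in2 x) = g2 x) ->
       forall z, h z = h' z);
  fp_faces : forall Q z, mf_face fp_alg Q z <->
    genalg (fun y => (exists x1, mf_face A1 Q x1 /\ y = fp_in1 x1) \/
                     (exists x2, mf_face A2 Q x2 /\ y = fp_in2 x2)) z }.
Arguments fp_in1 [A1 A2] m x.
Arguments fp_in2 [A1 A2] m x.

Definition fpchoice := forall A1 A2 : mfalg, mffp A1 A2.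

Variable FP : fpchoice.

Definition UP := forall A1 A2 : mfalg, (A1 -> C) -> (A2 -> C) -> FP A1 A2 -> C.

Section UPaxioms.
Variable up : UP.

Definition up_linear : Prop :=
  forall (A1 A2 : mfalg) (phi1 : A1 -> C) (phi2 : A2 -> C),
    lin_fun phi1 -> lin_fun phi2 -> lin_fun (up phi1 phi2).

(* universality: (phi1 o h1) . (phi2 o h2) = (phi1 . phi2) o (h1 \sqcup h2), *)
(* where h1 \sqcup h2 is the (unique) homomorphism k with k o in_i = in_i o h_i *)
Definition up_universal : Prop :=
  forall (B1 B2 A1 A2 : mfalg) (h1 : B1 -> A1) (h2 : B2 -> A2)
         (phi1 : A1 -> C) (phi2 : A2 -> C),
    mfhom h1 -> mfhom h2 -> lin_fun phi1 -> lin_fun phi2 ->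
    forall k : FP B1 B2 -> FP A1 A2, nhom k ->
      (forall x, k (fp_in1 (FP B1 B2) x) = fp_in1 (FP A1 A2) (h1 x)) ->
      (forall x, k (fp_in2 (FP B1 B2) x) = fp_in2 (FP A1 A2) (h2 x)) ->
      forall z, up (phi1 \o h1) (phi2 \o h2) z = up phi1 phi2 (k z).

(* associativity, via the canonical isomorphism                               *)
(* (A1 \sqcup A2) \sqcup A3 -> A1 \sqcup (A2 \sqcup A3)                       *)
Definition up_assoc : Prop :=
  forall (A1 A2 A3 : mfalg) (phi1 : A1 -> C) (phi2 : A2 -> C) (phi3 : A3 -> C),
    lin_fun phi1 -> lin_fun phi2 -> lin_fun phi3 ->
    forall k : FP (FP A1 A2) A3 -> FP A1 (FP A2 A3), nhom k ->
      (forall x, k (fp_in1 (FP (FP A1 A2) A3) (fp_in1 (FP A1 A2) x))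
                 = fp_in1 (FP A1 (FP A2 A3)) x) ->
      (forall x, k (fp_in1 (FP (FP A1 A2) A3) (fp_in2 (FP A1 A2) x))
                 = fp_in2 (FP A1 (FP A2 A3)) (fp_in1 (FP A2 A3) x)) ->
      (forall x, k (fp_in2 (FP (FP A1 A2) A3) x)
                 = fp_in2 (FP A1 (FP A2 A3)) (fp_in2 (FP A2 A3) x)) ->
      forall z, up (up phi1 phi2) phi3 z = up phi1 (up phi2 phi3) (k z).

Definition up_restrict : Prop :=
  forall (A1 A2 : mfalg) (phi1 : A1 -> C) (phi2 : A2 -> C),
    lin_fun phi1 -> lin_fun phi2 ->
    (forall x, up phi1 phi2 (fp_in1 (FP A1 A2) x) = phi1 x) /\
    (forall x, up phi1 phi2 (fp_in2 (FP A1 A2) x) = phi2 x).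

(* symmetry, via the canonical isomorphism A1 \sqcup A2 -> A2 \sqcup A1 *)
Definition up_symmetric : Prop :=
  forall (A1 A2 : mfalg) (phi1 : A1 -> C) (phi2 : A2 -> C),
    lin_fun phi1 -> lin_fun phi2 ->
    forall k : FP A1 A2 -> FP A2 A1, nhom k ->
      (forall x, k (fp_in1 (FP A1 A2) x) = fp_in2 (FP A2 A1) x) ->
      (forall x, k (fp_in2 (FP A1 A2) x) = fp_in1 (FP A2 A1) x) ->
      forall z, up phi1 phi2 z = up phi2 phi1 (k z).

Definition univ_prod : Prop :=
  [/\ up_linear, up_universal, up_assoc & up_restrict].

Definition sym_univ_prod : Prop := univ_prod /\ up_symmetric.

Section Tower.
Local Unset Implicit Arguments.
Variable As : nat -> mfalg.
Variable phi : forall i, As i -> C.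

Fixpoint tower (m : nat) : mfalg :=
  match m with
  | 0 => As 0
  | m'.+1 => fp_alg (FP (tower m') (As m'.+1))
  end.

(* x : As j viewed in As i (identity if i = j; 0 otherwise, never used) *)
Definition castA (i j : nat) (x : As j) : As i :=
  match @eqP _ j i with
  | ReflectT e => eq_rect j (fun l => As l) x i e
  | ReflectF _ => 0
  end.

Fixpoint incl (m : nat) : forall j, As j -> tower m :=
  match m return forall j, As j -> tower m with
  | 0 => fun j x => castA 0 j x
  | m'.+1 => fun j x =>
      if j == m'.+1 then fp_in2 (FP (tower m') (As m'.+1)) (castA m'.+1 j x)
      else fp_in1 (FP (tower m') (As m'.+1)) (incl m' j x)
  end.

Fixpoint towF (t : nat -> R) (m : nat) : tower m -> C :=
  match m return tower m -> C with
  | 0 => fun x => (t 0)%:C%C * phi 0 x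
  | m'.+1 => @up (tower m') (As m'.+1) (towF t m')
                 (fun x => (t m'.+1)%:C%C * phi m'.+1 x)
  end.
End Tower.

End UPaxioms.

Definition nprod (A : nalg) (l : seq A) : A :=
  match l with
  | [::] => 0
  | x :: l' => foldl (@nmul A) x l'
  end.

Definition cderiv (g : R -> C) (s0 : R) (v : C) : Prop :=
  is_derive s0 (1 : R) (fun s => complex.Re (g s)) (complex.Re v) /\
  is_derive s0 (1 : R) (fun s => complex.Im (g s)) (complex.Im v).

Definition upd (x : nat -> R) (i : nat) (s : R) : nat -> R :=
  fun j => if j == i then s else x j.

(* mpd F [:: i1; ...; ir] x v : the iterated partial derivative              *)
(* d/dt_i1 ( d/dt_i2 ( ... d/dt_ir F ) ) exists at the point x and equals v   *)
Fixpoint mpd (F : (nat -> R) -> C) (l : seq nat) (x : nat -> R) (v : C) : Prop :=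
  match l with
  | [::] => F x = v
  | i :: l' => exists g : R -> C,
      (exists2 e : R, 0 < e & forall s : R, `|s - x i| < e -> mpd F l' (upd x i s) (g s))
      /\ cderiv g (x i) v
  end.

(* A partition pi in P(f), f in Fc^n, is given by n, f : 'I_n -> Fc and its   *)
(* set of blocks p, with partition p [set: 'I_n].                            *)
Definition wts := forall n : nat, {ffun 'I_n -> Fc} -> {set {set 'I_n}} -> C.

Definition is_part n (p : {set {set 'I_n}}) : Prop := finset.partition p [set: 'I_n].

Definition has_highest (up : UP) (alpha : wts) : Prop :=
  forall (k : nat) (As : nat -> mfalg) (phi : forall i, As i -> C),
    (0 < k)%N -> (forall i, lin_fun (phi i)) ->
    forall (n : nat) (b : 'I_n -> nat) (f : {ffun 'I_n -> Fc})
           (a : forall l : 'I_n, As (b l)),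
      (forall l, (b l < k)%N) ->
      (forall kappa, (kappa < k)%N -> exists l, b l = kappa) ->
      (forall l, mf_face (As (b l)) (f l) (a l)) ->
      mpd (fun t => towF up As phi t k.-1
                      (nprod [seq incl As k.-1 (b l) (a l) | l <- enum 'I_n]))
          (iota 0 k) (fun _ => 0)
          (alpha n f [set [set l : 'I_n | b l == kappa] | kappa : 'I_k] *
           \prod_(kappa < k)
              phi kappa (nprod [seq castA As kappa (b l) (a l) | l <- enum 'I_n & b l == kappa])).

Definition same_run n (f : {ffun 'I_n -> Fc}) (p : {set {set 'I_n}}) (i j : 'I_n) : Prop :=
  forall r : 'I_n, (minn i j <= r <= maxn i j)%N -> f r = f i /\ finset.pblock p r = finset.pblock p i.

(* (m, g, q) is the reduction pi_red of (n, f, p): the quotient by ~,        *)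
(* identified with [m] through the order-preserving bijection h.            *)
Definition is_red n (f : {ffun 'I_n -> Fc}) (p : {set {set 'I_n}})
                  m (g : {ffun 'I_m -> Fc}) (q : {set {set 'I_m}}) : Prop :=
  exists h : 'I_n -> 'I_m,
    [/\ forall i j : 'I_n, (i <= j)%N -> (h i <= h j)%N,
        forall y, exists i, h i = y,
        forall i j, h i = h j <-> same_run f p i j,
        forall i, g (h i) = f i
      & q = [set h @: B | B : {set 'I_n} in p]].

(* (m, g, q) is the partition p' of the multi-faced subset S of [n]_f,       *)
(* identified with [m] through the order-preserving bijection h : [m] -> S.   *)
Definition is_restr n (f : {ffun 'I_n -> Fc}) (S : {set 'I_n}) (p' : {set {set 'I_n}})
                    m (g : {ffun 'I_m -> Fc}) (q : {set {set 'I_m}}) : Prop :=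
  exists h : 'I_m -> 'I_n,
    [/\ forall i j : 'I_m, (i < j)%N -> (h i < h j)%N,
        forall x, x \in S <-> exists i, h i = x,
        forall i, g i = f (h i)
      & q = [set h @^-1: B | B : {set 'I_n} in p']].

Definition mirror_f n (f : {ffun 'I_n -> Fc}) : {ffun 'I_n -> Fc} :=
  [ffun i => f (rev_ord i)].
Definition mirror_p n (p : {set {set 'I_n}}) : {set {set 'I_n}} :=
  [set (@rev_ord n) @: B | B : {set 'I_n} in p].

Definition admissible (alpha : wts) : Prop :=
     (forall n (f : {ffun 'I_n -> Fc}), (0 < n)%N -> alpha n f [set [set: 'I_n]] = 1) /\
     (forall f : {ffun 'I_2 -> Fc},
        alpha 2 f [set [set @ord0 1]; [set @ord_max 1]] = 1) /\
     (forall n f p m g q, is_part p -> @is_red n f p m g q -> alpha n f p = alpha m g q) /\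
     (forall n (f : {ffun 'I_n -> Fc}) p (beta1 beta2 : {set 'I_n}) (i j : 'I_n),
        is_part p -> beta1 \in p -> beta2 \in p -> beta1 != beta2 ->
        i \in beta1 -> j \in beta2 -> val j = (val i).+1 -> f i = f j ->
        forall m g q, @is_restr n f (beta1 :|: beta2) [set beta1; beta2] m g q ->
          alpha n f p = alpha n f ((p :\ beta1 :\ beta2) :|: [set beta1 :|: beta2])
                        * alpha m g q) /\
     (forall n (f g : {ffun 'I_n -> Fc}) p, is_part p ->
        (forall l : 'I_n, (0 < val l)%N -> (val l < n.-1)%N -> f l = g l) ->
        alpha n f p = alpha n g p) /\
     (forall n (f : {ffun 'I_n -> Fc}) p, is_part p ->
        alpha n (mirror_f f) (mirror_p p) = Num.conj (alpha n f p)).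

End Defs.

(* Main.v *)
Require Import Defs.
From HB Require Import structures.
From mathcomp Require Import all_boot all_order all_algebra.
From mathcomp Require Import zify.
From mathcomp Require Import boolp functions.
From mathcomp Require Import topology normedtype derive.
From mathcomp Require Import reals complex.

(** The product is defined by a moment-cumulant formula: a functional [phi] has cumulants
    [K] when [phi (a1 ... an)] is the sum over all partitions [pi] of
    [alpha_pi * \prod_(B in pi) K(a_B)], and the product of [phi1] and [phi2] is the
    functional on the free product that restricts to them and whose cumulants with
    entries from both algebras vanish.  By reduction invariance and the factorisation
    of [alpha] at two neighbours of equal face, a functional respects products of
    neighbouring entries exactly when its cumulants satisfy
    [K(.., ab, ..) = K(.., a, b, ..) + sum over the splittings separating a and b],
    and the cumulants with mixed ones replaced by [0] still satisfy this rule; hence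
    the product exists.  Rescaling the factors by [t_i] multiplies cumulants by [t_i]
    up to higher powers, which gives the highest coefficients.

    For uniqueness, by universality it is enough to consider sums of two copies of the
    letters of a free multi-faced algebra, that is, an additive convolution evaluated at
    words without repeated letters.  There it is additive in every single letter, hence
    only sees the values of both functionals on words without repeated letters, and on
    those every functional is a convolution of functionals supported on one word each.
    Scaling the letters of these words shows that such a convolution is multilinear in
    the scaling factors, so that it equals its highest coefficient. *)

Set Implicit Arguments.
Unset Strict Implicit.
Unset Printing Implicit Defensive.

Import Order.TTheory GRing.Theory Num.Theory numFieldNormedType.Exports.
Local Open Scope ring_scope.

Arguments mf_face {R Fc}.
Arguments nprod : simpl never.

(** A free product is known only through its universal property, so there are no normal forms on
    which a functional could be defined. A functional is instead obtained from a function on words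
    that is linear in every entry and that turns a product of two elements of one part into two
    neighbouring entries: the parts then act on the space of such functions, and the coproduct
    extends the action. This is why everything in the existence proof is reduced to these two
    properties of the moment-cumulant sum, and why each of them is written as an identity between a
    defect of moments and a defect of cumulants, which can be read in both directions. The obstacle
    to uniqueness is that highest coefficients fix one mixed derivative at [0] and not the product
    itself. For functionals supported on one word each, multiplying the [j]th functional by [t_j] is
    the same as rescaling one letter of its word, so universality forces the value to be a constant
    times [t_1 ... t_k], and the derivative is that constant. *)

Section SubModule.
Variables (K : pzRingType) (V : lmodType K).

(** Submodules cut out by a [Prop]. Membership is decided classically, so the subtype is again an
    [lmodType]; it carries subalgebras, endomorphism algebras and spaces of functions on words. *)
Record submod := SubMod {
  sm_pred : V -> Prop;
  sm_pred0 : sm_pred 0;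
  sm_predL : forall (c : K) x y, sm_pred x -> sm_pred y -> sm_pred (c *: x + y) }.

Definition sm_in (S : submod) : {pred V} := fun x => `[< sm_pred S x >].

Lemma sm_closed S : submod_closed (sm_in S).
Proof.
split=> [|c x y]; first by apply/asboolP/sm_pred0.
by move=> /asboolP xS /asboolP yS; apply/asboolP/sm_predL.
Qed.

HB.instance Definition _ S := GRing.isSubmodClosed.Build K V (sm_in S) (sm_closed S).

Definition sm_sort (S : submod) := {x : V | x \in sm_in S}.
HB.instance Definition _ S := SubChoice.on (sm_sort S).
HB.instance Definition _ S := [SubChoice_isSubLmodule of sm_sort S by <:].

Definition sm_mk (S : submod) x (Sx : sm_pred S x) : sm_sort S :=
  exist _ x (introT (asboolP _) Sx).

Lemma sm_valP S (x : sm_sort S) : sm_pred S (val x).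
Proof. by have /asboolP := valP x. Qed.

End SubModule.

(** * Homomorphisms, linear functionals and products in nonunital algebras *)

Section NAlg.
Variable R : realType.
Local Notation C := (complex R).

Lemma nhomL (A B : nalg R) (h : A -> B) (hh : nhom h) c x y :
  h (c *: x + y) = c *: h x + h y.
Proof. by case: hh. Qed.

Lemma nhomM (A B : nalg R) (h : A -> B) (hh : nhom h) x y :
  h (nmul x y) = nmul (h x) (h y).
Proof. by case: hh. Qed.

Lemma nhomD (A B : nalg R) (h : A -> B) (hh : nhom h) x y : h (x + y) = h x + h y.
Proof. by have := nhomL hh 1 x y; rewrite !scale1r. Qed.

Lemma nhom0 (A B : nalg R) (h : A -> B) (hh : nhom h) : h 0 = 0.
Proof. by have /eqP := nhomD hh 0 0; rewrite addr0 -subr_eq0 opprD addNKr oppr_eq0 => /eqP. Qed.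

Lemma nhomZ (A B : nalg R) (h : A -> B) (hh : nhom h) c x : h (c *: x) = c *: h x.
Proof. by have := nhomL hh c x 0; rewrite (nhom0 hh) !addr0. Qed.

Lemma nhom_id (A : nalg R) : nhom (@id A).
Proof. by []. Qed.

Lemma nhom_comp (A B D : nalg R) (g : B -> D) (h : A -> B) :
  nhom g -> nhom h -> nhom (g \o h).
Proof.
move=> gh hh; split=> [c x y|x y] /=; first by rewrite (nhomL hh) (nhomL gh).
by rewrite (nhomM hh) (nhomM gh).
Qed.

Lemma nmul0l (A : nalg R) (x : A) : nmul 0 x = 0.
Proof. by have := nmulZl 0 0 x; rewrite !scale0r. Qed.

Lemma nmul0r (A : nalg R) (x : A) : nmul x 0 = 0.
Proof. by have := nmulZr 0 x 0; rewrite !scale0r. Qed.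

Lemma nhom_cst0 (A B : nalg R) : nhom (fun _ : A => 0 : B).
Proof. by split=> [c x y|x y]; rewrite ?scaler0 ?addr0 ?nmul0l. Qed.

Lemma lin_funD (A : nalg R) (phi : A -> C) (hh : lin_fun phi) x y :
  phi (x + y) = phi x + phi y.
Proof. by have := hh 1 x y; rewrite scale1r mul1r. Qed.

Lemma lin_fun0 (A : nalg R) (phi : A -> C) (hh : lin_fun phi) : phi 0 = 0.
Proof. by have /eqP := lin_funD hh 0 0; rewrite addr0 -subr_eq0 opprD addNKr oppr_eq0 => /eqP. Qed.

Lemma lin_funZ (A : nalg R) (phi : A -> C) (hh : lin_fun phi) c x :
  phi (c *: x) = c * phi x.
Proof. by have := hh c x 0; rewrite (lin_fun0 hh) !addr0. Qed.

Lemma lin_fun_comp (A B : nalg R) (phi : B -> C) (h : A -> B) :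
  lin_fun phi -> nhom h -> lin_fun (phi \o h).
Proof. by move=> lp hh c x y /=; rewrite (nhomL hh) lp. Qed.

Lemma lin_fun_scale (A : nalg R) (phi : A -> C) c :
  lin_fun phi -> lin_fun (fun x => c * phi x).
Proof. by move=> lp d x y; rewrite lp mulrDr mulrCA. Qed.

Lemma lin_fun_cst0 (A : nalg R) : lin_fun (fun _ : A => 0 : C).
Proof. by move=> c x y; rewrite mulr0 addr0. Qed.

(** ** Products of nonempty words *)

Lemma nprod_cons (A : nalg R) (x : A) l : l != [::] ->
  nprod (x :: l) = nmul x (nprod l).
Proof.
case: l => // y l _; rewrite /nprod /=; elim: l x y => //= z l IH x y.
by rewrite -nmulA IH.
Qed.

Lemma nprod_cat (A : nalg R) (u v : seq A) : u != [::] -> v != [::] ->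
  nprod (u ++ v) = nmul (nprod u) (nprod v).
Proof.
move=> + v0; elim: u => // x u IH _.
case: (eqVneq u [::]) => [->|u0] /=; first by rewrite nprod_cons.
by rewrite (@nprod_cons _ x (u ++ v)) ?IH // ?(@nprod_cons _ x u) ?nmulA //; case: (u) u0.
Qed.

Lemma nprod_lin (A : nalg R) (u v : seq A) c x y :
  nprod (u ++ c *: x + y :: v) = c *: nprod (u ++ x :: v) + nprod (u ++ y :: v).
Proof.
case: u v => [|u0 u] [|v0 v].
- by [].
- by rewrite !cat0s !(@nprod_cons _ _ (v0 :: v)) // nmulDl nmulZl.
- by rewrite !(@nprod_cat _ (u0 :: u) [:: _]) // [nprod [:: _ + _]]/nprod /= nmulDr nmulZr.
- rewrite !(@nprod_cat _ (u0 :: u)) // !(@nprod_cons _ _ (v0 :: v)) //.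
  by rewrite nmulDl nmulZl nmulDr nmulZr.
Qed.

Lemma nprod_mul (A : nalg R) (u v : seq A) x y :
  nprod (u ++ nmul x y :: v) = nprod (u ++ [:: x, y & v]).
Proof.
case: u => [|z u] //; rewrite /nprod /= !foldl_cat /=.
by rewrite nmulA.
Qed.

Lemma nprod0 (A : nalg R) (u v : seq A) : nprod (u ++ 0 :: v) = 0.
Proof. by have := nprod_lin u v (-1) 0 0; rewrite scaler0 addr0 scaleN1r addNr. Qed.

Lemma nprod_in0 (A : nalg R) (l : seq A) : 0 \in l -> nprod l = 0.
Proof. by case/splitPr=> u v; rewrite nprod0. Qed.

Lemma nhom_nprod (A B : nalg R) (h : A -> B) (hh : nhom h) l :
  h (nprod l) = nprod (map h l).
Proof.
case: l => [|x l]; rewrite /nprod /=; first exact: nhom0.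
by elim: l x => //= y l IH x; rewrite IH nhomM.
Qed.

(** ** Subalgebras and endomorphism algebras *)

Section SubAlg.
Variables (A : nalg R) (S : A -> Prop) (hS : subalg S).

Definition sa_submod : submod A :=
  let: And3 S0 SL _ := hS in SubMod S0 SL.

Lemma sa_pred x : sm_pred sa_submod x <-> S x.
Proof. by rewrite /sa_submod; case: hS. Qed.

Definition sa_mul (x y : sm_sort sa_submod) : sm_sort sa_submod.
Proof.
refine (@sm_mk _ _ sa_submod (nmul (val x) (val y)) _).
case: (hS) => _ _ SM; apply/sa_pred/SM; exact/sa_pred/sm_valP.
Defined.

Definition sa_nalg : nalg R.
Proof.
refine (@NAlg R (sm_sort sa_submod) sa_mul _ _ _ _ _) => *; apply: val_inj.
- exact: nmulA.
- exact: nmulDl.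
- exact: nmulDr.
- exact: nmulZl.
- exact: nmulZr.
Defined.

Definition sa_val (x : sa_nalg) : A := \val (x : sm_sort sa_submod).

Lemma sa_val_hom : nhom sa_val. Proof. by []. Qed.

Lemma sa_valP x : S (sa_val x). Proof. exact/sa_pred/sm_valP. Qed.

Lemma sa_val_inj : injective sa_val. Proof. exact: val_inj. Qed.

Definition sa_mk x (Sx : S x) : sa_nalg := sm_mk (iffRL (sa_pred x) Sx).

End SubAlg.

Section EndAlg.
Variable V : lmodType C.

Definition end_submod : submod (V -> V).
Proof.
refine (@SubMod C (V -> V) (fun T => forall c x y, T (c *: x + y) = c *: T x + T y) _ _).
  by move=> c x y; rewrite /GRing.zero /= scaler0 addr0.
move=> d T U TL UL c x y; rewrite !fctE TL UL.
by rewrite !scalerDr addrACA !scalerA mulrC.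
Defined.

Lemma endL (T : sm_sort end_submod) c x y : val T (c *: x + y) = c *: val T x + val T y.
Proof. exact: (sm_valP T). Qed.

Lemma endD (T : sm_sort end_submod) x y : val T (x + y) = val T x + val T y.
Proof. by have := endL T 1 x y; rewrite !scale1r. Qed.

Lemma endZ (T : sm_sort end_submod) c x : val T (c *: x) = c *: val T x.
Proof.
have T0 : val T 0 = 0 by have := endL T (-1) 0 0; rewrite scaler0 addr0 scaleN1r addNr.
by have := endL T c x 0; rewrite T0 !addr0.
Qed.

Definition end_mul (T U : sm_sort end_submod) : sm_sort end_submod.
Proof.
refine (@sm_mk _ _ end_submod (val T \o val U) _).
by move=> c x y /=; rewrite !endL.
Defined.

(** Homomorphisms into this algebra are representations. Evaluating a representation at a fixed
    vector is how functionals are built, both on coproducts and on free algebras. *)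
Definition end_nalg : nalg R.
Proof.
refine (@NAlg R (sm_sort end_submod) end_mul _ _ _ _ _).
- by move=> x y z; apply: val_inj.
- by move=> x y z; apply: val_inj.
- by move=> x y z; apply: val_inj; apply/funext => v /=; rewrite !fctE endD.
- by move=> c x y; apply: val_inj.
- by move=> c x y; apply: val_inj; apply/funext => v /=; rewrite !fctE endZ.
Defined.

Definition end_val (T : end_nalg) : V -> V := \val (T : sm_sort end_submod).

Lemma end_valM (T U : end_nalg) v : end_val (nmul T U) v = end_val T (end_val U v).
Proof. by []. Qed.

Lemma end_valL c (T U : end_nalg) v : end_val (c *: T + U) v = c *: end_val T v + end_val U v.
Proof. by []. Qed.

Lemma end_val_inj (T U : end_nalg) : (forall v, end_val T v = end_val U v) -> T = U.
Proof. by move=> TU; apply: val_inj; apply/funext. Qed.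

Definition end_mk (T : V -> V) (TL : forall c x y, T (c *: x + y) = c *: T x + T y) : end_nalg :=
  @sm_mk _ _ end_submod T TL.

Lemma end_mkK T TL v : end_val (@end_mk T TL) v = T v. Proof. by []. Qed.

Lemma end_val_nprod (l : seq end_nalg) v : l != [::] ->
  end_val (nprod l) v = foldr end_val v l.
Proof.
elim: l => // T l IH _; case: (eqVneq l [::]) => [->|l0] //.
by rewrite nprod_cons // end_valM IH.
Qed.

End EndAlg.
End NAlg.

(** * Spans of words and functionals on coproducts *)

Section Words.
Variable R : realType.
Local Notation C := (complex R).

(** [genalg] quantifies over all subalgebras and offers no induction on linear combinations of
    words; this is its inductive counterpart. *)
Inductive wspan (A : nalg R) (P : A -> Prop) : A -> Prop :=
| wspan0 : wspan P 0
| wspanL c w x : w != [::] -> (forall a, a \in w -> P a) -> wspan P x ->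
    wspan P (c *: nprod w + x).

Lemma wspan_lin (A : nalg R) (P : A -> Prop) c x y :
  wspan P x -> wspan P y -> wspan P (c *: x + y).
Proof.
move=> Sx Sy; elim: Sx => [|d w z w0 wP _ IH]; first by rewrite scaler0 add0r.
by rewrite scalerDr scalerA -addrA; apply: wspanL.
Qed.

Lemma wspan_subalg (A : nalg R) (P : A -> Prop) : subalg (wspan P).
Proof.
split; [exact: wspan0 | exact: wspan_lin |].
move=> x y + Sy; elim=> [|c w z w0 wP _ IH]; first by rewrite nmul0l; apply: wspan0.
rewrite nmulDl nmulZl; apply: wspan_lin => //.
elim: Sy => [|d v t v0 vP _ IH']; first by rewrite nmul0r; apply: wspan0.
rewrite nmulDr nmulZr -nprod_cat //; apply: wspanL => //; first by case: (w) w0.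
by move=> a; rewrite mem_cat => /orP[/wP|/vP].
Qed.

Lemma genalg_wspan (A : nalg R) (P : A -> Prop) x : genalg P x -> wspan P x.
Proof.
apply; first exact: wspan_subalg.
move=> y Py; have := @wspanL _ P 1 [:: y] 0 isT _ (wspan0 P).
rewrite scale1r addr0; apply=> a; rewrite inE => /eqP-> //.
Qed.

Lemma lin_ext_words (A : nalg R) (P : A -> Prop) (phi psi : A -> C) :
  (forall x, genalg P x) -> lin_fun phi -> lin_fun psi ->
  (forall w, w != [::] -> (forall a, a \in w -> P a) -> phi (nprod w) = psi (nprod w)) ->
  phi = psi.
Proof.
move=> gen lp lq E; apply/funext=> x; elim: (genalg_wspan (gen x)) => [|c w y w0 wP _ IH].
  by rewrite (lin_fun0 lp) (lin_fun0 lq).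
by rewrite lp lq IH E.
Qed.

Lemma subalg_preim (A B : nalg R) (h : A -> B) (S : B -> Prop) :
  nhom h -> subalg S -> subalg (fun x => S (h x)).
Proof.
move=> hh [S0 SL SM]; split; first by rewrite (nhom0 hh).
  by move=> c x y Sx Sy; rewrite (nhomL hh); apply: SL.
by move=> x y Sx Sy; rewrite (nhomM hh); apply: SM.
Qed.

Lemma genalg_subalg (A : nalg R) (P : A -> Prop) : subalg (genalg P).
Proof.
split=> [S [] //|c x y gx gy S sS PS|x y gx gy S sS PS].
  by case: (sS) => _ + _; apply; [apply: gx | apply: gy].
by case: (sS) => _ _; apply; [apply: gx | apply: gy].
Qed.

(** If the subalgebra [U] contains all parts, the coproduct maps to [U] and back to [A]. The
    composite fixes the parts, hence is the identity by uniqueness, so every element lies in [U].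
    The maps to [U] must be total and are therefore [0] outside [U]. *)
Lemma coprod_genalg (A : nalg R) (J : Type) (S : J -> A -> Prop) :
  coprod_of_subalgs S -> forall x, genalg (fun a => exists j, S j a) x.
Proof.
move=> cS x U sU SU.
have SU' j a : S j a -> U a by move=> Sa; apply: SU; exists j.
pose g (j : J) (a : A) : sa_nalg sU :=
  if pselect (U a) is left Ua then sa_mk sU Ua else 0.
have gE j a : U a -> sa_val (g j a) = a by rewrite /g; case: pselect.
have gh j : hom_on (S j) (g j).
  have [U0 UL UM] := sU; split=> [c a b /SU' Ua /SU' Ub|a b /SU' Ua /SU' Ub];
    apply: (@sa_val_inj _ _ _ sU).
    by rewrite gE ?(nhomL (sa_val_hom sU)) ?gE //; apply: UL.
  by rewrite gE ?(nhomM (sa_val_hom sU)) ?gE //; apply: UM.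
have [[h [hh hE]] _] := cS _ g gh.
have [_ uq] := cS A (fun _ a => a) (fun _ => conj (fun _ _ _ _ _ => erefl) (fun _ _ _ _ => erefl)).
have <- : sa_val (h x) = x; last exact: sa_valP.
apply: (uq (@sa_val _ _ _ sU \o h) id _ (nhom_id A)) => //.
  exact: nhom_comp (sa_val_hom sU) hh.
by move=> j a Sa; rewrite /= (hE _ _ Sa) gE //; apply: SU' Sa.
Qed.

Section Extension.
Variables (A : nalg R) (J : eqType) (S : J -> A -> Prop).

Definition multilinear_words (F : seq (J * A) -> C) :=
  forall u v j c x y,
    F (u ++ (j, c *: x + y) :: v) = c * F (u ++ (j, x) :: v) + F (u ++ (j, y) :: v).

Definition merging_words (F : seq (J * A) -> C) :=
  forall u v j x y, F (u ++ (j, nmul x y) :: v) = F (u ++ [:: (j, x), (j, y) & v]).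

Definition compat_submod : submod (seq (J * A) -> C).
Proof.
refine (@SubMod C (seq (J * A) -> C)
  (fun F => multilinear_words F /\ merging_words F) _ _).
  by split=> [u v j c x y|//]; rewrite /GRing.zero /= mulr0 addr0.
move=> c F G [FL FM] [GL GM]; split=> [u v j d x y|u v j x y]; rewrite !fctE.
  by rewrite FL GL scalerDr mulrDr addrACA /GRing.scale /= mulrCA.
by rewrite FM GM.
Defined.

Local Notation V := (sm_sort compat_submod).

(** Right translation by one letter. The two compatibility conditions on [F] say precisely that this
    operator is linear and multiplicative in the letter. *)
Definition push (p : J * A) (F : V) : V.
Proof.
refine (@sm_mk _ _ compat_submod (fun w => val F (rcons w p)) _).
have [FL FM] := sm_valP F.
split=> [u v j c x y|u v j x y]; first by rewrite !rcons_cat FL.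
by rewrite !rcons_cat FM.
Defined.

Lemma push_val p (F : V) w : val (push p F) w = val F (rcons w p).
Proof. by []. Qed.

Lemma compat_valL c (F G : V) w : val (c *: F + G) w = c * val F w + val G w.
Proof. by rewrite linearP. Qed.

Lemma push_lin p c F G : push p (c *: F + G) = c *: push p F + push p G.
Proof.
by apply: val_inj; apply/funext => w; rewrite push_val !compat_valL !push_val.
Qed.

Definition pushE (j : J) (a : A) : end_nalg V := end_mk (push_lin (j, a)).

(* The algebra acts by right translations on the space of all compatible
   functions on words; evaluating at the empty word recovers a functional. *)
Lemma coprod_functional (F : seq (J * A) -> C) :
  coprod_of_subalgs S -> multilinear_words F -> merging_words F ->
  exists phi : A -> C, lin_fun phi /\
    forall w, w != [::] -> (all (fun p => `[< S p.1 p.2 >]) w) ->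
      phi (nprod (map snd w)) = F w.
Proof.
move=> cS FL FM.
have gh j : hom_on (S j) (pushE j).
  split=> [c x y _ _|x y _ _]; apply: end_val_inj => G; rewrite /pushE.
    rewrite end_valL !end_mkK; apply: val_inj; apply/funext => w.
    rewrite compat_valL !push_val.
    by have [GL _] := sm_valP G; have := GL w [::] j c x y; rewrite !cats1.
  rewrite end_valM !end_mkK; apply: val_inj; apply/funext => w.
  rewrite !push_val.
  by have [_ GM] := sm_valP G; have := GM w [::] j x y; rewrite -!cats1 -catA.
have [[h [hh hE]] _] := cS _ _ gh.
pose F0 : V := sm_mk (conj FL FM : sm_pred compat_submod F).
exists (fun x => val (end_val (h x) F0) [::]); split.
  by move=> c x y; rewrite (nhomL hh) end_valL compat_valL.
move=> w w0 wS; rewrite (nhom_nprod hh) end_val_nprod; last by case: (w) w0.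
have -> : F w = F ([::] ++ w) by [].
elim: w [::] wS {w0} => [|[j a] w IH] u /=; first by rewrite cats0.
move=> /andP[/asboolP Sa wS].
by rewrite (hE _ _ Sa) end_mkK push_val IH // cat_rcons.
Qed.
End Extension.

(** ** Free products *)

Section FreeProduct.
Variables (Fc : finType) (A1 A2 : mfalg R Fc) (F : mffp A1 A2).

(** Sending the other factor to [0] gives a retraction, along which functionals of a factor extend
    to the whole free product. *)
Lemma fp_retract1 : exists r : F -> A1,
  [/\ nhom r, forall x, r (fp_in1 F x) = x & forall x, r (fp_in2 F x) = 0].
Proof.
have [[r [hr [r1 r2]]] _] := fp_coprod F (nhom_id A1) (nhom_cst0 A2 A1).
by exists r.
Qed.

Lemma fp_retract2 : exists r : F -> A2,
  [/\ nhom r, forall x, r (fp_in1 F x) = 0 & forall x, r (fp_in2 F x) = x].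
Proof.
have [[r [hr [r1 r2]]] _] := fp_coprod F (nhom_cst0 A1 A2) (nhom_id A2).
by exists r.
Qed.

Definition fp_part (p : bool * Fc) (z : F) : Prop :=
  if p.1 then exists2 x, mf_face A1 p.2 x & z = fp_in1 F x
         else exists2 x, mf_face A2 p.2 x & z = fp_in2 F x.

(** A coproduct of coproducts: homomorphisms on the faces are first glued on each factor by
    [mf_coprod] and then on the free product. Words can thus be taken with entries in a face of a
    factor. *)
Lemma fp_coprod_parts : coprod_of_subalgs fp_part.
Proof.
have h1 := fp_hom1 F; have h2 := fp_hom2 F.
move=> D g gh; split; last first.
  move=> k k' kh kh' kg kg'.
  have E1 x : k (fp_in1 F x) = k' (fp_in1 F x).
    have [_ uq] := @mf_coprod _ _ A1 D (fun Q x => k (fp_in1 F x))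
      (fun Q => conj (fun c x y _ _ => nhomL (nhom_comp kh h1) c x y)
                     (fun x y _ _ => nhomM (nhom_comp kh h1) x y)).
    apply: (uq _ (k' \o fp_in1 F) (nhom_comp kh h1) (nhom_comp kh' h1)) => // Q y fy.
    have py : fp_part (true, Q) (fp_in1 F y) by exists y.
    by rewrite /= (kg _ _ py) (kg' _ _ py).
  have E2 x : k (fp_in2 F x) = k' (fp_in2 F x).
    have [_ uq] := @mf_coprod _ _ A2 D (fun Q x => k (fp_in2 F x))
      (fun Q => conj (fun c x y _ _ => nhomL (nhom_comp kh h2) c x y)
                     (fun x y _ _ => nhomM (nhom_comp kh h2) x y)).
    apply: (uq _ (k' \o fp_in2 F) (nhom_comp kh h2) (nhom_comp kh' h2)) => // Q y fy.
    have py : fp_part (false, Q) (fp_in2 F y) by exists y.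
    by rewrite /= (kg _ _ py) (kg' _ _ py).
  have [_ uq] := fp_coprod F (nhom_comp kh h1) (nhom_comp kh h2).
  by apply: uq => // x /=; rewrite ?E1 ?E2.
have gh1 Q : hom_on (mf_face A1 Q) (g (true, Q) \o fp_in1 F).
  have [gL gM] := gh (true, Q); split=> [c x y fx fy|x y fx fy] /=.
    by rewrite (nhomL h1) gL //; [exists x | exists y].
  by rewrite (nhomM h1) gM //; [exists x | exists y].
have gh2 Q : hom_on (mf_face A2 Q) (g (false, Q) \o fp_in2 F).
  have [gL gM] := gh (false, Q); split=> [c x y fx fy|x y fx fy] /=.
    by rewrite (nhomL h2) gL //; [exists x | exists y].
  by rewrite (nhomM h2) gM //; [exists x | exists y].
have [[k1 [kh1 k1E]] _] := mf_coprod gh1.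
have [[k2 [kh2 k2E]] _] := mf_coprod gh2.
have [[k [kh [kE1 kE2]]] _] := fp_coprod F kh1 kh2.
exists k; split=> // -[[] Q] x [y fy ->].
  by rewrite kE1 (k1E _ _ fy).
by rewrite kE2 (k2E _ _ fy).
Qed.

Lemma fp_genalg z : genalg (fun z => exists p, fp_part p z) z.
Proof. exact: (coprod_genalg fp_coprod_parts). Qed.

Lemma fp_face1 Q x : mf_face A1 Q x -> mf_face F Q (fp_in1 F x).
Proof. by move=> fx; apply/fp_faces => S _; apply; left; exists x. Qed.

Lemma fp_face2 Q x : mf_face A2 Q x -> mf_face F Q (fp_in2 F x).
Proof. by move=> fx; apply/fp_faces => S _; apply; right; exists x. Qed.

End FreeProduct.

Lemma mfhom_id (Fc : finType) (A : mfalg R Fc) : mfhom (@id A).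
Proof. by split. Qed.

Lemma mfhom_comp (Fc : finType) (A B D : mfalg R Fc) (g : B -> D) (h : A -> B) :
  mfhom g -> mfhom h -> mfhom (g \o h).
Proof. by move=> [gh gf] [hh hf]; split=> [|Q x fx /=]; [apply: nhom_comp | apply/gf/hf]. Qed.

Lemma mfhom_cst0 (Fc : finType) (A B : mfalg R Fc) : mfhom (fun _ : A => 0 : B).
Proof. by split=> [|Q x _]; [apply: nhom_cst0 | have [] := @mf_face_sub _ _ B Q]. Qed.

Lemma fp_mfhom1 (Fc : finType) (A1 A2 : mfalg R Fc) (F : mffp A1 A2) : mfhom (fp_in1 F).
Proof. by split; [apply: fp_hom1 | apply: fp_face1]. Qed.

Lemma fp_mfhom2 (Fc : finType) (A1 A2 : mfalg R Fc) (F : mffp A1 A2) : mfhom (fp_in2 F).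
Proof. by split; [apply: fp_hom2 | apply: fp_face2]. Qed.

Lemma fp_mfhom (Fc : finType) (A1 A2 B : mfalg R Fc) (F : mffp A1 A2)
    (g1 : A1 -> B) (g2 : A2 -> B) : mfhom g1 -> mfhom g2 ->
  exists h : F -> B, [/\ mfhom h, forall x, h (fp_in1 F x) = g1 x
                        & forall x, h (fp_in2 F x) = g2 x].
Proof.
move=> [h1 f1] [h2 f2]; have [[h [hh [hE1 hE2]]] _] := fp_coprod F h1 h2.
exists h; split=> //; split=> // Q x /fp_faces gx.
apply: (gx (fun x => mf_face B Q (h x))).
  exact: subalg_preim hh (@mf_face_sub _ _ B Q).
by move=> y [[z [fz ->]]|[z [fz ->]]]; rewrite ?hE1 ?hE2; [apply: f1 | apply: f2].
Qed.

End Words.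

(** ** Weights of labelled words *)

Section Weights.
Variables (R : realType) (Fc : finType) (alpha : wts R Fc).
Local Notation C := (complex R).

Definition lface (L : Type) (s : seq (Fc * L)) : {ffun 'I_(size s) -> Fc} :=
  [ffun i => (tnth (in_tuple s) i).1].
Definition lker (L : eqType) (s : seq (Fc * L)) : {set {set 'I_(size s)}} :=
  [set [set j | (tnth (in_tuple s) j).2 == (tnth (in_tuple s) i).2] | i : 'I_(size s)].

(* The weight of the partition of the positions of [s] given by equality of labels. *)
Definition wt (L : eqType) (s : seq (Fc * L)) : C := alpha (lface s) (lker s).

Definition kerp n (L : eqType) (l : 'I_n -> L) : {set {set 'I_n}} :=
  [set [set j | l j == l i] | i : 'I_n].

Lemma map_tnthE (T : Type) (s : seq T) :
  s = [seq tnth (in_tuple s) i | i <- enum 'I_(size s)].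
Proof. by have := map_tnth_enum (in_tuple s). Qed.

Lemma wtE (L : eqType) n (s : seq (Fc * L)) (f : {ffun 'I_n -> Fc}) (l : 'I_n -> L) :
  s = [seq (f i, l i) | i <- enum 'I_n] -> wt s = alpha f (kerp l).
Proof.
move=> Es; have sz : size s = n by rewrite Es size_map size_enum_ord.
move: f l Es; case: n / sz => f l Es.
have E i : tnth (in_tuple s) i = (f i, l i).
  rewrite (tnth_nth (f i, l i)) /=.
  apply: etrans (congr1 (fun t => nth (f i, l i) t i) Es) _.
  by rewrite (nth_map i) ?nth_ord_enum // size_enum_ord ltn_ord.
rewrite /wt; congr alpha; first by apply/ffunP => i; rewrite ffunE E.
apply: eq_imset => i; apply/setP=> j; rewrite !inE !E //.
Qed.

Lemma mem_kerp n (L : eqType) (l : 'I_n -> L) i : [set j | l j == l i] \in kerp l.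
Proof. exact: imset_f. Qed.

Lemma kerp_part n (L : eqType) (l : 'I_n -> L) : partition (kerp l) [set: 'I_n].
Proof.
have -> : kerp l = preim_partition l [set: 'I_n].
  apply/setP=> B; apply/imsetP/imsetP => [[i _ ->]|[i _ ->]]; exists i => //;
    apply/setP=> j; rewrite !inE // eq_sym //.
exact: preim_partitionP.
Qed.

Lemma pblock_kerp n (L : eqType) (l : 'I_n -> L) i :
  pblock (kerp l) i = [set j | l j == l i].
Proof.
apply: (def_pblock (partition_trivIset (kerp_part l))); first exact: mem_kerp.
by rewrite inE.
Qed.

Lemma eq_kerp n (L L' : eqType) (l : 'I_n -> L) (l' : 'I_n -> L') :
  (forall i j, (l i == l j) = (l' i == l' j)) -> kerp l = kerp l'.
Proof. by move=> E; apply: eq_imset => i; apply/setP => j; rewrite !inE E. Qed.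

(** Only the pattern of equalities between labels matters. This is what allows blocks to be renamed
    freely, without ever renumbering positions. *)
Lemma wt_relabel (L L' : eqType) (T : eqType) (f : T -> Fc) (l : T -> L) (l' : T -> L') s :
  {in s &, forall i j, (l i == l j) = (l' i == l' j)} ->
  wt [seq (f i, l i) | i <- s] = wt [seq (f i, l' i) | i <- s].
Proof.
move=> E; pose t := in_tuple s.
have Em U (g : T -> U) : map g s = map (fun i => g (tnth t i)) (enum 'I_(size s)).
  by rewrite {1}(map_tnthE s) -map_comp.
rewrite (@wtE _ _ _ [ffun i => f (tnth t i)] (fun i => l (tnth t i))); last first.
  by rewrite Em; apply: eq_map => i; rewrite ffunE.
rewrite (@wtE _ _ _ [ffun i => f (tnth t i)] (fun i => l' (tnth t i))); last first.
  by rewrite Em; apply: eq_map => i; rewrite ffunE.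
by congr alpha; apply: eq_kerp => i j; rewrite E ?mem_tnth.
Qed.

Hypothesis adm : admissible alpha.

Lemma wt_const (L : eqType) (s : seq (Fc * L)) : s != [::] ->
  {in s &, forall a b, a.2 = b.2} -> wt s = 1.
Proof.
move=> s0 sc; case: adm => a1 _; rewrite -(a1 _ (lface s)); last by case: (s) s0.
congr alpha; have [i0 _] : exists i0 : 'I_(size s), true.
  by case: (s) s0 => // x t _; exists ord0.
apply/setP=> B; rewrite inE; apply/imsetP/eqP => [[i _ ->]|->].
  by apply/setP=> j; rewrite !inE (sc _ _ (mem_tnth j (in_tuple s)) (mem_tnth i (in_tuple s))) eqxx.
by exists i0 => //; apply/setP=> j; rewrite !inE (sc _ _ (mem_tnth j (in_tuple s)) (mem_tnth i0 (in_tuple s))) eqxx.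
Qed.

Lemma same_runE (L : eqType) (s : seq (Fc * L)) i j :
  same_run (lface s) (lker s) i j <->
  forall r : 'I_(size s), (minn i j <= r <= maxn i j)%N ->
    tnth (in_tuple s) r = tnth (in_tuple s) i.
Proof.
have E r : pblock (lker s) r = pblock (lker s) i <->
    (tnth (in_tuple s) r).2 = (tnth (in_tuple s) i).2.
  rewrite !(pblock_kerp (fun i => (tnth (in_tuple s) i).2)).
  by split=> [/setP/(_ r)|->//]; rewrite !inE eqxx => /esym/eqP.
split=> H r /H; rewrite E !ffunE.
  by case; case: (tnth _ r) => a b; case: (tnth _ i) => c d /= -> ->.
by move=> ->.
Qed.

(** A monotone surjection respecting faces and labels only shortens runs of equal entries: every
    interval of [s'] lifts to an interval of [s]. So reducing after [h] reduces [s]. *)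
Lemma red_comp (L : eqType) (s s' : seq (Fc * L)) (h : 'I_(size s) -> 'I_(size s')) m
    (g : {ffun 'I_m -> Fc}) q :
  (forall i j : 'I_(size s), (i <= j)%N -> (h i <= h j)%N) ->
  (forall y, exists i, h i = y) ->
  (forall i, tnth (in_tuple s') (h i) = tnth (in_tuple s) i) ->
  is_red (lface s') (lker s') g q -> is_red (lface s) (lker s) g q.
Proof.
move=> hm hs hE [k [km ks kr kf ->]]; exists (k \o h); split=> /=.
- by move=> i j ij; apply/km/hm.
- by move=> y; have [y' <-] := ks y; have [i <-] := hs y'; exists i.
- move=> i j; rewrite kr !same_runE; split=> H r /andP[r1 r2].
    rewrite -!hE; apply: H; have [ij|ij] := leqP i j.
      have := hm _ _ ij; move: r1 r2; rewrite (minn_idPl ij) (maxn_idPr ij) => r1 r2 hij.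
      by rewrite (minn_idPl hij) (maxn_idPr hij) !hm.
    have := hm _ _ (ltnW ij); move: r1 r2; rewrite (minn_idPr (ltnW ij)) (maxn_idPl (ltnW ij)) => r1 r2 hij.
    by rewrite (minn_idPr hij) (maxn_idPl hij) !hm.
  suff [t tij <-] : exists2 t : 'I_(size s), (minn i j <= t <= maxn i j)%N & h t = r.
    by rewrite !hE; apply: H.
  have [t tr] := hs r.
  wlog ij : i j {H} r1 r2 / (i <= j)%N => [W|].
    have /orP[ij|ji] := leq_total i j; first exact: W.
    have := W j i; rewrite (minnC (h j)) (maxnC (h j)) => /(_ r1 r2 ji) [t' tt <-].
    by exists t' => //; rewrite minnC maxnC.
  have hij := hm _ _ ij; move: r1 r2.
  rewrite (minn_idPl ij) (maxn_idPr ij) (minn_idPl hij) (maxn_idPr hij) => r1 r2.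
  have [ti|it] := leqP t i.
    exists i; rewrite ?leqnn //; apply/val_inj/eqP; rewrite eqn_leq r1 /=.
    by rewrite -tr hm.
  have [jt|tj] := leqP j t.
    exists j; rewrite ?ij ?leqnn //; apply/val_inj/eqP; rewrite eqn_leq r2 andbT.
    by rewrite -tr hm.
  by exists t => //; rewrite (ltnW it) (ltnW tj).
- by move=> i; rewrite kf !ffunE hE.
have -> : lker s' = [set h @: (B : {set _}) | B in lker s].
  have hB i : [set j | (tnth (in_tuple s') j).2 == (tnth (in_tuple s') (h i)).2]
      = h @: [set j | (tnth (in_tuple s) j).2 == (tnth (in_tuple s) i).2].
    apply/setP=> y; rewrite inE; apply/idP/imsetP => [|[j + ->]].
      by have [j <-] := hs y; rewrite !hE => jE; exists j; rewrite // inE.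
    by rewrite inE !hE.
  apply/setP=> B; apply/imsetP/imsetP => [[y _ ->]|[_ /imsetP[i _ ->] ->]].
    by have [i <-] := hs y; rewrite hB; eexists; first exact: imset_f.
  by exists (h i); rewrite ?hB.
rewrite -imset_comp; apply: eq_imset => B /=.
exact/esym/imset_comp.
Qed.

Lemma red_step (L : eqType) (u v : seq (Fc * L)) a m (g : {ffun 'I_m -> Fc}) q :
  is_red (lface (u ++ a :: v)) (lker (u ++ a :: v)) g q ->
  is_red (lface (u ++ [:: a, a & v])) (lker (u ++ [:: a, a & v])) g q.
Proof.
set s := u ++ [:: a, a & v]; set s' := u ++ a :: v.
have sz : size s = (size s').+1 by rewrite !size_cat /= !addnS.
have us : (size u < size s')%N by rewrite size_cat /= addnS ltnS leq_addr.
have aux k : (k < (size s').+1)%N -> (unbump (size u) k < size s')%N.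
  by rewrite /unbump; case: (ltnP (size u) k) => /= uk kl; lia.
have ord_s (i : 'I_(size s)) : (i < (size s').+1)%N by rewrite -sz.
have hP i := aux _ (ord_s i).
(* [unbump (size u)] sends the positions [size u] and [size u + 1] of the two copies of [a] to the
   same place and closes the gap behind them. *)
apply: (@red_comp _ s s' (fun i => Ordinal (hP i))).
- move=> i j ij /=; rewrite /unbump.
  by case: (ltnP (size u) i) => ui; case: (ltnP (size u) j) => uj /=; lia.
- move=> y; have yP : (bump (size u) y < size s)%N.
    by rewrite sz ltnS /bump; case: (leqP (size u) y) => _; [exact: ltn_ord | exact/ltnW/ltn_ord].
  by exists (Ordinal yP); apply: val_inj; rewrite /= bumpK.
- move=> i; rewrite !(tnth_nth a) /= /s /s' /unbump !nth_cat.
  have [ui|ui] := ltnP (size u) i; rewrite ?subn0 //=.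
    rewrite subn1 -ltnS prednK ?(leq_ltn_trans _ ui) // ltnNge ui /= ltnNge (ltnW ui) /=.
    by case: (val i) ui => // k; rewrite ltnS => uk /=; rewrite subSn.
  case: ltnP => // iu; have -> : val i = size u by apply/eqP; rewrite eqn_leq ui iu.
  by rewrite subnn.
Qed.

(** A word without equal neighbours is its own reduction, because a run of at least two positions
    contains such neighbours; otherwise one of the two copies is dropped. *)
Lemma red_exists (L : eqType) (s : seq (Fc * L)) :
  exists m (g : {ffun 'I_m -> Fc}) q, is_red (lface s) (lker s) g q.
Proof.
have [n] := ubnP (size s); elim: n s => // n IH s sn.
case: (pselect (exists u a v, s = u ++ [:: a, a & v])) => [[u [a [v E]]]|N].
  have [|m [g [q H]]] := IH (u ++ a :: v).
    by move: sn; rewrite E !size_cat /= !addnS !ltnS.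
  by exists m, g, q; rewrite E; apply: red_step.
exists (size s), (lface s), (lker s), id; split=> //.
- by move=> y; exists y.
- move=> i j; rewrite same_runE; split=> [->|H].
    by move=> r; rewrite minnn maxnn -eqn_leq => /eqP/val_inj->.
  have K (k l : 'I_(size s)) : (k < l)%N ->
    (forall r : 'I_(size s), (k <= r <= l)%N -> tnth (in_tuple s) r = tnth (in_tuple s) k) -> False.
    move=> kl HH; apply: N; have k1 : (k.+1 < size s)%N := leq_ltn_trans kl (ltn_ord l).
    have [x0 _] : exists x0 : Fc * L, True by exists (tnth (in_tuple s) k).
    have := HH (Ordinal k1); rewrite /= leqnSn kl => /(_ isT).
    rewrite !(tnth_nth x0) /= => E; exists (take k s), (nth x0 s k), (drop k.+2 s).
    rewrite -{1}(cat_take_drop k s) (drop_nth x0) //.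
    by rewrite (drop_nth x0) // E.
  apply/val_inj/eqP; rewrite eqn_leq; apply/andP; split; rewrite leqNgt; apply/negP => lt.
    apply: (K _ _ lt) => r /andP[r1 r2]; transitivity (tnth (in_tuple s) i).
      by apply: H; rewrite (minn_idPr (ltnW lt)) (maxn_idPl (ltnW lt)) r1 r2.
    by apply/esym/H; rewrite (minn_idPr (ltnW lt)) (maxn_idPl (ltnW lt)) leqnn ltnW.
  by apply: (K _ _ lt) => r rr; apply: H; rewrite (minn_idPl (ltnW lt)) (maxn_idPr (ltnW lt)).
- apply/setP=> B; apply/idP/imsetP => [BP|[D DP ->]]; last by rewrite imset_id.
  by exists B; rewrite ?imset_id.
Qed.

(** Both words have a common reduction, so reduction invariance applies to each of them. *)
Lemma wt_dup (L : eqType) (u v : seq (Fc * L)) a :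
  wt (u ++ [:: a, a & v]) = wt (u ++ a :: v).
Proof.
have [m [g [q rd]]] := red_exists (u ++ a :: v).
have [_ [_ [red _]]] := adm.
rewrite /wt (red _ _ _ _ _ _ (kerp_part _) rd).
by rewrite (red _ _ _ _ _ _ (kerp_part _) (red_step rd)).
Qed.


Lemma sorted_enum_set n (S : {set 'I_n}) : sorted ltn (map val (enum S)).
Proof.
rewrite sorted_map; apply: (@sorted_filter _ (relpre val ltn)) => [y x z|]; first exact: ltn_trans.
by rewrite -sorted_map -enumT val_enum_ord iota_ltn_sorted.
Qed.

Lemma enum_val_ltn n (S : {set 'I_n}) (i j : 'I_#|S|) :
  (i < j)%N -> (enum_val i < enum_val j)%N.
Proof.
move=> ij; have x0 := enum_val i.
have H k : val (@enum_val _ (mem S) k) = nth (val x0) (map val (enum S)) k.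
  by rewrite (nth_map x0) -?enum_val_nth -?cardE.
rewrite !H; apply: (sorted_ltn_nth ltn_trans) => //; rewrite ?sorted_enum_set //.
  by rewrite inE size_map -cardE.
by rewrite inE size_map -cardE.
Qed.

(** The factorisation axiom for labelled words: renaming [l2] to [l1] joins the two blocks, and
    filtering by the two labels restricts to their union. *)
Lemma wt_split (L : eqType) (u v : seq (Fc * L)) q l1 l2 : l1 != l2 ->
  let s := u ++ [:: (q, l1), (q, l2) & v] in
  wt s = wt [seq (a.1, if a.2 == l2 then l1 else a.2) | a <- s] *
         wt [seq a <- s | a.2 \in [:: l1; l2]].
Proof.
move=> l12 s; have [_ [_ [_ [spl _]]]] := adm.
have su : (size u < size s)%N by rewrite size_cat /= !addnS ltnS; lia.
have su1 : ((size u).+1 < size s)%N by rewrite size_cat /= !addnS !ltnS leq_addr.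
pose i := Ordinal su; pose j := Ordinal su1.
pose t := tnth (in_tuple s); pose l r := (t r).2.
have Ei : t i = (q, l1) by rewrite /t (tnth_nth (q, l1)) /= nth_cat ltnn subnn.
have Ej : t j = (q, l2).
  by rewrite /t (tnth_nth (q, l1)) /= nth_cat ltnNge leqnSn subSn // subnn.
have li : l i = l1 by rewrite /l Ei.
have lj : l j = l2 by rewrite /l Ej.
pose b1 := [set r | l r == l1]; pose b2 := [set r | l r == l2].
have B1 : b1 \in kerp l by rewrite /b1 -li; apply: mem_kerp.
have B2 : b2 \in kerp l by rewrite /b2 -lj; apply: mem_kerp.
have ib1 : i \in b1 by rewrite inE li.
have jb2 : j \in b2 by rewrite inE lj.
have jb1 : j \notin b1 by rewrite inE lj eq_sym.
have b12 : b1 != b2 by apply: contraNneq jb1 => ->.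
have fij : lface s i = lface s j by rewrite !ffunE -/t; rewrite -/(t i) -/(t j) Ei Ej.
pose S := b1 :|: b2.
have rs : is_restr (lface s) S [set b1; b2] [ffun k => lface s (@enum_val _ (mem S) k)]
    (kerp (fun k => l (@enum_val _ (mem S) k))).
  exists (@enum_val _ (mem S)); split.
  - exact: enum_val_ltn.
  - move=> x; split=> [xS|[k <-]]; last exact: enum_valP.
    by exists (enum_rank_in xS x); rewrite enum_rankK_in.
  - by move=> k; rewrite ffunE.
  apply/setP=> B; apply/imsetP/imsetP => [[k _ ->]|[D + ->]].
    exists [set r | l r == l (@enum_val _ (mem S) k)]; last first.
      by apply/setP=> k'; rewrite !inE.
    have := enum_valP k; rewrite !inE => /orP[]/eqP->; by rewrite /b1 /b2 eqxx ?orbT.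
  rewrite !inE => /orP[]/eqP->.
    have iS : i \in S by rewrite inE ib1.
    exists (enum_rank_in iS i) => //; rewrite enum_rankK_in //.
    by apply/setP=> k'; rewrite !inE li.
  have jS : j \in S by rewrite inE jb2 orbT.
  exists (enum_rank_in jS j) => //; rewrite enum_rankK_in //.
  by apply/setP=> k'; rewrite !inE lj.
rewrite {1}/wt (spl _ (lface s) (kerp l) b1 b2 i j (kerp_part l) B1 B2 b12 ib1 jb2 erefl fij _ _ _ rs).
congr (_ * _).
  rewrite (@wtE _ _ _ (lface s) (fun r => if l r == l2 then l1 else l r)); last first.
    by rewrite {1}(map_tnthE s) -map_comp; apply: eq_map => r; rewrite /= ffunE.
  congr alpha; apply/setP=> B; rewrite !inE; apply/idP/imsetP.
    case/orP=> [/and3P[nb2 nb1 /imsetP[r _ E]]|/eqP->].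
      exists r => //.
      have lr2 : l r != l2 by apply: contraNneq nb2 => e; rewrite E e.
      have lr1 : l r != l1 by apply: contraNneq nb1 => e; rewrite E e.
      rewrite E; apply/setP=> r'; rewrite !inE (negbTE lr2).
      have [->|//] := eqVneq (l r') l2.
      by rewrite ![_ == l r]eq_sym (negbTE lr1) (negbTE lr2).
    exists i => //; apply/setP=> r'; rewrite !inE li /= (negbTE l12).
    by have [e|ne] := eqVneq (l r') l2; rewrite ?orbT ?eqxx ?orbF.
  move=> [r _ ->].
  have [lr|lr] := boolP (r \in S).
    apply/orP; right; apply/eqP/setP=> r'; rewrite !inE.
    have -> : (if l r == l2 then l1 else l r) = l1.
      by move: lr; rewrite !inE => /orP[/eqP->|->//]; rewrite (negbTE l12).
    by have [e|ne] := eqVneq (l r') l2; rewrite ?orbT ?eqxx ?orbF.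
  move: lr; rewrite !inE negb_or => /andP[lr1 lr2]; rewrite (negbTE lr2).
  have -> : [set j0 | (if l j0 == l2 then l1 else l j0) == l r] = [set j0 | l j0 == l r].
    apply/setP=> r'; rewrite !inE; have [->|//] := eqVneq (l r') l2.
    by rewrite ![_ == l r]eq_sym (negbTE lr1) (negbTE lr2).
  rewrite mem_kerp andbT; apply/orP; left; apply/andP; split.
    by apply: contraNneq lr2 => /setP/(_ j); rewrite jb2 inE lj => /esym; rewrite eq_sym.
  by apply: contraNneq lr1 => /setP/(_ i); rewrite ib1 inE li => /esym; rewrite eq_sym.
rewrite (@wtE _ _ _ [ffun k => lface s (@enum_val _ (mem S) k)] (fun k => l (@enum_val _ (mem S) k))) //.
rewrite {1}(map_tnthE s) filter_map.
have -> : [seq x <- enum 'I_(size s) | preim t (fun a => a.2 \in [:: l1; l2]) x] = enum S.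
  rewrite [RHS]/enum_mem /= {1}enumT; apply: eq_filter => r; rewrite /= !inE //.
have -> : enum S = [seq @enum_val _ (mem S) k | k <- enum 'I_#|S|].
  have Sx : i \in S by rewrite inE ib1.
  apply: (@eq_from_nth _ i); first by rewrite size_map size_enum_ord cardE.
  move=> k; rewrite -cardE => kS; rewrite (nth_map (Ordinal kS)) ?size_enum_ord //.
  by rewrite (enum_val_nth i) /= nth_enum_ord.
rewrite -map_comp; apply: eq_map => k; rewrite /= !ffunE.
by rewrite /l /t; case: (tnth _ _).
Qed.

End Weights.

(** * Enumerations of finite sets and sums over set partitions *)

Lemma enum_set_filter (T : finType) (A : {set T}) : enum A = [seq i <- enum T | i \in A].
Proof. by rewrite {1}/enum_mem -enumT. Qed.

(** The second hypothesis makes [h] respect the order of enumeration, so a subword does not change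
    when its index set is transported along [h]. *)
Lemma enum_imset (T U : finType) (h : T -> U) (S : {set U}) :
  injective h -> enum S = [seq h i | i <- enum T] ->
  forall B : {set T}, enum (h @: B) = [seq h i | i <- enum B].
Proof.
move=> hI ES B; have BS : h @: B \subset S.
  apply/subsetP=> _ /imsetP[i _ ->]; rewrite -mem_enum ES.
  by apply: map_f; rewrite mem_enum.
have -> : enum (h @: B) = [seq i <- enum S | i \in h @: B].
  rewrite !enum_set_filter -filter_predI; apply: eq_filter => i /=.
  by have [/(subsetP BS)->|] := boolP (i \in h @: B).
rewrite ES filter_map (enum_set_filter B); congr map; apply: eq_filter => i /=.
by rewrite mem_imset.
Qed.

(** A partition is the block of [x] together with a partition of the rest. A changed entry at [x] is
    then visible in that block only. *)
Lemma big_partition_pblock (V : nmodType) (T : finType) (S : {set T}) x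
    (f : {set {set T}} -> V) : x \in S ->
  \sum_(p : {set {set T}} | partition p S) f p =
  \sum_(B : {set T} | (x \in B) && (B \subset S))
    \sum_(q : {set {set T}} | partition q (S :\: B)) f (B |: q).
Proof.
move=> xS; rewrite (partition_big (fun p => pblock p x)
    (fun B => (x \in B) && (B \subset S))) /=; last first.
  move=> p pS; have xp : x \in cover p by rewrite (cover_partition pS).
  by rewrite mem_pblock xp (partitionS pS) // pblock_mem.
apply: eq_bigr => B /andP[xB BS].
rewrite (reindex_onto (fun q => B |: q) (fun p => p :\ B)) /=; last first.
  move=> p /andP[pS /eqP <-]; rewrite setD1K // pblock_mem //.
  by rewrite (cover_partition pS).
apply: eq_bigl => q; apply/idP/idP.
  move=> /andP[/andP[pS _] /eqP E]; rewrite -E.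
  by apply: partitionD1; rewrite // setU11.
move=> qS; have Bq : B \notin q.
  apply/negP=> /(partitionS qS)/subsetP/(_ x xB).
  by rewrite inE xB.
have pS : partition (B |: q) S.
  rewrite -(setID S B) (setIidPr BS); apply: partitionU1 => //.
    by apply/set0Pn; exists x.
  by rewrite disjoints_subset; apply/subsetP => i iB; rewrite !inE iB.
rewrite pS setU1K // eqxx andbT /=.
by apply/eqP/(def_pblock (partition_trivIset pS)) => //; rewrite setU11.
Qed.

(** ** Moments and cumulants *)

Section Cumulants.
Variables (R : realType) (Fc : finType) (alpha : wts R Fc).
Local Notation C := (complex R).
Local Notation wt := (wt alpha).

Definition sub (T : finType) (X : Type) (e : T -> X) (S : {set T}) : seq X :=
  [seq e i | i <- enum S].

Section Exp.
Variables (X : Type) (fc : X -> Fc).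

Definition pw (T : finType) (p : {set {set T}}) (S : {set T}) (e : T -> X) : C :=
  wt [seq (fc (e i), pblock p i) | i <- enum S].

(** The moment-cumulant sum indexed by a subset of any finite type, so that passing to subwords
    needs no renumbering; [pexpSE] shows that it depends on the subword alone. *)
Definition pexpS (K : seq X -> C) (T : finType) (S : {set T}) (e : T -> X) : C :=
  \sum_(p : {set {set T}} | partition p S) pw p S e * \prod_(B in p) K (sub e B).

Definition pexp (K : seq X -> C) (w : seq X) : C :=
  pexpS K [set: 'I_(size w)] (tnth (in_tuple w)).

Lemma sub_setT (w : seq X) : sub (tnth (in_tuple w)) [set: 'I_(size w)] = w.
Proof.
rewrite [RHS](map_tnthE w) /sub; congr map; rewrite enum_set_filter.
by rewrite (@eq_filter _ _ predT) ?filter_predT // => i; rewrite inE.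
Qed.

Lemma size_sub (T : finType) (e : T -> X) (S : {set T}) : size (sub e S) = #|S|.
Proof. by rewrite size_map cardE. Qed.

Lemma pexpSE K (T : finType) (S : {set T}) (e : T -> X) :
  pexpS K S e = pexp K (sub e S).
Proof.
pose w := sub e S; have sw : size w = #|S| by rewrite size_sub.
pose h (i : 'I_(size w)) := @enum_val _ (mem S) (cast_ord sw i).
have hI : injective h by move=> i j /enum_val_inj/cast_ord_inj.
have ES : enum S = [seq h i | i <- enum 'I_(size w)].
  case: (posnP (size w)) => [w0|w0].
    have -> : enum S = [::] by apply: size0nil; rewrite -cardE -sw.
    by rewrite [enum 'I_ _]size0nil // size_enum_ord.
  pose i0 := h (Ordinal w0); apply: (@eq_from_nth _ i0).
    by rewrite size_map size_enum_ord sw cardE.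
  move=> k; rewrite -cardE -sw => kw; rewrite (nth_map (Ordinal kw)) ?size_enum_ord //.
  by rewrite /h (enum_val_nth i0) /= nth_enum_ord.
have Eh i : tnth (in_tuple w) i = e (h i).
  rewrite (tnth_nth (e (h i))) /= [in LHS](nth_map (h i)).
    by congr e; rewrite [RHS]/h (enum_val_nth (h i)).
  by rewrite -cardE -sw ltn_ord.
have hT : h @: [set: 'I_(size w)] = S.
  apply/setP=> x; apply/imsetP/idP => [[i _ ->]|]; first exact: enum_valP.
  by rewrite -mem_enum ES => /mapP[i _ ->]; exists i.
have Esub (B : {set 'I_(size w)}) : sub e (h @: B) = sub (tnth (in_tuple w)) B.
  by rewrite /sub (enum_imset hI ES) -map_comp; apply: eq_map => i; rewrite Eh.
pose hh (p : {set {set 'I_(size w)}}) := [set h @: (B : {set _}) | B in p].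
rewrite -/w /pexp {1}/pexpS.
rewrite (reindex_onto hh (fun p => [set h @^-1: (B : {set _}) | B in p])) /=; last first.
  move=> p pS; rewrite /hh -imset_comp -[RHS]imset_id.
  apply: eq_in_imset => B Bp /=; apply/setP=> x; apply/imsetP/idP => [[i + ->]|xB].
    by rewrite inE.
  have : x \in S by apply: (subsetP (partitionS pS Bp)).
  by rewrite -hT => /imsetP[i _ xi]; exists i; rewrite // inE -xi.
apply: eq_big => [p|p].
  have -> : [set h @^-1: (B : {set _}) | B in hh p] = p.
    rewrite /hh -imset_comp -[RHS]imset_id; apply: eq_in_imset => B _ /=.
    by apply/setP=> i; rewrite inE mem_imset.
  by rewrite eqxx andbT -hT imset_partition.
move=> /andP[pS _]; have pT : partition p [set: 'I_(size w)].
  by move: pS; rewrite -hT imset_partition.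
congr (_ * _).
  rewrite /pw ES -map_comp enum_set_filter (@eq_filter _ _ predT) => [|i]; last by rewrite inE.
  rewrite filter_predT.
  apply: (@etrans _ _ (wt [seq (fc (e (h i)), pblock (hh p) (h i)) | i <- enum 'I_(size w)])) => //.
  apply: (@etrans _ _ (wt [seq (fc (e (h i)), pblock p i) | i <- enum 'I_(size w)])); last first.
    by congr wt; apply: eq_map => i; rewrite Eh.
  apply: wt_relabel.
  move=> i j _ _; have Ep k : pblock (hh p) (h k) = h @: pblock p k.
    apply: (def_pblock (partition_trivIset pS)).
      by apply: imset_f; rewrite pblock_mem // (cover_partition pT) inE.
    by rewrite mem_imset // mem_pblock (cover_partition pT) inE.
  by rewrite !Ep (inj_eq (imset_inj hI)).
rewrite big_imset /=; last by move=> A B _ _; apply: imset_inj.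
by apply: eq_bigr => B _; rewrite Esub.
Qed.

Lemma sub_nil (T : finType) (e : T -> X) (B : {set T}) : B != set0 -> nilp (sub e B) = false.
Proof. by rewrite /nilp size_sub cards_eq0 => /negbTE. Qed.

Lemma eq_in_sub (T : finType) (S : {set T}) (e e' : T -> X) :
  {in S, e =1 e'} -> sub e S = sub e' S.
Proof. by move=> E; apply/eq_in_map => i; rewrite mem_enum => /E. Qed.

Lemma eq_in_pw (T : finType) (S : {set T}) p (e e' : T -> X) :
  {in S, forall i, fc (e i) = fc (e' i)} -> pw p S e = pw p S e'.
Proof. by move=> E; congr wt; apply/eq_in_map => i; rewrite mem_enum => /E->. Qed.

Lemma eq_pexpS K K' (T : finType) (S : {set T}) (e : T -> X) :
  (forall B : {set T}, B != set0 -> B \subset S -> K (sub e B) = K' (sub e B)) ->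
  pexpS K S e = pexpS K' S e.
Proof.
move=> E; apply: eq_bigr => p pS; congr (_ * _); apply: eq_bigr => B Bp.
by rewrite E ?(partition_neq0 pS) ?(partitionS pS).
Qed.

Hypothesis adm : admissible alpha.

Lemma partition_set1 (T : finType) (S : {set T}) : S != set0 -> partition [set S] S.
Proof.
move=> S0; rewrite -[X in partition X](setU0 [set S]) -[X in partition _ X](setU0 S).
by apply: partitionU1 => //; rewrite ?partition_set0 // -setI_eq0 setI0.
Qed.

Lemma pw_set1 (T : finType) (S : {set T}) (e : T -> X) : S != set0 -> pw [set S] S e = 1.
Proof.
move=> S0; apply: wt_const => //.
  by rewrite -size_eq0 size_map -cardE cards_eq0.
have tr : trivIset [set S] := partition_trivIset (partition_set1 S0).
move=> _ _ /mapP[i + ->] /mapP[j + ->]; rewrite !mem_enum /= => iS jS.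
by rewrite !(def_pblock tr (set11 S)).
Qed.

Definition prest (K : seq X -> C) (T : finType) (S : {set T}) (e : T -> X) : C :=
  \sum_(p : {set {set T}} | partition p S && (p != [set S])) pw p S e * \prod_(B in p) K (sub e B).

Lemma pexpS_top K (T : finType) (S : {set T}) (e : T -> X) : S != set0 ->
  pexpS K S e = K (sub e S) + prest K S e.
Proof.
move=> S0; rewrite /pexpS (bigD1 [set S]) /=; last exact: partition_set1.
by rewrite pw_set1 // mul1r big_set1.
Qed.

Lemma partition_proper (T : finType) (S : {set T}) p (B : {set T}) :
  partition p S -> p != [set S] -> B \in p -> B \proper S.
Proof.
move=> pS pN Bp; rewrite properEneq (partitionS pS Bp) andbT.
apply: contraNneq pN => BS; rewrite eqEsubset; apply/andP; split; last first.
  by rewrite sub1set -BS.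
apply/subsetP=> D Dp; rewrite inE; apply/negPn/negP => DS.
have /trivIsetP tr := partition_trivIset pS.
have /set0Pn[x xD] := partition_neq0 pS Dp.
have := tr D B Dp Bp; rewrite BS => /(_ DS); rewrite disjoint_subset => /subsetP/(_ x xD).
by rewrite inE (subsetP (partitionS pS Dp) x xD).
Qed.

Lemma eq_prest K K' (T : finType) (S : {set T}) (e : T -> X) :
  (forall B : {set T}, B != set0 -> B \proper S -> K (sub e B) = K' (sub e B)) ->
  prest K S e = prest K' S e.
Proof.
move=> E; apply: eq_bigr => p /andP[pS pN]; congr (_ * _); apply: eq_bigr => B Bp.
by rewrite E ?(partition_neq0 pS) ?(partition_proper pS).
Qed.

(** Solves the moment-cumulant formula for the cumulant of the full word: [prest] involves only
    proper, hence shorter, subwords. [n] is fuel, and the result is the same once it reaches the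
    length. *)
Fixpoint plog_rec (n : nat) (M : seq X -> C) (w : seq X) : C :=
  if n is n'.+1 then
    M w - prest (plog_rec n' M) [set: 'I_(size w)] (tnth (in_tuple w))
  else 0.

Definition plog (M : seq X -> C) (w : seq X) : C := plog_rec (size w) M w.

Lemma setT_neq0 (w : seq X) : ~~ nilp w -> [set: 'I_(size w)] != set0.
Proof. by rewrite -cards_eq0 cardsT card_ord. Qed.

Lemma plog_rec_stable n m M w : ~~ nilp w -> (size w <= n)%N -> (size w <= m)%N ->
  plog_rec n M w = plog_rec m M w.
Proof.
elim: n m w => [|n IH] [|m] w w0; rewrite ?leqn0 -?/(nilp w) ?(negbTE w0) // => wn wm /=.
congr (_ - _); apply: eq_prest => B B0 /proper_card.
rewrite cardsT card_ord -(size_sub (tnth (in_tuple w))) => sB.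
by apply: IH; rewrite ?sub_nil // -ltnS (leq_trans sB).
Qed.

Lemma plogE M w : ~~ nilp w ->
  plog M w = M w - prest (plog M) [set: 'I_(size w)] (tnth (in_tuple w)).
Proof.
move=> w0; rewrite {1}/plog (@plog_rec_stable _ (size w).+1) //=.
congr (_ - _); apply: eq_prest => B B0 /proper_card.
rewrite cardsT card_ord -(size_sub (tnth (in_tuple w))) => sB.
by apply: plog_rec_stable; rewrite ?sub_nil // ltnW.
Qed.

Lemma pexp_plog M w : ~~ nilp w -> pexp (plog M) w = M w.
Proof.
move=> w0; rewrite /pexp pexpS_top ?setT_neq0 // sub_setT plogE //.
by rewrite subrK.
Qed.

(* [pexp] is unitriangular with respect to the length of words. *)
Lemma pexp_inj (P : seq X -> Prop) K K' :
  (forall (w : seq X) (S : {set 'I_(size w)}), P w -> P (sub (tnth (in_tuple w)) S)) ->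
  (forall w, ~~ nilp w -> P w -> pexp K w = pexp K' w) ->
  forall w, ~~ nilp w -> P w -> K w = K' w.
Proof.
move=> Psub E w; have [n] := ubnP (size w); elim: n w => // n IH w wn w0 Pw.
have := E w w0 Pw; rewrite /pexp !pexpS_top ?setT_neq0 // !sub_setT.
rewrite (@eq_prest K K'); first by move/addIr.
move=> B B0 /proper_card; rewrite cardsT card_ord -(size_sub (tnth (in_tuple w))) => sB.
by apply: IH; rewrite ?sub_nil //; [apply: leq_trans sB _ | apply: Psub].
Qed.

End Exp.
End Cumulants.

(** ** Multilinearity and merging of neighbouring entries *)

Section Multilinearity.
Variables (R : realType) (Fc : finType) (alpha : wts R Fc).
Hypothesis adm : admissible alpha.
Local Notation C := (complex R).
Local Notation wt := (wt alpha).
Local Notation pw := (pw alpha).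
Local Notation pexp := (pexp alpha).
Local Notation pexpS := (pexpS alpha).
Local Notation plog := (plog alpha).

Lemma pexp_map (X Y : Type) (fX : X -> Fc) (fY : Y -> Fc) (g : X -> Y) K w :
  (forall x, fY (g x) = fX x) -> pexp fY K (map g w) = pexp fX (fun v => K (map g v)) w.
Proof.
move=> fg; have E (T : finType) (e : T -> X) (S : {set T}) : map g (sub e S) = sub (g \o e) S.
  by rewrite /sub -map_comp.
rewrite -{1}(sub_setT w) E -pexpSE /pexp /pexpS; apply: eq_bigr => p _; congr (_ * _).
  by congr wt; apply: eq_map => i; rewrite /= fg.
by apply: eq_bigr => B _; rewrite E.
Qed.

Lemma all_sub (X : Type) (P : pred X) (w : seq X) (S : {set 'I_(size w)}) :
  all P w -> all P (sub (tnth (in_tuple w)) S).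
Proof.
move=> Pw; rewrite all_map; apply/allP => i _ /=.
by move: Pw; rewrite {1}(map_tnthE w) all_map => /allP; apply; rewrite mem_enum.
Qed.

Lemma plog_map (X Y : Type) (fX : X -> Fc) (fY : Y -> Fc) (g : X -> Y) M w :
  (forall x, fY (g x) = fX x) -> ~~ nilp w ->
  plog fY M (map g w) = plog fX (fun v => M (map g v)) w.
Proof.
move=> fg w0; apply: (@pexp_inj _ _ alpha _ fX adm (fun _ => True)
  (fun v => plog fY M (map g v))) w0 I => // v v0 _.
have gv0 : ~~ nilp (map g v) by rewrite /nilp size_map.
by rewrite -(pexp_map (plog fY M) _ fg); rewrite !(pexp_plog _ adm).
Qed.

Lemma eq_pexp_in (X : Type) (fX : X -> Fc) (P : seq X -> Prop) K K' :
  (forall (w : seq X) (S : {set 'I_(size w)}), P w -> P (sub (tnth (in_tuple w)) S)) ->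
  (forall w, ~~ nilp w -> P w -> K w = K' w) ->
  forall w, P w -> pexp fX K w = pexp fX K' w.
Proof.
move=> Psub E w Pw; apply: eq_pexpS => B B0 _; apply: E; rewrite ?sub_nil //.
exact: Psub.
Qed.

(* Determines the top block of a sum over partitions once all such sums over
   smaller sets are known. *)
Lemma pointed_sum0 (T : finType) (x : T) (W : {set {set T}} -> {set T} -> C)
    (d : {set T} -> C) (r : {set {set T}} -> C) :
  (forall S, S != set0 -> W [set S] S = 1) -> r set0 = 1 ->
  forall S0 : {set T},
  (forall S : {set T}, x \in S -> S \subset S0 ->
     \sum_(B : {set T} | (x \in B) && (B \subset S))
       \sum_(q : {set {set T}} | partition q (S :\: B)) W (B |: q) S * (d B * r q) = 0) ->
  x \in S0 -> d S0 = 0.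
Proof.
move=> W1 r1 S0; have [n] := ubnP #|S0|; elim: n S0 => // n IH S Sn H xS.
have := H S xS (subxx S); rewrite (bigD1 S) ?xS ?subxx //= [X in _ + X]big1 => [|B].
  rewrite addr0 setDv (eq_bigl (fun q => q == set0)) => [|q]; last by rewrite partition_set0.
  rewrite big_pred1_eq setU0 W1 ?mul1r ?r1 ?mulr1 //.
  by apply/set0Pn; exists x.
move=> /andP[/andP[xB BS] BnS]; apply: big1 => q _; rewrite (IH B) ?mul0r ?mulr0 //.
  by rewrite -ltnS (leq_trans _ Sn) // ltnS proper_card // properEneq BnS.
by move=> S' xS' S'B; apply: H => //; apply: subset_trans BS.
Qed.

Lemma pexpS_split (X : Type) (fX : X -> Fc) K (T : finType) (S : {set T}) x (e : T -> X) :
  x \in S -> pexpS fX K S e =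
  \sum_(B : {set T} | (x \in B) && (B \subset S))
    \sum_(q : {set {set T}} | partition q (S :\: B))
      pw fX (B |: q) S e * (K (sub e B) * \prod_(D in q) K (sub e D)).
Proof.
move=> xS; rewrite /pexpS (big_partition_pblock _ xS).
apply: eq_bigr => B /andP[xB BS]; apply: eq_bigr => q qS; congr (_ * _).
rewrite big_setU1 //; apply/negP=> /(partitionS qS)/subsetP/(_ x xB).
by rewrite inE xB.
Qed.

Section Linear.
Variables (X : Type) (fX : X -> Fc) (T : finType) (x : T) (e1 e2 e3 : T -> X) (c : C).
Hypotheses (E13 : forall i, i != x -> e1 i = e3 i) (E23 : forall i, i != x -> e2 i = e3 i).
Hypotheses (F13 : fX (e1 x) = fX (e3 x)) (F23 : fX (e2 x) = fX (e3 x)).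

(** Only the block containing [x] sees the entry that varies, so the linearity defect of the moments
    is a pointed sum of the defects of the cumulants. Read forwards it makes moments linear; with
    [pointed_sum0] it makes cumulants linear. *)
Lemma pexpS_lin_defect K (S : {set T}) : x \in S ->
  pexpS fX K S e3 - c * pexpS fX K S e1 - pexpS fX K S e2 =
  \sum_(B : {set T} | (x \in B) && (B \subset S))
    \sum_(q : {set {set T}} | partition q (S :\: B))
      pw fX (B |: q) S e3 * ((K (sub e3 B) - c * K (sub e1 B) - K (sub e2 B)) *
        \prod_(D in q) K (sub e3 D)).
Proof.
move=> xS; rewrite !(pexpS_split _ _ _ xS) mulr_sumr -!sumrB; apply: eq_bigr => B /andP[xB BS].
rewrite mulr_sumr -!sumrB; apply: eq_bigr => q qS.
have xD D : D \in q -> x \notin D.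
  by move=> /(partitionS qS)/subsetP sD; apply/negP => /sD; rewrite inE xB.
have P1 : \prod_(D in q) K (sub e1 D) = \prod_(D in q) K (sub e3 D).
  apply: eq_bigr => D /xD xD'; congr K; apply: eq_in_sub => i iD; apply: E13.
  by apply: contraNneq xD' => <-.
have P2 : \prod_(D in q) K (sub e2 D) = \prod_(D in q) K (sub e3 D).
  apply: eq_bigr => D /xD xD'; congr K; apply: eq_in_sub => i iD; apply: E23.
  by apply: contraNneq xD' => <-.
have W1 : pw fX (B |: q) S e1 = pw fX (B |: q) S e3.
  by apply: eq_in_pw => i _; have [->|/E13->] := eqVneq i x.
have W2 : pw fX (B |: q) S e2 = pw fX (B |: q) S e3.
  by apply: eq_in_pw => i _; have [->|/E23->] := eqVneq i x.
rewrite P1 P2 W1 W2; move: (pw _ _ _ _) (\prod_(_ in _) _) (K _) (K _) (K _).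
by move=> w P k1 k2 k3; rewrite !mulrBl !mulrBr; congr (_ - _ - _); rewrite -!mulrA mulrCA.
Qed.

Lemma pexpS_lin K (S : {set T}) : x \in S ->
  (forall B : {set T}, x \in B -> B \subset S ->
     K (sub e3 B) = c * K (sub e1 B) + K (sub e2 B)) ->
  pexpS fX K S e3 = c * pexpS fX K S e1 + pexpS fX K S e2.
Proof.
move=> xS H; apply/eqP; rewrite -subr_eq0 opprD addrA pexpS_lin_defect //.
apply/eqP; apply: big1 => B /andP[xB BS]; apply: big1 => q _.
by rewrite H // -[_ - _ - _]addrA -opprD subrr mul0r mulr0.
Qed.

Lemma pexpS_lin_inv K (S : {set T}) : x \in S ->
  (forall B : {set T}, x \in B -> B \subset S ->
     pexpS fX K B e3 = c * pexpS fX K B e1 + pexpS fX K B e2) ->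
  K (sub e3 S) = c * K (sub e1 S) + K (sub e2 S).
Proof.
move=> xS H; apply/eqP; rewrite -subr_eq0 opprD addrA; apply/eqP.
apply: (@pointed_sum0 T x (fun p S => pw fX p S e3)
  (fun B => K (sub e3 B) - c * K (sub e1 B) - K (sub e2 B))
  (fun q => \prod_(D in q) K (sub e3 D))) xS => [D D0||D xD DS].
- exact: pw_set1.
- by rewrite big_set0.
by rewrite -pexpS_lin_defect // H // -[_ - _ - _]addrA -opprD subrr.
Qed.
End Linear.

Lemma enum_split (T : finType) (S : {set T}) x : x \in S ->
  exists U V, [/\ enum S = U ++ x :: V, x \notin U & x \notin V].
Proof.
rewrite -mem_enum => xS; have := enum_uniq (mem S).
case/splitPr: xS => U V; rewrite cat_uniq /= => /and4P[_ /norP[xU _] xV _].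
by exists U, V.
Qed.

Lemma eq_map_notin (T : eqType) (X : Type) (e e' : T -> X) x (U : seq T) :
  (forall i, i != x -> e i = e' i) -> x \notin U -> map e U = map e' U.
Proof.
move=> E xU; apply/eq_in_map => i iU; apply: E.
by apply: contraNneq xU => <-.
Qed.

Section Algebra.
Variables (A : nalg R) (J : eqType) (fJ : J -> Fc).
Local Notation X := (J * A)%type.
Local Notation fX := (fun p : X => fJ p.1).

Lemma multilinear_sub (M : seq X -> C) (T : finType) (S : {set T}) x (e1 e2 e3 : T -> X) j c a b :
  multilinear_words M -> x \in S ->
  (forall i, i != x -> e1 i = e3 i) -> (forall i, i != x -> e2 i = e3 i) ->
  e1 x = (j, a) -> e2 x = (j, b) -> e3 x = (j, c *: a + b) ->
  M (sub e3 S) = c * M (sub e1 S) + M (sub e2 S).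
Proof.
move=> ML xS E1 E2 x1 x2 x3; have [U [V [ES xU xV]]] := enum_split xS.
rewrite /sub ES !map_cat /= x1 x2 x3 ML.
by rewrite !(eq_map_notin E1) // !(eq_map_notin E2).
Qed.

Lemma sub_tnth_set (Y : Type) (u v : seq Y) y0 (z : Y) (i0 : 'I_(size (u ++ y0 :: v))) :
  val i0 = size u ->
  sub (fun i => if i == i0 then z else tnth (in_tuple (u ++ y0 :: v)) i)
    [set: 'I_(size (u ++ y0 :: v))] = u ++ z :: v.
Proof.
move=> Ei; apply: (@eq_from_nth _ y0).
  by rewrite size_sub cardsT card_ord !size_cat.
move=> k; rewrite size_sub cardsT card_ord => kn.
rewrite (nth_map i0) -?cardE ?cardsT ?card_ord // enum_set_filter.
rewrite (@eq_filter _ _ predT) => [|i]; last by rewrite inE.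
rewrite filter_predT (nth_ord_enum i0 (Ordinal kn)) -val_eqE /= Ei.
rewrite (tnth_nth y0) /= !nth_cat; case: eqP => [->|kN].
  by rewrite ltnn subnn.
case: ltnP => // ku; have : (size u < k)%N by rewrite ltn_neqAle ku andbT eq_sym; apply/eqP.
by rewrite -subn_gt0; case: (k - size u)%N.
Qed.

Lemma multilinear_pexp K : multilinear_words K -> multilinear_words (pexp fX K).
Proof.
move=> KL u v j c a b; pose w := u ++ (j, 0 : A) :: v.
have su : (size u < size w)%N by rewrite size_cat /= addnS ltnS leq_addr.
pose i0 := Ordinal su; pose e z (i : 'I_(size w)) := if i == i0 then (j, z) else tnth (in_tuple w) i.
have Ew z : u ++ (j, z) :: v = sub (e z) [set: 'I_(size w)] by rewrite sub_tnth_set.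
have off y z i : i != i0 -> e y i = e z i by rewrite /e => /negbTE->.
have at0 y : e y i0 = (j, y) by rewrite /e eqxx.
rewrite !Ew -!pexpSE; apply: (@pexpS_lin X fX _ i0 (e a) (e b) (e (c *: a + b)) c);
  rewrite ?at0 ?inE //; try exact: off.
by move=> B iB _; apply: (multilinear_sub KL iB) => //; exact: off.
Qed.

Lemma multilinear_plog M : multilinear_words M -> multilinear_words (plog fX M).
Proof.
move=> ML u v j c a b; pose w := u ++ (j, 0 : A) :: v.
have su : (size u < size w)%N by rewrite size_cat /= addnS ltnS leq_addr.
pose i0 := Ordinal su; pose e z (i : 'I_(size w)) := if i == i0 then (j, z) else tnth (in_tuple w) i.
have Ew z : u ++ (j, z) :: v = sub (e z) [set: 'I_(size w)] by rewrite sub_tnth_set.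
have off y z i : i != i0 -> e y i = e z i by rewrite /e => /negbTE->.
have at0 y : e y i0 = (j, y) by rewrite /e eqxx.
rewrite !Ew; apply: (@pexpS_lin_inv X fX _ i0 (e a) (e b) (e (c *: a + b)) c);
  rewrite ?at0 ?inE //; try exact: off.
move=> B iB _; have B0 : B != set0 by apply/set0Pn; exists i0.
rewrite !pexpSE !(pexp_plog _ adm) ?sub_nil //.
by apply: (multilinear_sub ML iB) => //; exact: off.
Qed.


(** Neighbours [x] and [y] of the whole type remain neighbours in every subset containing both. *)
Lemma enum_adj (T : finType) (U V : seq T) x y (S : {set T}) :
  enum T = U ++ [:: x, y & V] -> x \in S -> y \notin S ->
  exists U' V', [/\ enum S = U' ++ x :: V', enum (y |: S) = U' ++ [:: x, y & V']
    & (x \notin U') && (y \notin U') && (x \notin V') && (y \notin V')].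
Proof.
move=> ET xS yS; have := enum_uniq T; rewrite ET cat_uniq /= inE !negb_or.
move=> /and5P[_ /and3P[xU yU _] /andP[_ xV] yV _].
have H W : y \notin W -> [seq i <- W | i \in y |: S] = [seq i <- W | i \in S].
  by move=> yW; apply: eq_in_filter => i iW; rewrite !inE; case: eqP iW yW => [->->|].
exists [seq i <- U | i \in S], [seq i <- V | i \in S].
split; rewrite ?enum_set_filter ?ET ?filter_cat /= ?xS ?(negbTE yS) //.
  by rewrite setU11 !inE xS orbT !H.
by rewrite !mem_filter !negb_and xU yU xV yV !orbT.
Qed.

Lemma pblockU1 (T : finType) (S B : {set T}) q x i : partition q (S :\: B) ->
  x \in B -> B \subset S -> i \in S ->
  pblock (B |: q) i = if i \in B then B else pblock q i.
Proof.
move=> qS xB BS iS; have pS : partition (B |: q) S.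
  rewrite -(setID S B) (setIidPr BS); apply: partitionU1 => //.
    by apply/set0Pn; exists x.
  by rewrite disjoints_subset; apply/subsetP => k kB; rewrite !inE kB.
have [iB|iB] := boolP (i \in B).
  by apply: (def_pblock (partition_trivIset pS)) => //; rewrite setU11.
have ic : i \in cover q by rewrite (cover_partition qS) inE iB.
apply: (def_pblock (partition_trivIset pS)); last by rewrite mem_pblock.
by rewrite inE pblock_mem ?orbT.
Qed.

Lemma pblock_out (T : finType) (S B : {set T}) q i : partition q (S :\: B) ->
  i \in S -> i \notin B -> pblock q i != B.
Proof.
move=> qS iS iB; have ic : i \in cover q by rewrite (cover_partition qS) inE iB.
by apply: contraNneq iB => <-; rewrite mem_pblock.
Qed.

Section Merge.
Variables (T : finType) (U V : seq T) (x y : T) (e e' : T -> X) (K : seq X -> C).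
Hypotheses (ET : enum T = U ++ [:: x, y & V]) (Ee : forall i, i != x -> e' i = e i).
Hypotheses (Fxy : fX (e x) = fX (e y)) (Fx : fX (e' x) = fX (e x)).

Let Fe i : fX (e' i) = fX (e i).
Proof. by have [->|/Ee->] := eqVneq i x. Qed.

Let xy : x != y.
Proof.
have := enum_uniq T; rewrite ET cat_uniq /= => /and3P[_ _ /andP[+ _]].
by rewrite inE negb_or => /andP[].
Qed.

(* [D] and [y |: (B :\: D)] are the two halves of a splitting of [y |: B] separating
   the neighbours [x] and [y]; in [e'], the entry at [x] is their product and [y] is unused. *)
Definition split_sum (B : {set T}) : C :=
  \sum_(D : {set T} | (x \in D) && (D \subset B))
    wt [seq (fX (e i), i \in D) | i <- enum (y |: B)] *
      (K (sub e D) * K (sub e (y |: (B :\: D)))).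

Definition merge_defect (B : {set T}) : C :=
  K (sub e' B) - K (sub e (y |: B)) - split_sum B.

(** The block of [x] gets the label [None] instead of itself; the label then survives when the block
    is enlarged by [y]. *)
Lemma pw_lab (S B : {set T}) q (d : T -> X) : partition q (S :\: B) -> x \in B -> B \subset S ->
  pw fX (B |: q) S d =
  wt [seq (fX (d i), if i \in B then None else Some (pblock q i)) | i <- enum S].
Proof.
move=> qS xB BS; apply: wt_relabel => i j; rewrite !mem_enum => iS jS.
rewrite !(pblockU1 qS xB BS) //.
have [iB|iB] := boolP (i \in B); have [jB|jB] := boolP (j \in B); rewrite ?eqxx //.
  by rewrite eq_sym (negbTE (pblock_out qS jS jB)).
by rewrite (negbTE (pblock_out qS iS iB)).
Qed.

(** The neighbours [x] and [y] have the same face and lie in the same block, so reduction removes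
    [y]. *)
Lemma wt_lab_merge (S B : {set T}) q : x \in B -> B \subset S -> y \notin S ->
  partition q (S :\: B) ->
  wt [seq (fX (e i), if i \in y |: B then None else Some (pblock q i)) | i <- enum (y |: S)] =
  pw fX (B |: q) S e'.
Proof.
move=> xB BS yS qS; rewrite pw_lab //.
have xS := subsetP BS x xB; have yB : y \notin B by apply: contra yS; apply: (subsetP BS).
have [U' [V' [-> -> /andP[/andP[/andP[xU yU] xV] yV]]]] := enum_adj ET xS yS.
rewrite !map_cat /= setU11 setU1r // xB Fx Fxy wt_dup // ; congr (wt (_ ++ _ :: _)).
  apply/eq_in_map => i iU; rewrite Fe in_setU1; case: eqP => // iy.
  by rewrite -iy iU in yU.
apply/eq_in_map => i iU; rewrite Fe in_setU1; case: eqP => // iy.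
by rewrite -iy iU in yV.
Qed.

Lemma pw_joined (S B : {set T}) q : x \in B -> B \subset S -> y \notin S ->
  partition q (S :\: B) -> pw fX ((y |: B) |: q) (y |: S) e = pw fX (B |: q) S e'.
Proof.
move=> xB BS yS qS; rewrite pw_lab ?wt_lab_merge ?setU1r ?setUS //.
by have -> : (y |: S) :\: (y |: B) = S :\: B
  by apply/setP=> i; rewrite !inE; case: eqP => [->|//]; rewrite (negbTE yS) andbF.
Qed.

(** Here [x] and [y] are neighbours of equal face in different blocks. By [wt_split] the weight is
    that of the joined block [y |: B], from which reduction removes [y], times the weight of the two
    halves alone. *)
Lemma pw_separated (S B D : {set T}) q : x \in D -> D \subset B -> B \subset S -> y \notin S ->
  partition q (S :\: B) ->
  pw fX (D |: ((y |: (B :\: D)) |: q)) (y |: S) e =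
  pw fX (B |: q) S e' * wt [seq (fX (e i), i \in D) | i <- enum (y |: B)].
Proof.
move=> xD DB BS yS qS; set B2 := y |: (B :\: D).
have xB := subsetP DB x xD; have xS := subsetP BS x xB.
have yB : y \notin B by apply: contra yS; apply: (subsetP BS).
have yD : y \notin D by apply: contra yB; apply: (subsetP DB).
have q2 : partition q ((y |: S) :\: D :\: B2).
  have -> // : (y |: S) :\: D :\: B2 = S :\: B.
  apply/setP=> i; rewrite !inE; case: eqP => [->|_] /=.
    by rewrite (negbTE yS) andbF.
  move: (subsetP DB i); case: (i \in D) => [/(_ isT)->|_] //=.
have yB2 : y \in B2 by rewrite setU11.
have B2S : B2 \subset (y |: S) :\: D.
  apply/subsetP=> i; rewrite !inE => /orP[/eqP->|/andP[-> /(subsetP BS)->]]; last by rewrite orbT.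
  by rewrite eqxx yD.
have qD : partition (B2 |: q) ((y |: S) :\: D).
  rewrite -(setID ((y |: S) :\: D) B2) (setIidPr B2S); apply: partitionU1 => //.
    by apply/set0Pn; exists y.
  by rewrite disjoints_subset; apply/subsetP => k kB; rewrite in_setC in_setD kB.
rewrite pw_lab //; last by apply: subset_trans DB (subset_trans BS (subsetUr _ _)).
pose lab i : bool + {set T} := if i \in D then inl true else if i \in B2 then inl false
   else inr (pblock q i).
rewrite (@wt_relabel _ _ alpha _ _ _ _ _ lab); last first.
  move=> i j; rewrite !mem_enum => iS jS; rewrite /lab.
  have [iD|iD] := boolP (i \in D); have [jD|jD] := boolP (j \in D); rewrite ?eqxx //;
    try by case: ifP.
  have iS2 : i \in (y |: S) :\: D by rewrite in_setD iD.
  have jS2 : j \in (y |: S) :\: D by rewrite in_setD jD.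
  rewrite (pblockU1 q2 yB2 B2S iS2) (pblockU1 q2 yB2 B2S jS2).
  have [iB|iB] := boolP (i \in B2); have [jB|jB] := boolP (j \in B2).
  - by rewrite !eqxx.
  - by rewrite [Some _ == _](_ : _ = (B2 == pblock q j)) // eq_sym (negbTE (pblock_out q2 jS2 jB)).
  - by rewrite [Some _ == _](_ : _ = (pblock q i == B2)) // (negbTE (pblock_out q2 iS2 iB)).
  - by [].
have BD i : (i \in y |: B) = (i \in D) || (i \in B2).
  rewrite !inE; have [iD|iD] := boolP (i \in D); rewrite ?(subsetP DB _ iD) ?orbT //=.
have [U' [V' [ES ES' /andP[/andP[/andP[xU yU] xV] yV]]]] := enum_adj ET xS yS.
have := @wt_split _ _ alpha adm (bool + {set T})%type
  [seq (fX (e i), lab i) | i <- U'] [seq (fX (e i), lab i) | i <- V'] (fX (e x)) (inl true) (inl false) isT.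
have -> : [seq (fX (e i), lab i) | i <- U'] ++ [:: (fX (e x), inl true), (fX (e x), inl false) &
     [seq (fX (e i), lab i) | i <- V']] = [seq (fX (e i), lab i) | i <- enum (y |: S)].
  by rewrite ES' map_cat /= /lab xD (negbTE yD) yB2 -Fxy.
move=> ->; congr (_ * _).
  rewrite -wt_lab_merge // -map_comp.
  rewrite [LHS](@wt_relabel _ _ alpha _ _ _ (fun i => fX (e i))
    (fun i => if lab i == inl false then inl true else lab i)
    (fun i => if i \in y |: B then None else Some (pblock q i))) //.
  move=> i j _ _; rewrite !BD /lab.
  by case: (i \in D); case: (j \in D); case: (i \in B2); case: (j \in B2).
rewrite filter_map.
have -> : [seq i <- enum (y |: S) | preim (fun i => (fX (e i), lab i)) (fun a => a.2 \in [:: inl true; inl false]) i]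
    = enum (y |: B).
  rewrite !(enum_set_filter (y |: _)) -filter_predI; apply: eq_filter => i /=.
  rewrite BD /lab !inE.
  have [iD|iD] := boolP (i \in D).
    by rewrite (subsetP BS _ (subsetP DB _ iD)) orbT.
  rewrite /=; have [|] := boolP (i == y) => //= _.
  have [iB|] //= := boolP (i \in B).
  by rewrite (subsetP BS _ iB).
apply: wt_relabel => i j; rewrite !mem_enum !BD /lab.
by case: (i \in D); case: (j \in D); case: (i \in B2); case: (j \in B2).
Qed.


(** Partitions of [y |: S] are sorted by whether [y] lies in the block of [x]. If it does, deleting
    [y] gives a partition of [S]. If not, joining the two blocks and deleting [y] gives one, and the
    ways of cutting its block at [x] again add up to [split_sum]. *)
Lemma pexpS_merge_defect (S : {set T}) : x \in S -> y \notin S ->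
  pexpS fX K S e' - pexpS fX K (y |: S) e =
  \sum_(B : {set T} | (x \in B) && (B \subset S))
    \sum_(q : {set {set T}} | partition q (S :\: B))
      pw fX (B |: q) S e' * (merge_defect B * \prod_(D in q) K (sub e' D)).
Proof.
move=> xS yS; pose G p := pw fX p (y |: S) e * \prod_(B in p) K (sub e B).
have joined : \sum_(B : {set T} | (x \in B) && (B \subset y |: S) && (y \in B))
      \sum_(q : {set {set T}} | partition q ((y |: S) :\: B)) G (B |: q) =
    \sum_(B : {set T} | (x \in B) && (B \subset S))
      \sum_(q : {set {set T}} | partition q (S :\: B)) G ((y |: B) |: q).
  rewrite (reindex_onto (fun B => y |: B) (fun B => B :\ y)) /=; last first.
    by move=> B /andP[_ yB]; rewrite setD1K.
  apply: eq_big => [B|B].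
    apply/idP/idP => [/andP[/andP[/andP[xB BS] _] /eqP E]|/andP[xB BS]].
      move: xB BS; rewrite -E !inE (negbTE xy) /= => -> /subsetP sB.
      by apply/subsetP=> i; rewrite !inE => /andP[iy iB]; move: (sB i); rewrite !inE iB (negbTE iy); apply.
    rewrite setU1r // setUS // setU11 /= setU1K //.
    by apply: contra yS; apply: (subsetP BS).
  move=> /andP[/andP[/andP[xB BS] _] /eqP E].
  suff -> : (y |: S) :\: (y |: B) = S :\: B by [].
  by apply/setP=> i; rewrite !inE; case: eqP => [->|//]; rewrite (negbTE yS) andbF.
have separated : \sum_(D : {set T} | (x \in D) && (D \subset y |: S) && (y \notin D))
      \sum_(q : {set {set T}} | partition q ((y |: S) :\: D)) G (D |: q) =
    \sum_(B : {set T} | (x \in B) && (B \subset S))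
      \sum_(D : {set T} | (x \in D) && (D \subset B))
        \sum_(q : {set {set T}} | partition q (S :\: B)) G (D |: ((y |: (B :\: D)) |: q)).
  rewrite [RHS](exchange_big_dep (fun D : {set T} => (x \in D) && (D \subset S))) /=; last first.
    by move=> B D /andP[_ BS] /andP[-> DB]; rewrite (subset_trans DB BS).
  apply: eq_big => [D|D].
    apply/idP/idP => [/andP[/andP[-> DS] yD]|/andP[-> DS]] /=.
      apply/subsetP=> i iD; move: (subsetP DS i iD); rewrite !inE => /orP[/eqP iy|//].
      by rewrite -iy iD in yD.
    rewrite (subset_trans DS (subsetUr _ _)) /=.
    by apply: contra yS; apply: (subsetP DS).
  move=> /andP[/andP[xD DS] yD].
  have yDS : y \in (y |: S) :\: D by rewrite !inE eqxx yD.
  have DS' : D \subset S.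
    apply/subsetP=> i iD; move: (subsetP DS i iD); rewrite !inE => /orP[/eqP iy|//].
    by rewrite -iy iD in yD.
  rewrite (big_partition_pblock _ yDS).
  (* [B2] is the block of [y]; united with the block [D] of [x] and deprived of [y] it is the block
     [B] of [x] in a partition of [S]. *)
  rewrite (reindex_onto (fun B => y |: (B :\: D)) (fun B2 => D :|: (B2 :\ y))) /=; last first.
    move=> B2 /andP[yB2 /subsetP B2S]; apply/setP=> i; rewrite !inE.
    case: eqP => [->|_] //=; move: (B2S i); rewrite !inE.
    by case: (i \in D); case: (i \in B2) => // /(_ isT).
  apply: eq_big => [B|B].
    apply/idP/idP => [/andP[/andP[_ /subsetP B2S] /eqP E]|/andP[/andP[xB BS] /andP[_ DB]]].
      have DB : D \subset B by rewrite -E subsetUl.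
      rewrite xD (subsetP DB x xD) DB /= andbT.
      apply/subsetP=> i iB; have [iD|iD] := boolP (i \in D); first exact: (subsetP DS').
      have iy : i != y by move: iB; rewrite -E !inE (negbTE iD) /= => /andP[].
      by move: (B2S i); rewrite !inE iB iD (negbTE iy) /=; apply.
    rewrite setU11 /=; apply/andP; split.
      apply/subsetP=> i; rewrite !inE => /orP[/eqP->|/andP[-> /(subsetP BS)->]]; last by rewrite orbT.
      by rewrite eqxx yD.
    have yB : y \notin B by apply: contra yS; apply: (subsetP BS).
    apply/eqP/setP=> i; rewrite !inE; case: eqP => [->|_] /=.
      by rewrite (negbTE yB) (negbTE yD).
    by move: (subsetP DB i); case: (i \in D) => [/(_ isT)->|].
  move=> /andP[/andP[_ /subsetP B2S] /eqP E]; apply: eq_bigl => q.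
  suff -> : (y |: S) :\: D :\: (y |: B :\: D) = S :\: B by [].
  have DB : D \subset B by rewrite -E subsetUl.
  apply/setP=> i; rewrite !inE; case: eqP => [->|_] /=.
    by rewrite (negbTE yS) andbF.
  by move: (subsetP DB i); case: (i \in D) => [/(_ isT)->|_] //=.
have Px (B : {set T}) q : x \in B -> partition q (S :\: B) ->
    \prod_(D in q) K (sub e D) = \prod_(D in q) K (sub e' D).
  move=> xB qS; apply: eq_bigr => D Dq; congr K; apply: eq_in_sub => i iD; rewrite Ee //.
  by apply: contraTneq xB => <-; move: (subsetP (partitionS qS Dq) i iD); rewrite inE => /andP[].
have xyS : x \in y |: S by rewrite setU1r.
have -> : pexpS fX K (y |: S) e = \sum_(p : {set {set T}} | partition p (y |: S)) G p by [].
rewrite (big_partition_pblock _ xyS) (bigID (fun B : {set T} => y \in B)) /=.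
rewrite joined separated (pexpS_split _ _ _ xS) opprD addrA -!sumrB.
apply: eq_bigr => B /andP[xB BS].
have yB : y \notin B by apply: contra yS; apply: (subsetP BS).
rewrite exchange_big /= -!sumrB; apply: eq_bigr => q qS.
have Bq (D : {set T}) : x \in D -> D \notin q.
  move=> xD; apply/negP=> /(partitionS qS)/subsetP/(_ x xD).
  by rewrite inE xB.
have Cq (D : {set T}) : y \in D -> D \notin q.
  move=> yD; apply/negP=> /(partitionS qS)/subsetP/(_ y yD).
  by rewrite inE (negbTE yS) andbF.
have -> : G ((y |: B) |: q) = pw fX (B |: q) S e' * (K (sub e (y |: B)) * \prod_(D in q) K (sub e' D)).
  by rewrite /G pw_joined // big_setU1 ?Bq ?setU1r // (Px _ _ xB qS).
have -> : \sum_(D : {set T} | (x \in D) && (D \subset B)) G (D |: ((y |: (B :\: D)) |: q)) =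
    pw fX (B |: q) S e' * (split_sum B * \prod_(D in q) K (sub e' D)).
  rewrite mulr_suml mulr_sumr; apply: eq_bigr => D /andP[xD DB].
  rewrite /G pw_separated // big_setU1 /=; last first.
    rewrite in_setU1 negb_or Bq // andbT; apply/eqP => E.
    have : x \in y |: (B :\: D) by rewrite -E.
    by rewrite !inE (negbTE xy) xD.
  by rewrite big_setU1 ?Cq ?setU11 // (Px _ _ xB qS) -!mulrA.
by rewrite /merge_defect !mulrBl !mulrBr.
Qed.
End Merge.

Definition merge_rule (K : seq X -> C) : Prop :=
  forall (T : finType) (U V : seq T) (x y : T) (e e' : T -> X) j a b (B : {set T}),
    enum T = U ++ [:: x, y & V] -> (forall i, i != x -> e' i = e i) ->
    e x = (j, a) -> e y = (j, b) -> e' x = (j, nmul a b) -> x \in B -> y \notin B ->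
    merge_defect x y e e' K B = 0.

Lemma merging_sub M (T : finType) (U V : seq T) (x y : T) (e e' : T -> X) j a b (B : {set T}) :
  merging_words M ->
  enum T = U ++ [:: x, y & V] -> (forall i, i != x -> e' i = e i) ->
  e x = (j, a) -> e y = (j, b) -> e' x = (j, nmul a b) -> x \in B -> y \notin B ->
  M (sub e' B) = M (sub e (y |: B)).
Proof.
move=> MM ET Ee ex ey ex' xB yB.
have [U' [V' [EB EB' /andP[/andP[/andP[xU yU] xV] yV]]]] := enum_adj ET xB yB.
rewrite /sub EB EB' !map_cat /= ex' MM ex ey.
by rewrite !(eq_map_notin Ee).
Qed.

(** The moments have no defect on any subset of [B] containing [x], so the pointed triangular system
    leaves no defect of the cumulants either. *)
Lemma merge_rule_plog M : merging_words M -> merge_rule (plog fX M).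
Proof.
move=> MM T U V x y e e' j a b B ET Ee ex ey ex' xB yB.
have Fxy : fX (e x) = fX (e y) by rewrite ex ey.
have Fx : fX (e' x) = fX (e x) by rewrite ex ex'.
apply: (@pointed_sum0 T x (fun p S => pw fX p S e') (merge_defect x y e e' (plog fX M))
  (fun q => \prod_(D in q) plog fX M (sub e' D))) xB => [D D0||D xD DB].
- exact: pw_set1.
- by rewrite big_set0.
have yD : y \notin D by apply: contra yB; apply: (subsetP DB).
rewrite -(pexpS_merge_defect _ ET Ee Fxy Fx xD yD) !pexpSE !(pexp_plog _ adm); last 2 first.
- by rewrite sub_nil //; apply/set0Pn; exists x; rewrite ?setU1r.
- by rewrite sub_nil //; apply/set0Pn; exists x; rewrite ?setU1r.
by rewrite (merging_sub MM ET Ee ex ey ex') // subrr.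
Qed.

Lemma merging_pexp K : merge_rule K -> merging_words (pexp fX K).
Proof.
move=> KM u v j a b; pose w := u ++ [:: (j, a), (j, b) & v].
have sw : size w = (size u + (size v).+2)%N by rewrite size_cat.
have su : (size u < size w)%N by rewrite sw; lia.
have su1 : ((size u).+1 < size w)%N by rewrite sw; lia.
pose x := Ordinal su; pose y := Ordinal su1.
pose e := tnth (in_tuple w); pose e' i := if i == x then (j, nmul a b) else e i.
have ex : e x = (j, a) by rewrite /e (tnth_nth (j, a)) /= nth_cat ltnn subnn.
have ey : e y = (j, b) by rewrite /e (tnth_nth (j, a)) /= nth_cat ltnNge leqnSn subSn // subnn.
have ex' : e' x = (j, nmul a b) by rewrite /e' eqxx.
have Ee i : i != x -> e' i = e i by rewrite /e' => /negbTE->.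
have Fxy : fX (e x) = fX (e y) by rewrite ex ey.
have Fx : fX (e' x) = fX (e x) by rewrite ex ex'.
have [U [V ET]] : exists U V, enum 'I_(size w) = U ++ [:: x, y & V].
  exists (take (size u) (enum 'I_(size w))), (drop (size u).+2 (enum 'I_(size w))).
  rewrite -[LHS](cat_take_drop (size u)); congr (_ ++ _).
  rewrite (drop_nth x) ?size_enum_ord // (drop_nth x) ?size_enum_ord //.
  by rewrite (nth_ord_enum x x) (nth_ord_enum x y).
(* The merged word is indexed by all positions of the long word but [y], with the product placed at
   [x]. *)
pose S := [set: 'I_(size w)] :\ y.
have yS : y \notin S by rewrite !inE eqxx.
have xS : x \in S by rewrite !inE andbT -val_eqE /= neq_ltn ltnSn.
have yxS : y |: S = [set: 'I_(size w)] by rewrite setD1K ?inE.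
have [U' [V' [ES ES' /andP[/andP[/andP[xU yU] xV] yV]]]] := enum_adj ET xS yS.
have sU : size U' = size u.
  have : index x (enum (y |: S)) = size U' by rewrite ES' index_cat (negbTE xU) /= eqxx addn0.
  rewrite yxS enum_set_filter (@eq_filter _ _ predT) => [|i]; last by rewrite inE.
  by rewrite filter_predT index_enum_ord.
have Ew : sub e (y |: S) = w by rewrite yxS sub_setT.
have := Ew; rewrite /sub ES' map_cat /= ex ey /w => /eqP; rewrite eqseq_cat ?size_map //.
move=> /andP[/eqP Eu /eqP[Ev]].
have -> : u ++ (j, nmul a b) :: v = sub e' S.
  by rewrite /sub ES map_cat /= ex' !(eq_map_notin Ee) // Eu Ev.
apply: (@etrans _ _ (pexp fX K (sub e (y |: S)))); last by rewrite Ew.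
rewrite -!pexpSE; apply/eqP; rewrite -subr_eq0; apply/eqP.
rewrite (pexpS_merge_defect _ ET Ee Fxy Fx xS yS); apply: big1 => B /andP[xB BS].
apply: big1 => q _; rewrite (KM _ _ _ _ _ _ _ _ _ _ _ ET Ee ex ey ex') ?mul0r ?mulr0 //.
by apply: contra yS; apply: (subsetP BS).
Qed.

End Algebra.
End Multilinearity.

(** * Cumulants of functionals and their vanishing on mixed words *)

Section Product.
Variables (R : realType) (Fc : finType) (alpha : wts R Fc).
Hypothesis adm : admissible alpha.
Local Notation C := (complex R).
Local Notation pexp := (pexp alpha).
Local Notation plog := (plog alpha).

(** The face recorded with an entry need not contain it. Moments and cumulants are thus defined on
    all words, and multilinearity and merging hold without side conditions. *)
Definition mom (A : nalg R) (phi : A -> C) (w : seq (Fc * A)) : C := phi (nprod (map snd w)).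

Definition cum (A : nalg R) (phi : A -> C) : seq (Fc * A) -> C :=
  plog (fun p : Fc * A => p.1) (mom phi).

Lemma multilinear_mom (A : nalg R) (phi : A -> C) : lin_fun phi -> multilinear_words (mom phi).
Proof. by move=> lp u v j c a b; rewrite /mom !map_cat /= nprod_lin lp. Qed.

Lemma merging_mom (A : nalg R) (phi : A -> C) : merging_words (mom phi).
Proof. by move=> u v j a b; rewrite /mom !map_cat /= nprod_mul. Qed.

Lemma pexp_cum (A : nalg R) (phi : A -> C) w : ~~ nilp w ->
  pexp (fun p : Fc * A => p.1) (cum phi) w = phi (nprod (map snd w)).
Proof. exact: pexp_plog. Qed.

Lemma cum_hom (A B : nalg R) (h : A -> B) (phi : B -> C) w : nhom h -> ~~ nilp w ->
  cum phi [seq (p.1, h p.2) | p <- w] = cum (phi \o h) w.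
Proof.
move=> hh w0; rewrite /cum (@plog_map _ _ _ adm _ _ (fun p : Fc * A => p.1)) //.
congr plog; apply/funext => v; rewrite /mom /= (nhom_nprod hh) -!map_comp.
by congr (phi (nprod _)); apply: eq_map.
Qed.

(** ** Words with coloured entries *)

Section Colours.
Variables (J : eqType) (A : nalg R).
Local Notation X := ((J * Fc) * A)%type.

Definition uncol (w : seq X) : seq (Fc * A) := [seq (p.1.2, p.2) | p <- w].
Definition has_col (c : J) : pred X := fun p => p.1.1 == c.
Definition mixed (w : seq X) : Prop := forall c, ~~ all (has_col c) w.

Lemma snd_uncol w : map snd (uncol w) = map snd w.
Proof. by rewrite -map_comp. Qed.

Lemma pexp_uncol K w : pexp (fun p : Fc * A => p.1) K (uncol w) =
  pexp (fun p : X => p.1.2) (fun v => K (uncol v)) w.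
Proof. exact: pexp_map. Qed.

Lemma mixed_sub (w : seq X) : ~~ nilp w -> mixed w \/ exists c, all (has_col c) w.
Proof.
case: w => // p w _; have [a|a] := boolP (all (has_col p.1.1) (p :: w)).
  by right; exists p.1.1.
by left=> c; apply: contra a => /=; rewrite /has_col => /andP[/eqP-> a]; rewrite eqxx.
Qed.

Definition valid (S : J * Fc -> A -> Prop) : pred X := fun p => `[< S p.1 p.2 >].

Definition indep (S : J * Fc -> A -> Prop) (phi : A -> C) : Prop :=
  forall w, all (valid S) w -> mixed w -> cum phi (uncol w) = 0.

(** Mixed cumulants vanish on both sides and those in one colour agree, so all moments of words in
    the parts agree, and these words span. *)
Lemma indep_ext (S : J * Fc -> A -> Prop) (phi psi : A -> C) :
  (forall x, genalg (fun a => exists p, S p a) x) -> lin_fun phi -> lin_fun psi ->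
  indep S phi -> indep S psi ->
  (forall c w, ~~ nilp w -> all (valid S) w -> all (has_col c) w ->
     cum phi (uncol w) = cum psi (uncol w)) ->
  phi = psi.
Proof.
move=> gen lp lq ip iq E; apply: (lin_ext_words gen lp lq) => w w0 wS.
have [v Ev vS] : exists2 v : seq X, map snd v = w & all (valid S) v.
  elim: w wS {w0} => [|a w IH] wS; first by exists [::].
  have [v Ev vS] := IH (fun b bw => wS b (mem_behead (s := a :: w) bw)).
  have [p Sp] := wS a (mem_head _ _).
  by exists ((p, a) :: v); rewrite /= ?Ev // vS andbT; apply/asboolP.
have v0 : ~~ nilp v by rewrite /nilp -(size_map snd) Ev size_eq0.
have u0 : ~~ nilp (uncol v) by rewrite /nilp size_map.
rewrite -Ev -snd_uncol -!pexp_cum // !pexp_uncol.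
apply: (@eq_pexp_in _ _ _ _ _ (all (valid S))) => //.
  by move=> x T; apply: all_sub.
move=> x x0 xS; have [m|[c ac]] := mixed_sub x0; last exact: E ac.
by rewrite ip // iq.
Qed.

End Colours.

(** ** The product *)

Section Binary.
Variables (A1 A2 : mfalg R Fc) (F : mffp A1 A2).
Local Notation X := ((bool * Fc) * F)%type.

(** The product is handled through this characterisation. Since at most one functional satisfies it,
    universality and symmetry amount to checking it for a transported product. *)
Definition is_up (phi1 : A1 -> C) (phi2 : A2 -> C) (phi : F -> C) : Prop :=
  [/\ lin_fun phi, forall x, phi (fp_in1 F x) = phi1 x, forall x, phi (fp_in2 F x) = phi2 x
    & indep (@fp_part R Fc A1 A2 F) phi].

Lemma valid_part1 (w : seq X) : all (valid (@fp_part _ _ _ _ F)) w -> all (has_col true) w ->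
  exists2 v : seq (Fc * A1), uncol w = [seq (p.1, fp_in1 F p.2) | p <- v]
    & forall p, p \in v -> mf_face A1 p.1 p.2.
Proof.
elim: w => [|[[b q] z] w IH]; first by exists [::].
move=> /andP[/asboolP Sz Sw] /andP[/eqP /= bE aw].
have [v Ev vF] := IH Sw aw; rewrite {}bE in Sz *; case: Sz => x fx /= ->.
exists ((q, x) :: v); first by rewrite /= -Ev.
by move=> p; rewrite inE => /orP[/eqP->//|/vF].
Qed.

Lemma valid_part2 (w : seq X) : all (valid (@fp_part _ _ _ _ F)) w -> all (has_col false) w ->
  exists2 v : seq (Fc * A2), uncol w = [seq (p.1, fp_in2 F p.2) | p <- v]
    & forall p, p \in v -> mf_face A2 p.1 p.2.
Proof.
elim: w => [|[[b q] z] w IH]; first by exists [::].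
move=> /andP[/asboolP Sz Sw] /andP[/eqP /= bE aw].
have [v Ev vF] := IH Sw aw; rewrite {}bE in Sz *; case: Sz => x fx /= ->.
exists ((q, x) :: v); first by rewrite /= -Ev.
by move=> p; rewrite inE => /orP[/eqP->//|/vF].
Qed.

Lemma is_up_unique phi1 phi2 phi psi : is_up phi1 phi2 phi -> is_up phi1 phi2 psi -> phi = psi.
Proof.
move=> [lp p1 p2 ip] [lq q1 q2 iq].
apply: (indep_ext (@fp_genalg _ _ _ _ F) lp lq ip iq) => -[] w w0 wS wc.
  have [v Ev _] := valid_part1 wS wc.
  have v0 : ~~ nilp v by move: w0; rewrite /nilp -(size_map (fun p : X => (p.1.2, p.2))) -/(uncol w) Ev size_map.
  rewrite Ev !(cum_hom _ (fp_hom1 F) v0); congr (cum _ v).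
  by apply/funext => x /=; rewrite p1 q1.
have [v Ev _] := valid_part2 wS wc.
have v0 : ~~ nilp v by move: w0; rewrite /nilp -(size_map (fun p : X => (p.1.2, p.2))) -/(uncol w) Ev size_map.
rewrite Ev !(cum_hom _ (fp_hom2 F) v0); congr (cum _ v).
by apply/funext => x /=; rewrite p2 q2.
Qed.

Section Construction.
Variables (psi : bool -> F -> C).
Hypothesis lpsi : forall b, lin_fun (psi b).

Definition colcum (w : seq X) : C :=
  if w is p :: _ then
    if all (has_col p.1.1) w then cum (psi p.1.1) (uncol w) else 0
  else 0.

Lemma colcum_mono b w : ~~ nilp w -> all (has_col b) w -> colcum w = cum (psi b) (uncol w).
Proof. by case: w => // p w _ a; have /andP[/eqP Eb _] := a; rewrite /colcum Eb a. Qed.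

Lemma colcum_mixed w : mixed w -> colcum w = 0.
Proof. by case: w => // p w m; rewrite /colcum (negbTE (m _)). Qed.

Lemma colcum_neq w p p' : p \in w -> p' \in w -> p.1.1 != p'.1.1 -> colcum w = 0.
Proof.
move=> pw pw' pp; apply: colcum_mixed => c; apply/negP => /allP a.
by move: pp; rewrite (eqP (a _ pw)) (eqP (a _ pw')) eqxx.
Qed.

Lemma multilinear_colcum : multilinear_words colcum.
Proof.
move=> u v j c a b.
have al (x : F) d : all (has_col d) (u ++ (j, x) :: v) = all (has_col d) (u ++ (j, 0) :: v).
  by rewrite !all_cat.
have n0 (x : F) : ~~ nilp (u ++ (j, x) :: v) by case: (u).
have [m|[d ad]] := mixed_sub (n0 0).
  by rewrite !colcum_mixed ?mulr0 ?addr0 // => d; rewrite al.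
rewrite !(@colcum_mono d) ?al // /uncol !map_cat /=.
apply: (@multilinear_plog _ _ _ adm _ _ id).
exact: multilinear_mom.
Qed.

(** If all entries involved have one colour, the rule is that of the cumulants of [psi]. Otherwise
    some entry [i] differs in colour from [x] and [y], which share theirs; in every term [i] occurs
    in one cumulant with [x] or with [y], so all terms vanish. *)
Lemma merge_rule_colcum : merge_rule alpha (fun j : bool * Fc => j.2) colcum.
Proof.
move=> T U V x y e e' j a b B ET Ee ex ey ex' xB yB.
pose s (p : X) := (p.1.2, p.2).
have U_sub (d : T -> X) D : uncol (sub d D) = sub (s \o d) D by rewrite /uncol /sub -map_comp.
have sub0 (d : T -> X) (D : {set T}) i : i \in D -> ~~ nilp (sub d D).
  by move=> iD; rewrite sub_nil //; apply/set0Pn; exists i.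
have col' i : (e' i).1.1 = (e i).1.1 by have [->|/Ee->//] := eqVneq i x; rewrite ex' ex.
have memsub (d : T -> X) (D : {set T}) i : i \in D -> d i \in sub d D.
  by move=> iD; apply: map_f; rewrite mem_enum.
have [mono|] := boolP [forall i in y |: B, (e i).1.1 == j.1].
  move/forall_inP: mono => mono.
  have K (D : {set T}) i : D \subset y |: B -> i \in D -> colcum (sub e D) = cum (psi j.1) (sub (s \o e) D).
    move=> /subsetP DB iD; rewrite (@colcum_mono j.1) ?U_sub ?(sub0 _ _ i) //.
    by apply/allP => _ /mapP[k + ->]; rewrite mem_enum => /DB/mono.
  have K' : colcum (sub e' B) = cum (psi j.1) (sub (s \o e') B).
    rewrite (@colcum_mono j.1) ?U_sub ?(sub0 _ _ x) //.
    apply/allP => _ /mapP[k + ->]; rewrite mem_enum /has_col col' => kB.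
    by apply: mono; rewrite inE kB orbT.
  have := @merge_rule_plog _ _ _ adm F _ id (mom (psi j.1)) (@merging_mom _ _)
    T U V x y (s \o e) (s \o e') j.2 a b B ET.
  move=> H; rewrite -[RHS]H //=.
  - rewrite /merge_defect /split_sum -/(cum _) K' (K _ y) ?setU11 //.
    congr (_ - _); apply: eq_bigr => D /andP[xD DB].
    rewrite (K _ x) ?(subset_trans DB (subsetUr _ _)) // (K _ y) ?setU11 //.
    by apply/subsetP => i; rewrite !inE => /orP[->//|/andP[_ ->]]; rewrite orbT.
  - by move=> i /Ee->.
  - by rewrite ex.
  - by rewrite ey.
  - by rewrite ex'.
rewrite negb_forall_in => /exists_inP[i iyB ij].
have iy : i != y by apply: contraNneq ij => ->; rewrite ey.
have iB : i \in B by move: iyB; rewrite !inE (negbTE iy).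
have nx : (e i).1.1 != (e x).1.1 by rewrite ex.
have ny : (e i).1.1 != (e y).1.1 by rewrite ey.
rewrite /merge_defect (@colcum_neq (sub e' B) (e' i) (e' x)) ?memsub ?col' //.
rewrite (@colcum_neq (sub e (y |: B)) (e i) (e x)) ?memsub ?inE ?xB ?iB ?orbT //.
rewrite subr0 sub0r /split_sum big1 ?oppr0 // => D /andP[xD DB].
have [iD|iD] := boolP (i \in D).
  by rewrite (@colcum_neq (sub e D) (e i) (e x)) ?memsub // mul0r mulr0.
rewrite (@colcum_neq (sub e (y |: _)) (e i) (e y)) ?memsub ?inE ?iB ?iD ?eqxx ?orbT //.
by rewrite mulr0 mulr0.
Qed.

End Construction.

Lemma is_up_exists phi1 phi2 : lin_fun phi1 -> lin_fun phi2 -> exists phi, is_up phi1 phi2 phi.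
Proof.
move=> l1 l2; have [r1 [h1 r11 r12]] := fp_retract1 F; have [r2 [h2 r21 r22]] := fp_retract2 F.
(* The retractions put both functionals on the same algebra, so that [colcum] can speak of words
   over [F] only. *)
pose psi b : F -> C := if b then phi1 \o r1 else phi2 \o r2.
have lpsi b : lin_fun (psi b) by case: b; apply: lin_fun_comp.
have [phi [lp E]] := coprod_functional (@fp_coprod_parts _ _ _ _ F)
  (multilinear_pexp alpha (fun j : bool * Fc => j.2) (multilinear_colcum lpsi))
  (merging_pexp adm (merge_rule_colcum psi)).
(* On words in the parts, [phi] has the moments generated by [colcum psi], and moments determine
   cumulants. *)
have cE w : ~~ nilp w -> all (valid (@fp_part _ _ _ _ F)) w -> cum phi (uncol w) = colcum psi w.
  apply: (pexp_inj adm (fc := fun p : X => p.1.2) (P := all (valid (@fp_part _ _ _ _ F))) (K := fun v => cum phi (uncol v)) (K' := colcum psi)).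
    by move=> x T; apply: all_sub.
  move=> v v0 vS; rewrite -pexp_uncol pexp_cum; last by rewrite /nilp size_map.
  by rewrite snd_uncol E // -size_eq0.
have mono b w : ~~ nilp w -> all (has_col b) w -> all (valid (@fp_part _ _ _ _ F)) w ->
    phi (nprod (map snd w)) = psi b (nprod (map snd w)).
  move=> w0 wb wS; have u0 : ~~ nilp (uncol w) by rewrite /nilp size_map.
  rewrite -snd_uncol -!pexp_cum // !pexp_uncol.
  apply: (@eq_pexp_in _ _ _ _ _ (fun v => all (has_col b) v && all (valid (@fp_part _ _ _ _ F)) v));
    rewrite ?wb //.
    by move=> x T /andP[xb xS]; rewrite !all_sub.
  by move=> v v0 /andP[vb vS]; rewrite cE // (colcum_mono _ v0 vb).
exists phi; split=> //.
- move=> x; rewrite -[X in _ = phi1 X]r11 -/((phi1 \o r1) _) -[RHS]/((psi true \o fp_in1 F) x) -[LHS]/((phi \o fp_in1 F) x).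
  congr (_ x); apply: (lin_ext_words (coprod_genalg (@mf_coprod _ _ A1))).
  + exact: lin_fun_comp lp (fp_hom1 F).
  + exact: lin_fun_comp (lpsi true) (fp_hom1 F).
  move=> w w0 wF /=; rewrite (nhom_nprod (fp_hom1 F)).
  have [v [Ev vb vS]] : exists v : seq X, [/\ map snd v = map (fp_in1 F) w, all (has_col true) v
      & all (valid (@fp_part _ _ _ _ F)) v].
    elim: w wF {w0} => [|y w IH] wF; first by exists [::].
    have [v [Ev vb vS]] := IH (fun b bw => wF b (mem_behead (s := y :: w) bw)).
    have [q fq] := wF y (mem_head _ _).
    exists (((true, q), fp_in1 F y) :: v); rewrite /= Ev vb vS; split=> //.
    by rewrite andbT; apply/asboolP; exists y.
  by rewrite -Ev (mono true) // /nilp -(size_map snd) Ev size_map size_eq0.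
- move=> x; rewrite -[X in _ = phi2 X]r22 -/((phi2 \o r2) _) -[RHS]/((psi false \o fp_in2 F) x) -[LHS]/((phi \o fp_in2 F) x).
  congr (_ x); apply: (lin_ext_words (coprod_genalg (@mf_coprod _ _ A2))).
  + exact: lin_fun_comp lp (fp_hom2 F).
  + exact: lin_fun_comp (lpsi false) (fp_hom2 F).
  move=> w w0 wF /=; rewrite (nhom_nprod (fp_hom2 F)).
  have [v [Ev vb vS]] : exists v : seq X, [/\ map snd v = map (fp_in2 F) w, all (has_col false) v
      & all (valid (@fp_part _ _ _ _ F)) v].
    elim: w wF {w0} => [|y w IH] wF; first by exists [::].
    have [v [Ev vb vS]] := IH (fun b bw => wF b (mem_behead (s := y :: w) bw)).
    have [q fq] := wF y (mem_head _ _).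
    exists (((false, q), fp_in2 F y) :: v); rewrite /= Ev vb vS; split=> //.
    by rewrite andbT; apply/asboolP; exists y.
  by rewrite -Ev (mono false) // /nilp -(size_map snd) Ev size_map size_eq0.
- move=> w wS wm; have w0 : ~~ nilp w by case: w wS wm => // _ /(_ true).
  by rewrite cE // colcum_mixed.
Qed.

End Binary.
End Product.

(** * Universality, symmetry and associativity *)

Section ProductLaws.
Variables (R : realType) (Fc : finType) (alpha : wts R Fc).
Hypothesis adm : admissible alpha.
Local Notation C := (complex R).
Local Notation indep := (indep alpha).
Local Notation cum := (cum alpha).

Lemma cum_mono_eq (T B : nalg R) (i : B -> T) (phi psi : T -> C) (w : seq (Fc * T)) :
  nhom i -> (forall b, phi (i b) = psi (i b)) -> ~~ nilp w ->
  (forall p, p \in w -> exists b, p.2 = i b) -> cum phi w = cum psi w.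
Proof.
move=> hi E w0 H.
have [v Ev] : exists v, w = [seq (p.1, i p.2) | p <- v].
  elim: w H {w0} => [|[q z] w IH] H; first by exists [::].
  have [b /= ->] := H _ (mem_head _ _).
  have [v ->] := IH (fun p pw => H p (mem_behead (s := (q, z) :: w) pw)).
  by exists ((q, b) :: v).
have v0 : ~~ nilp v by move: w0; rewrite Ev /nilp size_map.
rewrite Ev !(cum_hom adm _ hi v0); congr (cum _ v).
exact/funext.
Qed.

Lemma cum_mono (T B : nalg R) (i : B -> T) (phi : T -> C) (w : seq (Fc * B)) psi :
  nhom i -> (forall b, phi (i b) = psi b) -> ~~ nilp w ->
  cum phi [seq (p.1, i p.2) | p <- w] = cum psi w.
Proof. by move=> hi E w0; rewrite (cum_hom adm) //; congr (cum _ w); apply/funext. Qed.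

Definition recol (J J' : eqType) (T T' : nalg R) (g : J -> J') (h : T -> T')
  (p : (J * Fc) * T) : (J' * Fc) * T' := ((g p.1.1, p.1.2), h p.2).


Lemma mixed_recol (J J' : eqType) (T T' : nalg R) (g : J -> J') (h : T -> T')
    (w : seq ((J * Fc) * T)) : injective g -> ~~ nilp w -> mixed w -> mixed (map (recol g h) w).
Proof.
move=> gI; case: w => // p w _ m c; apply: contra (m p.1.1) => /=.
rewrite /has_col /= => /andP[/eqP <-]; rewrite eqxx all_map /=; apply: sub_all => p' /=.
by rewrite (inj_eq gI).
Qed.

Lemma indep_pull (J J' : eqType) (T T' : nalg R) (S : J * Fc -> T -> Prop)
    (S' : J' * Fc -> T' -> Prop) (g : J -> J') (h : T -> T') (phi : T' -> C) :
  injective g -> nhom h -> (forall c q z, S (c, q) z -> S' (g c, q) (h z)) ->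
  indep S' phi -> indep S (phi \o h).
Proof.
move=> gI hh SS' ip w wS m; have [/nilP->//|w0] := boolP (nilp w).
rewrite -(cum_hom adm) //; last by rewrite /nilp size_map.
have -> : [seq (p.1, h p.2) | p <- uncol w] = uncol (map (recol g h) w).
  by rewrite /uncol -!map_comp.
apply: ip; last exact: mixed_recol.
rewrite all_map; apply: sub_all wS => -[[c q] z] /= /asboolP Sz.
by apply/asboolP; apply: SS'.
Qed.

Definition two_parts (T : nalg R) (B A : mfalg R Fc) (i1 : B -> T) (i2 : A -> T)
    (p : bool * Fc) (z : T) : Prop :=
  if p.1 then exists2 x, mf_face B p.2 x & z = i1 x
         else exists2 x, mf_face A p.2 x & z = i2 x.

Definition nested_parts (J : eqType) (T : nalg R) (B A : mfalg R Fc) (i1 : B -> T) (i2 : A -> T)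
    (S : J * Fc -> B -> Prop) (p : option J * Fc) (z : T) : Prop :=
  if p.1 is Some c then exists2 x, S (c, p.2) x & z = i1 x
  else exists2 x, mf_face A p.2 x & z = i2 x.

(** A mixed word without entries from [A] is already mixed inside [B]. With such an entry,
    forgetting the colours inside [B] still leaves a word mixed between [B] and [A]. *)
Lemma indep_nest (J : eqType) (T : nalg R) (B A : mfalg R Fc) (i1 : B -> T) (i2 : A -> T)
    (S : J * Fc -> B -> Prop) (phi : T -> C) : nhom i1 ->
  (forall c q z, S (c, q) z -> mf_face B q z) ->
  indep (two_parts i1 i2) phi -> indep S (phi \o i1) -> indep (nested_parts i1 i2 S) phi.
Proof.
move=> hi SB ip iS w wS m; have [/nilP->//|w0] := boolP (nilp w).
have [noN|hasN] := boolP (all (fun p => p.1.1 != None) w).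
  have [v Ev vS] : exists2 v : seq ((J * Fc) * B), w = map (recol Some i1) v & all (valid S) v.
    elim: w wS noN {m w0} => [|[[[c|] q] z] w IH]; [by exists [::] | | by move=> _ /andP[]].
    move=> /andP[/asboolP[x Sx /= ->] wS] noN; have [v -> vS] := IH wS noN.
    by exists (((c, q), x) :: v); rewrite //= vS andbT; apply/asboolP.
  have Eu : uncol w = [seq (p.1, i1 p.2) | p <- uncol v] by rewrite Ev /uncol -!map_comp.
  have v0 : ~~ nilp v by move: w0; rewrite Ev /nilp size_map.
  rewrite Eu (cum_hom adm) //; last by rewrite /nilp size_map.
  apply: iS => // c; have := m (Some c); rewrite Ev; apply: contra.
  by rewrite all_map; apply: sub_all.
pose w' := map (recol (fun c : option J => c != None) id) w.
have -> : uncol w = uncol w' by rewrite /uncol -map_comp.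
apply: ip.
  rewrite all_map; apply: sub_all wS => -[[[c|] q] z] /= /asboolP[x Sx /= ->]; apply/asboolP.
    by exists x => //; apply: SB Sx.
  by exists x.
case; rewrite /w' all_map; last first.
  apply: contra (m None); apply: sub_all => -[[[c|] q] z] //=.
by apply: contra hasN; apply: sub_all => -[[[c|] q] z].
Qed.

(** ** The universal product *)

Variable FP : fpchoice R Fc.

(** Chosen classically. The value [0] is a default for arguments without a product; for linear
    functionals it is excluded by [is_up_exists]. *)
Definition the_up : UP FP := fun A1 A2 phi1 phi2 =>
  if pselect (exists phi, is_up alpha (F := FP A1 A2) phi1 phi2 phi) is left h
  then projT1 (cid h) else fun _ => 0.

Lemma the_upP (A1 A2 : mfalg R Fc) (phi1 : A1 -> C) (phi2 : A2 -> C) :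
  lin_fun phi1 -> lin_fun phi2 -> is_up alpha (F := FP A1 A2) phi1 phi2 (the_up phi1 phi2).
Proof.
move=> l1 l2; rewrite /the_up; case: pselect => [h|[]]; last exact: is_up_exists.
by case: cid.
Qed.

Lemma the_up_linear : up_linear the_up.
Proof. by move=> A1 A2 phi1 phi2 l1 l2; case: (the_upP l1 l2). Qed.

Lemma the_up_restrict : up_restrict the_up.
Proof. by move=> A1 A2 phi1 phi2 l1 l2; case: (the_upP l1 l2). Qed.

Lemma the_up_universal : up_universal the_up.
Proof.
move=> B1 B2 A1 A2 h1 h2 phi1 phi2 [hh1 f1] [hh2 f2] l1 l2 k kh k1 k2 z.
rewrite -[RHS]/((the_up phi1 phi2 \o k) z); congr (_ z).
have [lp p1 p2 ip] := the_upP l1 l2.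
apply: (is_up_unique adm (the_upP (lin_fun_comp l1 hh1) (lin_fun_comp l2 hh2))).
split=> [|x|x|]; rewrite /= ?k1 ?k2 ?p1 ?p2 //; first exact: lin_fun_comp.
apply: (indep_pull (g := id) _ kh _ ip) => // -[] q _ [x fx /= ->].
  by exists (h1 x); [apply: f1 | rewrite k1].
by exists (h2 x); [apply: f2 | rewrite k2].
Qed.

Lemma the_up_symmetric : up_symmetric the_up.
Proof.
move=> A1 A2 phi1 phi2 l1 l2 k kh k1 k2 z.
rewrite -[RHS]/((the_up phi2 phi1 \o k) z); congr (_ z).
have [lp p1 p2 ip] := the_upP l2 l1.
apply: (is_up_unique adm (the_upP l1 l2)).
split=> [|x|x|]; rewrite /= ?k1 ?k2 ?p1 ?p2 //; first exact: lin_fun_comp.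
apply: (indep_pull (g := negb) _ kh _ ip) => [[] []//|[] q _ [x fx /= ->]].
  by exists x; rewrite ?k1.
by exists x; rewrite ?k2.
Qed.

(** By [indep_nest], for either bracketing all cumulants mixing the three factors vanish. The two
    functionals agree on each factor, so [indep_ext] with three colours identifies them. *)
Lemma the_up_assoc : up_assoc the_up.
Proof.
move=> A1 A2 A3 phi1 phi2 phi3 l1 l2 l3 k kh k1 k2 k3 z.
rewrite -[RHS]/((the_up phi1 (the_up phi2 phi3) \o k) z); congr (_ z).
have [l12 p1 p2 ip12] := the_upP l1 l2; have [l23 q2 q3 ip23] := the_upP l2 l3.
have [lp p12 p3 ip] := the_upP l12 l3; have [lq q1 q23 iq] := the_upP l1 l23.
pose T := FP (FP A1 A2) A3; pose T2 := FP A1 (FP A2 A3).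
pose S : option bool * Fc -> T -> Prop :=
  nested_parts (fp_in1 T) (fp_in2 T) (@fp_part _ _ _ _ (FP A1 A2)).
pose S2 : option bool * Fc -> T2 -> Prop :=
  nested_parts (fp_in2 T2) (fp_in1 T2) (@fp_part _ _ _ _ (FP A2 A3)).
have pf (B D : mfalg R Fc) c q (x : FP B D) : fp_part (c, q) x -> mf_face (FP B D) q x.
  by case: c => -[y fy ->]; [apply: fp_face1 | apply: fp_face2].
have iS : indep S (the_up (the_up phi1 phi2) phi3).
  apply: indep_nest => //; first exact: fp_hom1.
    by move=> c q x; apply: pf.
  have -> // : the_up (the_up phi1 phi2) phi3 \o fp_in1 T = the_up phi1 phi2.
  exact/funext.
have iS2 : indep S2 (the_up phi1 (the_up phi2 phi3)).
  apply: indep_nest => //; first exact: fp_hom2.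
  - by move=> c q x; apply: pf.
  - apply: (indep_pull (g := negb) (h := id) _ _ _ iq) => [[] []//||[] q x] //=.
  have -> // : the_up phi1 (the_up phi2 phi3) \o fp_in2 T2 = the_up phi2 phi3.
  exact/funext.
(* On the left the colours of [A1], [A2], [A3] are [Some true], [Some false], [None]; on the right
   they are [None], [Some true], [Some false]. *)
pose g (c : option bool) := if c is Some b then if b then None else Some true else Some false.
have iS' : indep S (the_up phi1 (the_up phi2 phi3) \o k).
  apply: (indep_pull (g := g) _ kh _ iS2) => [[[]|] [[]|]//|[[]|] q _ [x + ->]] /=.
  - by move=> [y fy ->]; exists y => //; rewrite k1.
  - by move=> [y fy ->]; exists (fp_in1 _ y); rewrite ?k2 //; exists y.
  - by move=> fx; exists (fp_in2 _ x); rewrite ?k3 //; exists x.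
have gen x : genalg (fun a => exists p, S p a) x.
  have sub1 : subalg (fun y => genalg (fun a => exists p, S p a) (fp_in1 T y)).
    exact: subalg_preim (fp_hom1 T) (genalg_subalg _).
  have sub2 : subalg (fun y => genalg (fun a => exists p, S p a) (fp_in2 T y)).
    exact: subalg_preim (fp_hom2 T) (genalg_subalg _).
  apply: (fp_genalg x); first exact: genalg_subalg.
  move=> _ [[[] q] [y fy ->]].
    apply: (fp_genalg y sub1) => v [[c q'] pv] U _; apply.
    by exists (Some c, q'), v.
  by move=> U _; apply; exists (None, q), y.
apply: (indep_ext adm gen _ _ iS iS') => //; first exact: lin_fun_comp.
move=> c w w0 wS wc; have u0 : ~~ nilp (uncol w) by rewrite /nilp size_map.
have H p : p \in uncol w -> exists2 q, S (c, q) p.2 & p.1 = q.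
  move=> /mapP[[[d q] x] /[dup] /(allP wS)/asboolP Sx /(allP wc)/eqP /= dc ->].
  by rewrite -dc; exists q.
case: c wc H => [[]|] _ H.
- apply: (@cum_mono_eq _ _ (fp_in1 T \o fp_in1 _)) => //.
  + exact: nhom_comp (fp_hom1 _) (fp_hom1 _).
  + by move=> b /=; rewrite p12 p1 k1 q1.
  by move=> p /H[q [x [y _ ->] Ex] _]; exists y.
- apply: (@cum_mono_eq _ _ (fp_in1 T \o fp_in2 _)) => //.
  + exact: nhom_comp (fp_hom1 _) (fp_hom2 _).
  + by move=> b /=; rewrite p12 p2 k2 q23 q2.
  by move=> p /H[q [x [y _ ->] Ex] _]; exists y.
- apply: (@cum_mono_eq _ _ (fp_in2 T)) => //.
  + exact: fp_hom2.
  + by move=> b /=; rewrite p3 k3 q23 q3.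
  by move=> p /H[q [x _ Ex] _]; exists x.
Qed.

Lemma the_up_sym_univ_prod : sym_univ_prod the_up.
Proof.
split; last exact: the_up_symmetric; split.
- exact: the_up_linear.
- exact: the_up_universal.
- exact: the_up_assoc.
- exact: the_up_restrict.
Qed.

End ProductLaws.
Arguments the_up {R Fc} alpha FP _ _ _ _ _.

(** ** Iterated partial derivatives of polynomial functions *)

Section Calculus.
Variable R : realType.
Local Notation C := (complex R).

Lemma complex_eqP (x y : C) : complex.Re x = complex.Re y -> complex.Im x = complex.Im y -> x = y.
Proof. by case: x y => [a b] [c d] /= -> ->. Qed.

(** [cderiv] differentiates real and imaginary parts separately; along the real line these are real
    polynomials, with the parts of the coefficients as coefficients. *)
Lemma horner_parts (G : {poly C}) : exists p q : {poly R},
  [/\ forall s : R, complex.Re G.[s%:C%C] = p.[s], forall s : R, complex.Im G.[s%:C%C] = q.[s],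
      forall i, p`_i = complex.Re G`_i & forall i, q`_i = complex.Im G`_i].
Proof.
elim/poly_ind: G => [|G c [p [q [Ep Eq Cp Cq]]]].
  by exists 0, 0; split=> [s|s|i|i]; rewrite ?horner0 ?coef0.
have ReD (x y : C) : complex.Re (x + y) = complex.Re x + complex.Re y by case: x y => [a b] [d e].
have ImD (x y : C) : complex.Im (x + y) = complex.Im x + complex.Im y by case: x y => [a b] [d e].
have ReM (x : C) (s : R) : complex.Re (x * s%:C%C) = complex.Re x * s.
  by case: x => a b /=; rewrite mulr0 subr0.
have ImM (x : C) (s : R) : complex.Im (x * s%:C%C) = complex.Im x * s.
  by case: x => a b /=; rewrite mulr0 add0r.
exists (p * 'X + (complex.Re c)%:P), (q * 'X + (complex.Im c)%:P); split=> [s|s|i|i].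
- by rewrite !hornerE ReD ReM Ep.
- by rewrite !hornerE ImD ImM Eq.
- by rewrite !coefD !coefMX !coefC ReD; case: i => [|i]; rewrite ?addr0 //= Cp.
- by rewrite !coefD !coefMX !coefC ImD; case: i => [|i]; rewrite ?addr0 //= Cq.
Qed.

Lemma cderiv_horner0 (G : {poly C}) : cderiv (fun s : R => G.[s%:C%C]) 0 G`_1.
Proof.
have [p [q [Ep Eq Cp Cq]]] := horner_parts G; split.
  have -> : (fun s : R => complex.Re G.[s%:C%C]) = horner p by apply/funext.
  have := is_derive_poly p 0; rewrite horner_coef0 coef_deriv mulr1n Cp //.
have -> : (fun s : R => complex.Im G.[s%:C%C]) = horner q by apply/funext.
have := is_derive_poly q 0; rewrite horner_coef0 coef_deriv mulr1n Cq //.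
Qed.

Lemma cderiv_unique (g h : R -> C) (s0 : R) v w (e e' : R) : 0 < e -> 0 < e' ->
  (forall s, `|s - s0| < e -> `|s - s0| < e' -> g s = h s) ->
  cderiv g s0 v -> cderiv h s0 w -> v = w.
Proof.
move=> e0 e'0 gh [gR gI] [hR hI].
have nR (r : C -> R) : \forall s \near s0, (fun t => r (g t)) s = (fun t => r (h t)) s.
  apply/nbhs_ballP; exists (Num.min e e'); first by rewrite /= lt_min e0 e'0.
  move=> s; rewrite /ball /= distrC lt_min => /andP[se se'].
  by rewrite gh.
apply: complex_eqP.
  rewrite -(@derive_val _ _ _ _ _ _ _ gR) -(@derive_val _ _ _ _ _ _ _ hR).
  exact: near_eq_derive (nR _).
rewrite -(@derive_val _ _ _ _ _ _ _ gI) -(@derive_val _ _ _ _ _ _ _ hI).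
exact: near_eq_derive (nR _).
Qed.

Lemma mpd_unique (F : (nat -> R) -> C) l x v w : mpd F l x v -> mpd F l x w -> v = w.
Proof.
elim: l x v w => [|i l IH] x v w /=; first by move=> -> ->.
move=> [g [[e e0 gE] dg]] [h [[e' e'0 hE] dh]].
apply: (cderiv_unique e0 e'0 _ dg dh) => s se se'.
exact: IH (gE _ se) (hE _ se').
Qed.

Lemma mpd_separable (I : finType) (D : pred I) (c : I -> C) (P : I -> nat -> {poly C}) k :
  mpd (fun t => \sum_(i | D i) c i * \prod_(j < k) (P i j).[(t j)%:C%C]) (iota 0 k) (fun _ => 0)
    (\sum_(i | D i) c i * \prod_(j < k) (P i j)`_1).
Proof.
(* The value once the derivatives in the variables [s], ..., [k - 1] have been taken at [0]: each
   turns its factor into a linear coefficient, while the variables below [s] stay free. *)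
pose ev s (x : nat -> R) := \sum_(i | D i) c i *
  \prod_(j < k) (if (j < s)%N then (P i j).[(x j)%:C%C] else (P i j)`_1).
suff H : forall r s x, (s + r = k)%N -> (forall j, (s <= j)%N -> x j = 0) ->
    mpd (fun t => \sum_(i | D i) c i * \prod_(j < k) (P i j).[(t j)%:C%C]) (iota s r) x (ev s x).
  exact: (H k 0%N (fun _ => 0)).
elim=> [|r IH] s x sk x0 /=.
  apply: eq_bigr => i _; congr (_ * _); apply: eq_bigr => j _.
  by rewrite -(addn0 s) sk ltn_ord.
have sk' : (s < k)%N by rewrite -sk addnS ltnS leq_addr.
pose o := Ordinal sk'.
pose cc i := c i * \prod_(j < k | j != o) (if (j < s)%N then (P i j).[(x j)%:C%C] else (P i j)`_1).
pose G := \sum_(i | D i) cc i *: P i s.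
exists (fun v => G.[v%:C%C]); split.
  exists 1 => // v _; have -> : G.[v%:C%C] = ev s.+1 (upd x s v).
    rewrite horner_sum; apply: eq_bigr => i _; rewrite hornerZ (bigD1 o) //= ltnSn /upd eqxx.
    rewrite /cc -mulrA; congr (_ * _).
    rewrite mulrC; congr (_ * _); apply: eq_bigr => j jo.
    have js : (val j == s) = false by apply: negbTE jo.
    have -> : (j < s.+1)%N = (j < s)%N by rewrite ltnS leq_eqVlt js.
    by rewrite js.
  apply: IH; first by rewrite addSnnS.
  move=> j sj; rewrite /upd gtn_eqF // x0 // ltnW //.
have -> : ev s x = G`_1.
  rewrite coef_sum; apply: eq_bigr => i _; rewrite coefZ (bigD1 o) //= ltnn.
  by rewrite /cc -mulrA; congr (_ * _); rewrite mulrC.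
by rewrite (x0 s) //; exact: cderiv_horner0.
Qed.

End Calculus.

(** * Iterated products of a sequence of algebras *)

Section Tower.
Variables (R : realType) (Fc : finType) (FP : fpchoice R Fc).
Local Notation C := (complex R).
Variables (As : nat -> mfalg R Fc).
Local Notation castA := (Defs.castA R Fc As).
Local Notation tower := (Defs.tower R Fc FP As).
Local Notation incl := (Defs.incl R Fc FP As).

Lemma castA_id i x : castA i i x = x.
Proof. by rewrite /castA; case: eqP => // e; rewrite (eq_axiomK e). Qed.

Lemma incl_castA m i j x : j = i -> incl m j x = incl m i (castA i j x).
Proof. by move=> e; case: i / e; rewrite castA_id. Qed.

Lemma incl_last m x : incl m.+1 m.+1 x = fp_in2 (FP (tower m) (As m.+1)) x.
Proof. by rewrite /= eqxx castA_id. Qed.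

Lemma incl_prev m j x : (j <= m)%N -> incl m.+1 j x = fp_in1 (FP (tower m) (As m.+1)) (incl m j x).
Proof. by move=> jm; rewrite /= ltn_eqF. Qed.

Lemma incl_mfhom m j : (j <= m)%N -> mfhom (incl m j).
Proof.
elim: m => [|m IH] in j *.
  rewrite leqn0 => /eqP->; have -> : incl 0 0 = id by apply/funext => x; rewrite /= castA_id.
  exact: mfhom_id.
rewrite leq_eqVlt ltnS => /orP[/eqP->|jm].
  by have -> : incl m.+1 m.+1 = fp_in2 (FP (tower m) (As m.+1));
    [apply/funext => x; rewrite incl_last | apply: fp_mfhom2].
have -> : incl m.+1 j = fp_in1 (FP (tower m) (As m.+1)) \o incl m j.
  by apply/funext => x; rewrite incl_prev.
by apply: mfhom_comp (IH _ jm); apply: fp_mfhom1.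
Qed.

Section UniversalProduct.
Variables (up : UP FP) (phi : forall i, As i -> C) (t : nat -> R).
Hypotheses (upL : up_linear up) (upR : up_restrict up) (lphi : forall i, lin_fun (@phi i)).
Local Notation towF := (Defs.towF R Fc FP up As phi t).

Lemma towF_lin m : lin_fun (towF m).
Proof.
elim: m => [|m IH]; first by move=> c x y; rewrite /= lphi mulrDr mulrCA.
by apply: upL IH _; apply: lin_fun_scale.
Qed.

Arguments towF_lin : clear implicits.

Lemma towF_incl m j x : (j <= m)%N -> towF m (incl m j x) = (t j)%:C%C * phi x.
Proof.
elim: m => [|m IH] in j x *.
  by rewrite leqn0 => /eqP j0; move: x; rewrite j0 => x; rewrite /= castA_id.
have [r1 r2] := upR (towF_lin m) (lin_fun_scale (t m.+1)%:C%C (@lphi m.+1)).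
rewrite leq_eqVlt ltnS => /orP[/eqP jm|jm].
  by move: x; rewrite jm => x; rewrite incl_last; apply: r2.
by rewrite incl_prev // -IH //; apply: r1.
Qed.
End UniversalProduct.

Definition tower_parts m (p : nat * Fc) (z : tower m) : Prop :=
  (p.1 <= m)%N /\ exists2 a : As p.1, mf_face _ p.2 a & z = incl m p.1 a.

Variables (alpha : wts R Fc) (adm : admissible alpha).

(** Each storey is an instance of [indep_nest]: the new factor [m.+1] plays the colour [None] and
    the earlier ones keep their index. *)
Lemma indep_tower (phi : forall i, As i -> C) (lphi : forall i, lin_fun (@phi i)) t m :
  indep alpha (@tower_parts m) (towF R Fc FP (the_up alpha FP) As phi t m).
Proof.
pose up := the_up alpha FP.
have upL : up_linear up := @the_up_linear _ _ _ adm FP.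
have upR : up_restrict up := @the_up_restrict _ _ _ adm FP.
elim: m => [|m IH].
  move=> [|[p z] w] wS mw //.
  have := mw 0%N; rewrite (_ : all _ _) //; apply: sub_all wS => -[[j q] x] /asboolP[].
  by rewrite leqn0.
have [lp p1 p2 ip] := the_upP adm FP (@towF_lin up phi t upL lphi m)
  (lin_fun_scale (t m.+1)%:C%C (@lphi m.+1)).
have iN : indep alpha (nested_parts (fp_in1 (FP (tower m) (As m.+1))) (fp_in2 (FP (tower m) (As m.+1)))
    (@tower_parts m)) (towF R Fc FP up As phi t m.+1).
  apply: (indep_nest adm (fp_hom1 _) _ ip).
    by move=> c q z [cm [a fa ->]]; have [_] := incl_mfhom cm; apply.
  suff -> : towF R Fc FP up As phi t m.+1 \o fp_in1 (FP (tower m) (As m.+1)) = towF R Fc FP up As phi t m by [].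
  exact/funext.
apply: (indep_pull adm (g := fun j => if j == m.+1 then None else Some j) (h := id) _ _ _ iN) => //.
  by move=> i j; do 2![case: eqP => [->|]] => // _ _ [].
move=> c q z [/= cm [a fa ->]]; rewrite /nested_parts /=; case: eqP => [E|/eqP cN] /=.
  by move: a fa; rewrite E => a fa; exists a => //; rewrite castA_id.
have cm' : (c <= m)%N by rewrite -ltnS ltn_neqAle cN.
by exists (incl m c a) => //; split=> //; exists a.
Qed.
End Tower.

(** ** Highest coefficients *)

Section Highest.
Variables (R : realType) (Fc : finType) (alpha : wts R Fc).
Hypothesis adm : admissible alpha.
Local Notation C := (complex R).

Lemma coef01_prod (I : finType) (A : pred I) (P : I -> {poly C}) i j :
  A i -> A j -> j != i -> (P i)`_0 = 0 -> (P j)`_0 = 0 ->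
  (\prod_(k | A k) P k)`_0 = 0 /\ (\prod_(k | A k) P k)`_1 = 0.
Proof.
move=> Ai Aj ji i0 j0; rewrite (bigD1 i) // (bigD1 j) /=; last by rewrite Aj.
rewrite coef0M i0 mul0r; split=> //.
by rewrite coefM big_ord_recr big_ord1 /= subnn subn0 i0 mul0r add0r coef0M j0 mul0r mulr0.
Qed.

Lemma partition_two (T : finType) (S : {set T}) p : S != set0 -> partition p S -> p != [set S] ->
  exists B1 B2, [/\ B1 \in p, B2 \in p & B2 != B1].
Proof.
move=> /set0Pn[x xS] pS pN; have cov := cover_partition pS.
have xp : x \in cover p by rewrite cov.
have Bp := pblock_mem xp; have /properP[_ [y yS yB]] := partition_proper pS pN Bp.
exists (pblock p x), (pblock p y); split=> //; first by rewrite pblock_mem // cov.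
by apply: contraNneq yB => <-; rewrite mem_pblock cov.
Qed.

(** In the recursion for cumulants, every partition with at least two blocks contributes a product
    of two or more polynomials without constant term. Such terms start in degree two, so the linear
    coefficient is the moment. *)
Lemma plog_scaled (X : Type) (fX : X -> Fc) (M : seq X -> C) :
  exists P : seq X -> {poly C}, forall w, ~~ nilp w ->
    [/\ forall t, plog alpha fX (fun v => t * M v) w = (P w).[t], (P w)`_0 = 0 & (P w)`_1 = M w].
Proof.
suff H n : exists P : seq X -> {poly C}, forall w, ~~ nilp w -> (size w <= n)%N ->
    [/\ forall t, plog alpha fX (fun v => t * M v) w = (P w).[t], (P w)`_0 = 0 & (P w)`_1 = M w].
  have /choice[P HP] (w : seq X) : exists p : {poly C}, ~~ nilp w ->
      [/\ forall t, plog alpha fX (fun v => t * M v) w = p.[t], p`_0 = 0 & p`_1 = M w].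
    by have [P HP] := H (size w); exists (P w) => w0; apply: HP.
  by exists P.
elim: n => [|n [P IH]]; first by exists (fun _ => 0) => w w0; rewrite leqn0 -/(nilp w) (negbTE w0).
exists (fun w => M w *: 'X - \sum_(p : {set {set 'I_(size w)}} |
    partition p [set: 'I_(size w)] && (p != [set [set: 'I_(size w)]]))
  pw alpha fX p [set: 'I_(size w)] (tnth (in_tuple w)) *: \prod_(B in p) P (sub (tnth (in_tuple w)) B)).
move=> w w0 wn.
have sB (p : {set {set 'I_(size w)}}) (B : {set 'I_(size w)}) : partition p [set: 'I_(size w)] ->
    p != [set [set: 'I_(size w)]] -> B \in p ->
    ~~ nilp (sub (tnth (in_tuple w)) B) /\ (size (sub (tnth (in_tuple w)) B) <= n)%N.
  move=> pS pN Bp; rewrite sub_nil ?(partition_neq0 pS) // size_sub; split=> //.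
  have := proper_card (partition_proper pS pN Bp); rewrite cardsT card_ord => lt.
  by rewrite -ltnS (leq_trans lt).
have zero (p : {set {set 'I_(size w)}}) : partition p [set: 'I_(size w)] -> p != [set [set: 'I_(size w)]] ->
    (\prod_(B in p) P (sub (tnth (in_tuple w)) B))`_0 = 0 /\
    (\prod_(B in p) P (sub (tnth (in_tuple w)) B))`_1 = 0.
  move=> pS pN; have [B1 [B2 [B1p B2p B12]]] := partition_two (setT_neq0 w0) pS pN.
  have [n1 s1] := sB _ _ pS pN B1p; have [n2 s2] := sB _ _ pS pN B2p.
  by apply: (coef01_prod B1p B2p B12); [have [] := IH _ n1 s1 | have [] := IH _ n2 s2].
split=> [t||].
- rewrite plogE // hornerD hornerN hornerZ hornerX mulrC horner_sum; congr (_ - _).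
  apply: eq_bigr => p /andP[pS pN]; rewrite hornerZ horner_prod; congr (_ * _).
  by apply: eq_bigr => B /(sB _ _ pS pN)[n1 s1]; have [-> _ _] := IH _ n1 s1.
- rewrite coefB coefZ coefX mulr0 coef_sum big1 ?subr0 // => p /andP[pS pN].
  by rewrite coefZ; have [-> _] := zero p pS pN; rewrite mulr0.
- rewrite coefB coefZ coefX mulr1 coef_sum big1 ?subr0 // => p /andP[pS pN].
  by rewrite coefZ; have [_ ->] := zero p pS pN; rewrite mulr0.
Qed.

Lemma kerp_pblock n (p : {set {set 'I_n}}) : partition p [set: 'I_n] -> kerp (pblock p) = p.
Proof.
move=> pS; have cov i : i \in cover p by rewrite (cover_partition pS) inE.
have tr := partition_trivIset pS.
have E i : [set j | pblock p j == pblock p i] = pblock p i.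
  by apply/setP=> j; rewrite inE eq_sym eq_pblock.
apply/setP=> B; apply/imsetP/idP => [[i _ ->]|Bp]; first by rewrite E pblock_mem.
have /set0Pn[i iB] := partition_neq0 pS Bp.
by exists i => //; rewrite E (def_pblock tr Bp iB).
Qed.

Lemma kerp_ord n k (b : 'I_n -> nat) : (forall l, (b l < k)%N) ->
  (forall kappa, (kappa < k)%N -> exists l, b l = kappa) ->
  [set [set l : 'I_n | b l == kappa] | kappa : 'I_k] = kerp b.
Proof.
move=> bk bon; apply/setP=> B; apply/imsetP/imsetP => [[c _ ->]|[i _ ->]].
  by have [l <-] := bon c (ltn_ord c); exists l.
by exists (Ordinal (bk i)).
Qed.

Variable FP : fpchoice R Fc.

(** The moment-cumulant formula is a sum over partitions [p] of products of polynomials, one per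
    block, each in the variable of its colour. The mixed derivative extracts all linear
    coefficients, and only the partition into colour classes has a nonzero one in every variable. *)
Lemma the_up_highest : has_highest (the_up alpha FP) alpha.
Proof.
move=> k As phi k0 lphi n b f a bk bon fa.
have upL : up_linear (the_up alpha FP) := @the_up_linear _ _ _ adm FP.
have upR : up_restrict (the_up alpha FP) := @the_up_restrict _ _ _ adm FP.
have [l0 _] := bon 0%N k0.
have bk1 l : (b l <= k.-1)%N by rewrite -ltnS prednK.
pose T := Defs.tower R Fc FP As k.-1.
pose e l : Fc * T := (f l, Defs.incl R Fc FP As k.-1 (b l) (a l)).
pose Psi t := Defs.towF R Fc FP (the_up alpha FP) As phi t k.-1.
have fE t : Psi t (nprod [seq Defs.incl R Fc FP As k.-1 (b l) (a l) | l <- enum 'I_n]) =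
    \sum_(p : {set {set 'I_n}} | partition p [set: 'I_n])
      alpha f p * \prod_(B in p) cum alpha (Psi t) (sub e B).
  have -> : [seq Defs.incl R Fc FP As k.-1 (b l) (a l) | l <- enum 'I_n] = map snd (sub e [set: 'I_n]).
    rewrite /sub -map_comp enum_set_filter (@eq_filter _ _ predT) => [|l]; last by rewrite inE.
    by rewrite filter_predT; apply: eq_map.
  rewrite -(pexp_cum adm); last by rewrite sub_nil //; apply/set0Pn; exists l0.
  rewrite -pexpSE; apply: eq_bigr => p pS; congr (_ * _).
  rewrite /pw (@wtE _ _ alpha _ n _ f (pblock p)) ?kerp_pblock //.
  rewrite enum_set_filter (@eq_filter _ _ predT) => [|l]; last by rewrite inE.
  by rewrite filter_predT.
pose cst (B : {set 'I_n}) (j : nat) := [forall l in B, b l == j].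
pose wB (B : {set 'I_n}) j : seq (Fc * As j) := [seq (f l, Defs.castA R Fc As j (b l) (a l)) | l <- enum B].
pose P j := projT1 (cid (plog_scaled (fun q : Fc * As j => q.1) (mom (phi j)))).
have HP j := projT2 (cid (plog_scaled (fun q : Fc * As j => q.1) (mom (phi j)))).
rewrite -/(P _) in HP.
pose col (B : {set 'I_n}) : nat := if [pick l in B] is Some l then b l else 0%N.
have colk B : (col B < k)%N by rewrite /col; case: pickP => //.
have colE (B : {set 'I_n}) j : B != set0 -> cst B j -> col B = j.
  move=> /set0Pn[l lB] /forall_inP cB; rewrite /col; case: pickP => [l' l'B|/(_ l)].
    exact/eqP/cB.
  by rewrite lB.
(* The cumulant of a block as a polynomial in the variable of its colour: that of the rescaled
   functional for a single colour, and [0] for a mixed block by [indep_tower]. *)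
pose Q (B : {set 'I_n}) : {poly C} := if cst B (col B) then P (col B) (wB B (col B)) else 0.
have sizeB (B : {set 'I_n}) j : B != set0 -> ~~ nilp (wB B j).
  by move=> B0; rewrite /nilp size_map -cardE cards_eq0.
have cumE t (B : {set 'I_n}) : B != set0 -> cum alpha (Psi t) (sub e B) = (Q B).[(t (col B))%:C%C].
  move=> B0; rewrite /Q; have [cB|ncB] := boolP (cst B (col B)).
    have [/(_ (t (col B))%:C%C) <- _ _] := HP (col B) _ (sizeB B (col B) B0).
    have -> : sub e B = [seq (q.1, Defs.incl R Fc FP As k.-1 (col B) q.2) | q <- wB B (col B)].
      rewrite -map_comp; apply/eq_in_map => l; rewrite mem_enum => lB /=.
      rewrite /e; congr (_, _); apply: incl_castA.
      by have /forall_inP/(_ l lB)/eqP := cB.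
    have cm : (col B <= k.-1)%N by rewrite -ltnS prednK.
    have [hi _] := @incl_mfhom _ _ FP As k.-1 (col B) cm.
    rewrite (cum_mono adm (psi := fun x => (t (col B))%:C%C * phi (col B) x) hi) ?sizeB //.
    by move=> x; apply: (@towF_incl _ _ FP As _ phi t upL upR lphi).
  rewrite horner0.
  pose w := [seq (((b l, f l), Defs.incl R Fc FP As k.-1 (b l) (a l)) : (nat * Fc) * T) | l <- enum B].
  have -> : sub e B = uncol w by rewrite /uncol /w -map_comp.
  apply: (@indep_tower _ _ FP As alpha adm phi lphi t k.-1).
    rewrite all_map; apply/allP => l _ /=; apply/asboolP; split=> //=.
    by exists (a l).
  move=> c; apply: contra ncB => /allP cw.
  have cB : cst B c.
    apply/forall_inP => l lB; apply: (cw (((b l, f l), Defs.incl R Fc FP As k.-1 (b l) (a l)))).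
    by apply: map_f; rewrite mem_enum.
  by rewrite (colE B c).
have Q0 (B : {set 'I_n}) : B != set0 -> (Q B)`_0 = 0.
  by move=> B0; rewrite /Q; case: ifP => _; rewrite ?coef0 //; have [] := HP (col B) _ (sizeB B (col B) B0).
pose PP (p : {set {set 'I_n}}) (j : nat) := \prod_(B in p | col B == j) Q B.
have FE : (fun t => Psi t (nprod [seq Defs.incl R Fc FP As k.-1 (b l) (a l) | l <- enum 'I_n])) =
    (fun t => \sum_(p : {set {set 'I_n}} | partition p [set: 'I_n])
       alpha f p * \prod_(j < k) (PP p j).[(t j)%:C%C]).
  apply/funext => t; rewrite fE; apply: eq_bigr => p pS; congr (_ * _).
  rewrite (partition_big (fun B => Ordinal (colk B)) predT) //=.
  apply: eq_bigr => j _; rewrite horner_prod; apply: eq_big => [B|B]; first by rewrite -val_eqE.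
  by move=> /andP[Bp /eqP <-]; rewrite cumE ?(partition_neq0 pS).
rewrite [X in mpd X]FE.
suff -> : alpha f [set [set l : 'I_n | b l == kappa] | kappa : 'I_k] *
    \prod_(kappa < k) phi kappa (nprod [seq Defs.castA R Fc As kappa (b l) (a l) | l <- enum 'I_n & b l == kappa])
  = \sum_(p : {set {set 'I_n}} | partition p [set: 'I_n]) alpha f p * \prod_(j < k) (PP p j)`_1.
  exact: mpd_separable.
rewrite (kerp_ord bk bon) (bigD1 (kerp b)) /=; last exact: kerp_part.
have classE (B : {set 'I_n}) l : B \in kerp b -> l \in B -> B = [set l' | b l' == b l].
  by move=> /imsetP[i _ ->]; rewrite inE => /eqP->.
rewrite [X in _ = _ + X]big1 ?addr0 => [|p /andP[pS pN]].
  congr (_ * _); apply: eq_bigr => j _; rewrite /PP.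
  pose Bj := [set l | b l == j]; have [lj Elj] := bon j (ltn_ord j).
  have Bj0 : Bj != set0 by apply/set0Pn; exists lj; rewrite inE Elj.
  have cBj : cst Bj j by apply/forall_inP => l; rewrite inE.
  have Ecol := colE _ _ Bj0 cBj.
  rewrite (bigD1 Bj) /=; last by rewrite Ecol eqxx andbT /Bj -Elj mem_kerp.
  rewrite big1 => [|B /andP[/andP[Bp /eqP Bc] BN]].
    rewrite mulr1 /Q Ecol cBj; have [_ _ ->] := HP j _ (sizeB _ j Bj0).
    rewrite /mom /wB -map_comp /Bj enum_set_filter; congr (phi _ (nprod _)).
    by rewrite (@eq_filter _ _ (fun l => b l == j)) // => l; rewrite inE.
  case/eqP: BN; have /set0Pn[l lB] := partition_neq0 (kerp_part b) Bp.
  have EB := classE _ _ Bp lB; rewrite EB /Bj.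
  suff -> : b l = j by [].
  by rewrite -Bc; apply/esym/colE; [apply/set0Pn; exists l | apply/forall_inP => l'; rewrite EB inE].
have ex0 j : (j < k)%N -> (PP p j)`_1 = 0 -> alpha f p * \prod_(j < k) (PP p j)`_1 = 0.
  by move=> jk j0; rewrite (bigD1 (Ordinal jk)) //= j0 mul0r mulr0.
have [/forall_inP allc|/forall_inPn[B Bp ncB]] := boolP [forall B in p, cst B (col B)]; last first.
  apply: (ex0 _ (colk B)); rewrite /PP (bigD1 B) /=; last by rewrite Bp eqxx.
  by rewrite {1}/Q (negbTE ncB) mul0r coef0.
have cov i : i \in cover p by rewrite (cover_partition pS) inE.
(* Every block now has one colour, but [p] differs from the partition into colour classes, so some
   class is cut into at least two blocks. Two polynomials without constant term in the same variable
   leave no linear coefficient. *)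
have [i iN] : exists i, pblock p i != [set l | b l == b i].
  apply/existsP; rewrite -[X in is_true X]negbK negb_exists; apply: contra pN => /forallP al.
  rewrite -(kerp_pblock pS); apply/eqP/eq_kerp => i j.
  have /negPn/eqP Ei := al i.
  by rewrite eq_pblock ?(partition_trivIset pS) // Ei inE eq_sym.
have bip l : l \in pblock p i -> b l = b i.
  move=> li; have /forall_inP c := allc _ (pblock_mem (cov i)).
  by rewrite (eqP (c l li)) (eqP (c i _)) // mem_pblock.
have [l bl lN] : exists2 l, b l = b i & l \notin pblock p i.
  move: iN; rewrite eqEsubset negb_and => /orP[/subsetPn[l /bip bl]|/subsetPn[l]].
    by rewrite inE bl eqxx.
  by rewrite inE => /eqP bl lN; exists l.
have cE x : col (pblock p x) = b x.
  apply: colE; first by apply: (partition_neq0 pS); apply: pblock_mem.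
  have /forall_inP c := allc _ (pblock_mem (cov x)).
  by apply/forall_inP => y yx; rewrite (eqP (c y yx)) eq_sym; apply: c; rewrite mem_pblock.
apply: (ex0 (b i) (bk i)).
apply: (proj2 (@coef01_prod _ (fun B => (B \in p) && (col B == b i)) Q (pblock p i) (pblock p l) _ _ _ _ _)).
- by rewrite pblock_mem // cE eqxx.
- by rewrite pblock_mem // cE bl eqxx.
- by apply: contraNneq lN => <-; rewrite mem_pblock.
- by apply/Q0/(partition_neq0 pS)/pblock_mem.
- by apply/Q0/(partition_neq0 pS)/pblock_mem.
Qed.

End Highest.

(** ** Free multi-faced algebras *)

Section Free.
Variables (R : realType) (Fc : finType).
Local Notation C := (complex R).

(* [{poly C}] with product ['X * p * q] is the free nonunital algebra on the letter [1]. *)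
Definition one_letter_nalg : nalg R.
Proof.
refine (@NAlg R {poly C} (fun p q => 'X * p * q) _ _ _ _ _) => *.
- by rewrite !mulrA (mulrAC 'X _ 'X).
- by rewrite mulrDr mulrDl.
- by rewrite mulrDr.
- by rewrite -scalerAr -scalerAl.
- by rewrite -scalerAr.
Defined.

Definition letter1 : one_letter_nalg := (1 : {poly C}).

Fixpoint npow (D : nalg R) (d : D) (i : nat) : D :=
  if i is i'.+1 then nmul d (npow d i') else d.

Lemma letter1_pow i : npow letter1 i = 'X^i :> {poly C}.
Proof.
elim: i => [|i IH] /=; first by rewrite expr0.
by rewrite -[LHS]/('X * (1 : {poly C}) * npow letter1 i) IH mulr1 exprS.
Qed.

Lemma one_letter_ind (S : one_letter_nalg -> Prop) : subalg S -> S letter1 -> forall p, S p.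
Proof.
move=> [S0 SL SM] S1 p; rewrite -[p](@coefK C) poly_def.
have SX i : S ('X^i : {poly C}).
  by rewrite -letter1_pow; elim: i => //= i IH; apply: SM.
apply: (big_ind (fun q : {poly C} => S q)) => // [q r Sq Sr|i _].
  by have := SL 1 q r Sq Sr; rewrite scale1r.
by have := SL p`_i 'X^i 0 (SX i) S0; rewrite addr0.
Qed.

Lemma one_letter_hom (D : nalg R) (d : D) :
  exists h : one_letter_nalg -> D, nhom h /\ h letter1 = d.
Proof.
pose h (p : {poly C}) : D := \sum_(i < size p) p`_i *: npow d i.
have hN (p : {poly C}) N : (size p <= N)%N -> h p = \sum_(i < N) p`_i *: npow d i.
  move=> pN; rewrite /h (big_ord_widen N (fun i => p`_i *: npow d i)) // big_mkcond /=.
  by apply: eq_bigr => i _; case: ltnP => // pi; rewrite nth_default ?scale0r.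
have hL c (p q : {poly C}) : h (c *: p + q) = c *: h p + h q.
  pose N := maxn (size p) (size q).
  have s1 : (size (c *: p + q)%R <= N)%N.
    apply: leq_trans (size_polyD _ _) _; rewrite geq_max leq_maxr andbT.
    by apply: leq_trans (size_scale_leq _ _) (leq_maxl _ _).
  rewrite (hN _ N s1) (hN p N) ?leq_maxl // (hN q N) ?leq_maxr //.
  rewrite scaler_sumr -big_split /=; apply: eq_bigr => i _.
  by rewrite coefD coefZ scalerDl scalerA.
have hX i : h 'X^i = npow d i.
  rewrite (hN _ i.+1) ?size_polyXn // big_ord_recr /= coefXn eqxx scale1r.
  rewrite big1 ?add0r // => j _; rewrite coefXn ltn_eqF ?scale0r //.
have h0 : h 0 = 0 by rewrite /h size_poly0 big_ord0.
exists h; split; last by rewrite /letter1 -(expr0 'X) hX.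
split; first exact: hL.
move=> p.
have hXq r : h ('X * r) = nmul d (h r).
  rewrite (hN _ (size r).+1); last first.
    have [->|r0] := eqVneq r 0; first by rewrite mulr0 size_poly0.
    by rewrite mulrC size_mulX.
  rewrite big_ord_recl coefXM /= scale0r add0r /h.
  rewrite (big_morph (nmul d) (nmulDr d) (nmul0r d)); apply: eq_bigr => i _.
  by rewrite coefXM /= nmulZr.
apply: (one_letter_ind (S := fun p => forall q, h (nmul p q) = nmul (h p) (h q))); last first.
  by move=> q; rewrite -[nmul _ _]/('X * (1 : {poly C}) * q) mulr1 hXq /letter1 -(expr0 'X) hX.
split; first by move=> q; rewrite nmul0l h0 nmul0l.
  by move=> c u v Eu Ev q; rewrite nmulDl nmulZl !hL nmulDl nmulZl Eu Ev.
by move=> u v Eu Ev q; rewrite -nmulA !Eu Ev nmulA.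
Qed.

Lemma hom_on0 (A D : nalg R) (S : A -> Prop) (g : A -> D) : S 0 -> hom_on S g -> g 0 = 0.
Proof.
move=> S0 [gL _]; have := gL (-1) 0 0 S0 S0.
by rewrite scaler0 addr0 scaleN1r addNr.
Qed.

Definition one_letter_face (q Q : Fc) (p : one_letter_nalg) : Prop := Q = q \/ p = 0.

Lemma one_letter_face_sub q Q : subalg (one_letter_face q Q).
Proof.
split; first by right.
  move=> c x y [->|->]; first by left.
  by case=> [->|->]; [left | right; rewrite scaler0 addr0].
move=> x y [->|->]; first by left.
by right; rewrite nmul0l.
Qed.

Lemma one_letter_coprod q : coprod_of_subalgs (one_letter_face q).
Proof.
move=> D g gh; split; last first.
  by move=> h1 h2 _ _ E1 E2 x; rewrite (E1 q) ?(E2 q) //; left.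
exists (g q); split.
  by have [gL gM] := gh q; split=> [c x y|x y]; [apply: gL | apply: gM]; left.
move=> Q x [->//|->].
by rewrite (hom_on0 _ (gh q)) ?(hom_on0 _ (gh Q)) //; right.
Qed.

Definition one_letter (q : Fc) : mfalg R Fc :=
  MFAlg (one_letter_face_sub q) (@one_letter_coprod q).

Definition zero_nalg : nalg R.
Proof.
by refine (@NAlg R 'rV[C]_0 (fun _ _ => 0) _ _ _ _ _) => *; rewrite ?addr0 ?scaler0.
Defined.

Lemma zero_nalg_all0 (x : zero_nalg) : x = 0.
Proof. exact: (thinmx0 (x : 'rV[C]_0)). Qed.

Lemma zero_face_sub (Q : Fc) : subalg (fun x : zero_nalg => True).
Proof. by []. Qed.

Lemma zero_coprod : coprod_of_subalgs (fun (Q : Fc) (x : zero_nalg) => True).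
Proof.
move=> D g gh; split.
  exists (fun _ => 0); split; first exact: nhom_cst0.
  by move=> Q x _; rewrite (zero_nalg_all0 x) (hom_on0 _ (gh Q)).
by move=> h1 h2 hh1 hh2 _ _ x; rewrite (zero_nalg_all0 x) !nhom0.
Qed.

Definition zero_mfalg : mfalg R Fc := MFAlg zero_face_sub zero_coprod.

(** Letters are indexed by [nat], with only those below [n] meaningful. [free_univ] asks for
    existence alone: uniqueness follows from [free_face], which says in induction form that each
    face is generated by its letters. *)
Record is_free (n : nat) (f : nat -> Fc) (F : mfalg R Fc) (x : nat -> F) : Prop := IsFree {
  free_letter : forall i, (i < n)%N -> mf_face F (f i) (x i);
  free_univ : forall (D : nalg R) (d : nat -> D),
    exists h : F -> D, nhom h /\ forall i, (i < n)%N -> h (x i) = d i;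
  free_face : forall Q (S : F -> Prop), subalg S ->
    (forall i, (i < n)%N -> f i = Q -> S (x i)) -> forall z, mf_face F Q z -> S z }.

Lemma free_exists (FP : fpchoice R Fc) n f :
  exists (F : mfalg R Fc) (x : nat -> F), is_free n f x.
Proof.
elim: n => [|n [F [x [xF xU xS]]]].
  exists zero_mfalg, (fun _ => 0); split=> // [D d|Q S [S0 _ _] _ z _].
    by exists (fun _ => 0); split; first exact: nhom_cst0.
  by rewrite (zero_nalg_all0 z).
pose G := FP F (one_letter (f n)).
exists G, (fun i => if (i < n)%N then fp_in1 G (x i) else fp_in2 G letter1); split.
- move=> i; rewrite ltnS leq_eqVlt => /orP[/eqP->|ni].
    by rewrite ltnn; apply: fp_face2; left.
  by rewrite ni; apply/fp_face1/xF.
- move=> D d; have [h1 [hh1 E1]] := xU D d; have [h2 [hh2 E2]] := one_letter_hom (d n).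
  have [[h [hh [hE1 hE2]]] _] := fp_coprod G hh1 (hh2 : nhom (A := one_letter (f n)) h2).
  exists h; split=> // i; rewrite ltnS leq_eqVlt => /orP[/eqP->|ni]; last by rewrite ni hE1 E1.
  by rewrite ltnn hE2 E2.
move=> Q S Ss Sx z /fp_faces; apply=> // y [[y1 [fy ->]]|[y2 [fy ->]]].
  apply: (xS Q (fun t => S (fp_in1 G t))) fy; first exact: subalg_preim (fp_hom1 G) Ss.
  by move=> i ni fi; have := Sx i; rewrite ni; apply=> //; rewrite ltnW.
case: fy => [QE|->]; last by rewrite (nhom0 (fp_hom2 G)); have [] := Ss.
apply: (one_letter_ind (S := fun t => S (fp_in2 G t))); first exact: subalg_preim (fp_hom2 G) Ss.
by have := Sx n; rewrite ltnn; apply.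
Qed.

Section FreeTheory.
Variables (n : nat) (f : nat -> Fc) (F : mfalg R Fc) (x : nat -> F) (fr : is_free n f x).

Definition lword (v : seq nat) : F := nprod (map x v).
Definition below (v : seq nat) : bool := all (fun i => (i < n)%N) v.

Lemma free_ind (S : F -> Prop) : subalg S -> (forall i, (i < n)%N -> S (x i)) -> forall z, S z.
Proof.
move=> sS Sx z; apply: (coprod_genalg (@mf_coprod _ _ F) z) => // a [Q fa].
by apply: (free_face fr sS _ fa) => i ni _; apply: Sx.
Qed.

Lemma free_genalg z : genalg (fun a => exists2 i, (i < n)%N & a = x i) z.
Proof.
apply: free_ind; first exact: genalg_subalg.
by move=> i ni S _; apply; exists i.
Qed.

Lemma free_hom_ext (D : nalg R) (h k : F -> D) : nhom h -> nhom k ->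
  (forall i, (i < n)%N -> h (x i) = k (x i)) -> h =1 k.
Proof.
move=> hh kh E; apply: free_ind => //; split; first by rewrite !nhom0.
  by move=> c a b Ea Eb; rewrite (nhomL hh) (nhomL kh) Ea Eb.
by move=> a b Ea Eb; rewrite (nhomM hh) (nhomM kh) Ea Eb.
Qed.

Lemma free_lin_ext (phi psi : F -> C) : lin_fun phi -> lin_fun psi ->
  (forall v, v != [::] -> below v -> phi (lword v) = psi (lword v)) -> phi = psi.
Proof.
move=> lp lq E; apply: (lin_ext_words free_genalg lp lq) => w w0 wx.
have [v Ev vn] : exists2 v, w = map x v & below v.
  elim: w wx {w0} => [|a w IH] wx; first by exists [::].
  have [v -> vn] := IH (fun b bw => wx b (mem_behead (s := a :: w) bw)).
  by have [i ni ->] := wx a (mem_head _ _); exists (i :: v); rewrite //= ni.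
by rewrite Ev E // -size_eq0 -(size_map x) -Ev size_eq0.
Qed.

Definition fext (D : nalg R) (d : nat -> D) : F -> D := projT1 (cid (free_univ fr d)).

Lemma fext_hom (D : nalg R) (d : nat -> D) : nhom (fext d).
Proof. by rewrite /fext; case: cid => h []. Qed.

Lemma fextE (D : nalg R) (d : nat -> D) i : (i < n)%N -> fext d (x i) = d i.
Proof. by rewrite /fext; case: cid => h [] /= _; apply. Qed.

Lemma fext_lword (D : nalg R) (d : nat -> D) v : below v -> fext d (lword v) = nprod (map d v).
Proof.
move=> /allP vn; rewrite (nhom_nprod (fext_hom d)) -map_comp; congr nprod.
by apply/eq_in_map => i /vn; apply: fextE.
Qed.

Lemma fext_mfhom (B : mfalg R Fc) (d : nat -> B) :
  (forall i, (i < n)%N -> mf_face B (f i) (d i)) -> mfhom (fext d).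
Proof.
move=> fd; split; first exact: fext_hom.
move=> Q z; apply: (free_face fr (S := fun z => mf_face B Q (fext d z))).
  exact: subalg_preim (fext_hom d) (@mf_face_sub _ _ B Q).
by move=> i ni <-; rewrite fextE //; apply: fd.
Qed.

Definition append_letter (i : nat) : end_nalg ((seq nat -> C) : lmodType C) :=
  @end_mk R ((seq nat -> C) : lmodType C) (fun G w => G (rcons w i)) (fun _ _ _ => erefl).

(** Moments of words in free letters can be prescribed arbitrarily: letters act on functions on
    words by appending, and evaluation at the empty word returns [M]. *)
Lemma free_functional (M : seq nat -> C) : exists phi : F -> C, lin_fun phi /\
  forall v, v != [::] -> below v -> phi (lword v) = M v.
Proof.
pose h := fext append_letter; have hh : nhom h := fext_hom _.
exists (fun z => end_val (h z) M [::]); split.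
  by move=> c a b; rewrite (nhomL hh) end_valL.
move=> v v0 vn; rewrite /h fext_lword // end_val_nprod; last by case: (v) v0.
have -> : M v = M ([::] ++ v) by [].
elim: v [::] {v0 vn} => [|i v IH] u /=; first by rewrite cats0.
by rewrite /append_letter end_mkK IH cat_rcons.
Qed.

End FreeTheory.
End Free.

(** ** Additive convolution on a free multi-faced algebra *)

Section Convolution.
Variables (R : realType) (Fc : finType) (FP : fpchoice R Fc).
Local Notation C := (complex R).
Variables (up : UP FP) (hup : sym_univ_prod up).

Let upL : up_linear up. Proof. by case: hup => -[]. Qed.
Let upU : up_universal up. Proof. by case: hup => -[]. Qed.
Let upA : up_assoc up. Proof. by case: hup => -[]. Qed.
Let upR : up_restrict up. Proof. by case: hup => -[]. Qed.
Let upS : up_symmetric up. Proof. by case: hup. Qed.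

Section Fixed.
Variables (n : nat) (f : nat -> Fc) (F : mfalg R Fc) (x : nat -> F) (fr : is_free n f x).
Local Notation lw := (lword x).
Local Notation inn := (below n).

(** The comultiplication for which the letters are primitive; composing a product with it gives the
    law of the sum of two independent copies of the letters. *)
Definition delta : F -> FP F F :=
  fext fr (fun i => fp_in1 (FP F F) (x i) + fp_in2 (FP F F) (x i)).

Lemma face_add (B : mfalg R Fc) Q (a b : B) : mf_face B Q a -> mf_face B Q b -> mf_face B Q (a + b).
Proof.
have [_ SL _] := @mf_face_sub _ _ B Q.
by move=> fa fb; have := SL 1 a b fa fb; rewrite scale1r.
Qed.

Lemma face_scale (B : mfalg R Fc) Q c (a : B) : mf_face B Q a -> mf_face B Q (c *: a).
Proof.
have [S0 SL _] := @mf_face_sub _ _ B Q.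
by move=> fa; have := SL c a 0 fa S0; rewrite addr0.
Qed.

Lemma delta_mfhom : mfhom delta.
Proof.
by apply: fext_mfhom => i ni; apply: face_add; [apply: fp_face1 | apply: fp_face2];
  apply: free_letter fr _ ni.
Qed.

Lemma deltaE i : (i < n)%N -> delta (x i) = fp_in1 (FP F F) (x i) + fp_in2 (FP F F) (x i).
Proof. exact: fextE. Qed.

Definition addconv (chi om : F -> C) : F -> C := up chi om \o delta.

Lemma addconv_lin chi om : lin_fun chi -> lin_fun om -> lin_fun (addconv chi om).
Proof. by move=> l1 l2; apply: lin_fun_comp (upL l1 l2) (proj1 delta_mfhom). Qed.

(** [H] factors through [delta] because both agree on letters, and universality does the rest. Any
    product evaluated at sums of elements of the two factors thus becomes a convolution. *)
Lemma addconv_comp (A1 A2 : mfalg R Fc) (h1 : F -> A1) (h2 : F -> A2) (H : F -> FP A1 A2)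
    (phi1 : A1 -> C) (phi2 : A2 -> C) :
  mfhom h1 -> mfhom h2 -> lin_fun phi1 -> lin_fun phi2 -> nhom H ->
  (forall i, (i < n)%N -> H (x i) = fp_in1 (FP A1 A2) (h1 (x i)) + fp_in2 (FP A1 A2) (h2 (x i))) ->
  up phi1 phi2 \o H = addconv (phi1 \o h1) (phi2 \o h2).
Proof.
move=> m1 m2 l1 l2 hH HE.
have [k [[kh _] k1 k2]] := fp_mfhom (FP F F)
  (mfhom_comp (fp_mfhom1 (FP A1 A2)) m1) (mfhom_comp (fp_mfhom2 (FP A1 A2)) m2).
have -> : H = k \o delta.
  apply/funext; apply: (free_hom_ext fr hH); first exact: nhom_comp kh (proj1 delta_mfhom).
  by move=> i ni; rewrite /= deltaE // (nhomD kh) k1 k2 HE.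
apply/funext => z /=; rewrite /addconv /=.
by rewrite -(upU m1 m2 l1 l2 kh) //.
Qed.

Lemma addconv_assoc chi om eta : lin_fun chi -> lin_fun om -> lin_fun eta ->
  addconv (addconv chi om) eta = addconv chi (addconv om eta).
Proof.
move=> l1 l2 l3; have dm := delta_mfhom; have dh := proj1 dm.
pose T := FP (FP F F) F; pose T' := FP F (FP F F).
pose H := fext fr (fun i => fp_in1 T (delta (x i)) + fp_in2 T (x i)).
pose H' := fext fr (fun i => fp_in1 T' (x i) + fp_in2 T' (delta (x i))).
have -> : addconv (addconv chi om) eta = up (up chi om) eta \o H.
  rewrite (addconv_comp (h1 := delta) (h2 := id) dm (mfhom_id _) (upL l1 l2) l3 (fext_hom _ _)) //.
  by move=> i ni; rewrite fextE.
have -> : addconv chi (addconv om eta) = up chi (up om eta) \o H'.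
  rewrite (addconv_comp (h1 := id) (h2 := delta) (mfhom_id _) dm l1 (upL l2 l3) (fext_hom _ _)) //.
  by move=> i ni; rewrite fextE.
have h21 := nhom_comp (fp_hom2 T') (fp_hom1 (FP F F)).
have h22 := nhom_comp (fp_hom2 T') (fp_hom2 (FP F F)).
have [[k0 [kh0 [k01 k02]]] _] := fp_coprod (FP F F) (fp_hom1 T') h21.
have [[k [kh [k1 k2]]] _] := fp_coprod T kh0 h22.
apply/funext => z /=; rewrite (upA l1 l2 l3 kh); last 3 first.
- by move=> y; rewrite k1 k01.
- by move=> y; rewrite k1 k02.
- by move=> y; rewrite k2.
congr (up chi (up om eta) _); apply: (free_hom_ext fr (nhom_comp kh (fext_hom fr _)) (fext_hom fr _)).
move=> i ni; rewrite /= !fextE // (nhomD kh) k1 k2 deltaE // (nhomD kh0) k01 k02.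
by rewrite (nhomD (fp_hom2 T')) addrA.
Qed.

Lemma addconv_comm chi om : lin_fun chi -> lin_fun om -> addconv chi om = addconv om chi.
Proof.
move=> l1 l2; have dh := proj1 delta_mfhom.
have [[k [kh [k1 k2]]] _] := fp_coprod (FP F F) (fp_hom2 (FP F F)) (fp_hom1 (FP F F)).
apply/funext => z; rewrite /addconv /= (upS l1 l2 kh) //; congr (up om chi _).
apply: (free_hom_ext fr (nhom_comp kh dh) dh) => i ni.
by rewrite /= deltaE // (nhomD kh) k1 k2 addrC.
Qed.

Lemma addconv0f om : lin_fun om -> addconv (fun _ => 0) om = om.
Proof.
move=> l; have l0 := @lin_fun_cst0 R F.
have := @addconv_comp _ _ (fun _ => 0) id (fp_in2 (FP F F)) (fun _ => 0) om
  (mfhom_cst0 _ _) (mfhom_id _) l0 l (fp_hom2 _).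
move=> H; rewrite -[LHS]H; last by move=> i ni; rewrite (nhom0 (fp_hom1 _)) add0r.
by apply/funext => z /=; have [_ ->] := upR l0 l.
Qed.

Lemma addconvf0 om : lin_fun om -> addconv om (fun _ => 0) = om.
Proof. by move=> l; rewrite addconv_comm ?addconv0f //; apply: lin_fun_cst0. Qed.

Definition diag (s : nat -> C) : F -> F := fext fr (fun i => s i *: x i).

Lemma diag_mfhom s : mfhom (diag s).
Proof. by apply: fext_mfhom => i ni; apply/face_scale/(free_letter fr). Qed.

Lemma diagE s i : (i < n)%N -> diag s (x i) = s i *: x i.
Proof. exact: fextE. Qed.

Lemma diag_lword s v : v != [::] -> inn v -> diag s (lw v) = (\prod_(i <- v) s i) *: lw v.
Proof.
elim: v => // i v IH _ /andP[ni vn]; rewrite big_cons.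
have [->|v0] := eqVneq v [::]; first by rewrite big_nil mulr1; exact: diagE.
have E : lw (i :: v) = nmul (x i) (lw v) by rewrite /lword /= nprod_cons // -size_eq0 size_map size_eq0.
by rewrite E (nhomM (proj1 (diag_mfhom s))) IH // diagE // nmulZl nmulZr scalerA.
Qed.

Lemma addconv_diag s chi om : lin_fun chi -> lin_fun om ->
  addconv (chi \o diag s) (om \o diag s) = addconv chi om \o diag s.
Proof.
move=> l1 l2; have dm := diag_mfhom s; have dh := proj1 delta_mfhom.
rewrite -(addconv_comp (H := delta \o diag s) dm dm l1 l2) //.
  exact: nhom_comp dh (proj1 dm).
move=> i ni; rewrite /= diagE // (nhomZ dh) deltaE // scalerDr.
by rewrite (nhomZ (fp_hom1 _)) (nhomZ (fp_hom2 _)).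
Qed.

(** Setting a letter to [0] is a rescaling, hence compatible with convolution. *)
Definition kill (i : nat) : F -> F := diag (fun j => (j != i)%:R).

Lemma prod_kill (i : nat) (v : seq nat) : \prod_(j <- v) ((j != i)%:R : C) = (i \notin v)%:R.
Proof.
elim: v => [|j v IH]; first by rewrite big_nil.
rewrite big_cons IH inE negb_or eq_sym; case: eqVneq => _ /=; by rewrite ?mul0r ?mul1r.
Qed.

Lemma kill_lword i v : v != [::] -> inn v -> kill i (lw v) = if i \in v then 0 else lw v.
Proof.
by move=> v0 vn; rewrite /kill diag_lword // prod_kill; case: ifP => _; rewrite ?scale0r ?scale1r.
Qed.

Lemma kill_letter i j : (j < n)%N -> kill i (x j) = if j == i then 0 else x j.
Proof. by move=> nj; rewrite /kill diagE //; case: eqP => _; rewrite ?scale0r ?scale1r. Qed.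

Lemma kill_mfhom i : mfhom (kill i). Proof. exact: diag_mfhom. Qed.

Lemma addconv_kill i chi om : lin_fun chi -> lin_fun om ->
  addconv (chi \o kill i) (om \o kill i) = addconv chi om \o kill i.
Proof. exact: addconv_diag. Qed.

Lemma nprod_letter_sum (D : nalg R) (U V W : nat -> D) (i : nat) (v : seq nat) :
  count_mem i v = 1%N -> U i = V i + W i ->
  {in v, forall j, j != i -> U j = V j /\ U j = W j} ->
  nprod (map U v) = nprod (map V v) + nprod (map W v).
Proof.
move=> ci Ui UVW; have iv : i \in v by rewrite -has_pred1 has_count ci.
case/splitPr: iv ci UVW => u1 u2; rewrite count_cat /= eqxx => ci UVW.
have nu j : j \in u1 ++ u2 -> j != i.
  move=> ju; apply/eqP => ji; move: ci; rewrite addnCA => -[] /eqP.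
  by rewrite -count_cat -leqn0 leqNgt -has_count has_pred1 -ji ju.
have E (P : nat -> D) : {in u1 ++ u2, U =1 P} -> map U u1 = map P u1 /\ map U u2 = map P u2.
  by move=> UP; split; apply/eq_in_map => j ju; apply: UP; rewrite mem_cat ju ?orbT.
have [V1 V2] : map U u1 = map V u1 /\ map U u2 = map V u2.
  apply: E => j ju; have [] // := UVW j; last exact: nu.
  by move: ju; rewrite !mem_cat inE => /orP[]->; rewrite ?orbT.
have [W1 W2] : map U u1 = map W u1 /\ map U u2 = map W u2.
  apply: E => j ju; have [] // := UVW j; last exact: nu.
  by move: ju; rewrite !mem_cat inE => /orP[]->; rewrite ?orbT.
rewrite !map_cat /= Ui -V1 -V2 -W1 -W2.
by have := nprod_lin (map U u1) (map U u2) 1 (V i) (W i); rewrite !scale1r.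
Qed.

(** The word is linear in its only slot with the two copies of [x i]. In each of the two terms one
    copy does not occur, so it may be killed in its factor. *)
Lemma addconv_expand chi om i v : lin_fun chi -> lin_fun om -> (i < n)%N -> inn v ->
  count_mem i v = 1%N ->
  addconv chi om (lw v) = addconv chi (om \o kill i) (lw v) + addconv (chi \o kill i) om (lw v).
Proof.
move=> l1 l2 ni vn ci; have km := kill_mfhom i.
pose U j := fp_in1 (FP F F) (x j) + fp_in2 (FP F F) (x j).
pose V j := fp_in1 (FP F F) (x j) + fp_in2 (FP F F) (kill i (x j)).
pose W j := fp_in1 (FP F F) (kill i (x j)) + fp_in2 (FP F F) (x j).
rewrite -[om in addconv (_ \o _) om]/(om \o id) -[chi in addconv chi (om \o kill i)]/(chi \o id).
rewrite -(addconv_comp (H := fext fr V) (mfhom_id _) km l1 l2 (fext_hom _ _)); last first.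
  by move=> j nj; rewrite fextE.
rewrite -(addconv_comp (H := fext fr W) km (mfhom_id _) l1 l2 (fext_hom _ _)); last first.
  by move=> j nj; rewrite fextE.
rewrite /addconv /= /delta !fext_lword // (@nprod_letter_sum _ U V W i) //.
- by rewrite (lin_funD (upL l1 l2)).
- rewrite /V /W kill_letter // eqxx (nhom0 (fp_hom2 _)) (nhom0 (fp_hom1 _)).
  by rewrite addr0 add0r.
move=> j jv ji; have nj : (j < n)%N by apply: (allP vn).
by rewrite /V /W kill_letter // (negbTE ji).
Qed.

End Fixed.

End Convolution.

(** ** Convolution only sees words without repeated letters *)

Section UniqueLetters.
Variables (R : realType) (Fc : finType) (FP : fpchoice R Fc).
Local Notation C := (complex R).

Section Scan.
Variables n i : nat.

(* Scans the occurrences of [i] and of the fresh letter [n]: [0] none so far, [1] starts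
   with [i] and has no [n], [2] starts with [n] and continues with [i] only, [3] otherwise. *)
Definition scan_step (s l : nat) : nat :=
  if l == n then (if s == 0 then 2 else 3)%N
  else if l == i then (if s == 0 then 1 else s)%N else s.
Definition scan (u : seq nat) : nat := foldl scan_step 0%N u.
Definition merge_letter (l : nat) : nat := if l == n then i else l.
Definition mrg := map merge_letter.

Lemma scan_rcons u l : scan (rcons u l) = scan_step (scan u) l.
Proof. by rewrite /scan -cats1 foldl_cat. Qed.

Lemma mrg_rcons u l : mrg (rcons u l) = rcons (mrg u) (merge_letter l).
Proof. exact: map_rcons. Qed.

Lemma scan_le3 u : (scan u <= 3)%N.
Proof.
elim/last_ind: u => // u l; rewrite scan_rcons /scan_step.
by do 4![case: ifP => // _].
Qed.

Lemma scan0 u : scan u = 0%N -> i \notin mrg u.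
Proof.
elim/last_ind: u => // u l IH; rewrite scan_rcons mrg_rcons mem_rcons inE /scan_step /merge_letter.
case: ifP => _; first by case: ifP.
by case: eqP => [_|/eqP li /IH]; [case: eqP | rewrite eq_sym (negbTE li)].
Qed.

Lemma scan_no_fresh u : n \notin u -> (scan u <= 1)%N /\ mrg u = u.
Proof.
elim/last_ind: u => // u l IH; rewrite mem_rcons inE negb_or => /andP[nl /IH[s1 m]].
rewrite scan_rcons mrg_rcons m /scan_step /merge_letter eq_sym (negbTE nl); split=> //.
by case: ifP => // _; case: ifP.
Qed.

Lemma scan_no_old u : i \notin u -> scan u = (if count_mem n u is c.+1 then if c is 0 then 2 else 3 else 0)%N.
Proof.
elim/last_ind: u => // u l IH; rewrite mem_rcons inE negb_or => /andP[il /IH s].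
rewrite scan_rcons s /scan_step -cats1 count_cat /= addn0 (eq_sym l i) (negbTE il).
case: eqP => _ /=; last by rewrite addn0.
by rewrite addn1; case: (count _ _) => [|[|k]].
Qed.
End Scan.

Variables (up : UP FP) (hup : sym_univ_prod up).
Let upL : up_linear up. Proof. by case: hup => -[]. Qed.
Variables (n : nat) (f : nat -> Fc) (F : mfalg R Fc) (x : nat -> F) (fr : is_free n f x).
Local Notation lw := (lword x).
Local Notation inn := (below n).
Local Notation star := (addconv up fr).
Local Notation kill := (kill fr).

Lemma kill_agree (chi chi' : F -> C) i : lin_fun chi -> lin_fun chi' ->
  (forall u, u != [::] -> inn u -> i \notin u -> chi (lw u) = chi' (lw u)) ->
  chi \o kill i = chi' \o kill i.
Proof.
move=> l1 l2 E; have hk := proj1 (kill_mfhom fr i).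
apply: (free_lin_ext fr (lin_fun_comp l1 hk) (lin_fun_comp l2 hk)) => u u0 un /=.
rewrite (kill_lword fr) //; case: ifP => [|/negbT iu]; last exact: E.
by rewrite !lin_fun0.
Qed.

(* With a fresh letter [y] of the same face as [x i], multilinearity in the slot of [x i]
   gives [value(x i + y) = value(x i) + value(y)], while the joint moments of [x i]
   and [y] can be prescribed so that [x i], [y], [x i + y] have the laws of
   [chi], [chi \o kill i] and [chi']. *)
Lemma fresh_letter_law (chi chi' : F -> C) i (G : mfalg R Fc) (xG : nat -> G)
    (frG : is_free n.+1 (fun j => if j == n then f i else f j) xG) : (i < n)%N ->
  lin_fun chi -> lin_fun chi' ->
  (forall u, u != [::] -> inn u -> (count_mem i u <= 1)%N -> chi (lw u) = chi' (lw u)) ->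
  exists Phi : G -> C, [/\ lin_fun Phi, Phi \o fext fr xG = chi,
    Phi \o fext fr (fun j => if j == i then xG n else xG j) = chi \o kill i
    & Phi \o fext fr (fun j => if j == i then xG i + xG n else xG j) = chi'].
Proof.
move=> ni l1 l2 E; pose M (u : seq nat) := let s := scan n i u in
  if (s <= 1)%N then chi (lw (mrg n i u))
  else if s == 2 then chi' (lw (mrg n i u)) - chi (lw (mrg n i u)) else 0.
have [Phi [lP PE]] := free_functional frG M.
have iN : (i == n) = false by rewrite ltn_eqF.
have innN u : inn u -> n \notin u.
  by move=> /allP un; apply/negP => /un; rewrite ltnn.
have innS u : inn u -> below n.+1 u by apply: sub_all => j; apply: ltnW.
exists Phi; split=> //.
- apply: (free_lin_ext fr (lin_fun_comp lP (fext_hom fr _)) l1) => u u0 un /=.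
  rewrite fext_lword // PE ?innS // /M.
  by have [-> ->] := scan_no_fresh i (innN u un).
- have hk := proj1 (kill_mfhom fr i).
  apply: (free_lin_ext fr (lin_fun_comp lP (fext_hom fr _)) (lin_fun_comp l1 hk)) => u u0 un /=.
  rewrite fext_lword // (kill_lword fr) //.
  pose u' := map (fun j => if j == i then n else j) u.
  have -> : nprod [seq (if j == i then xG n else xG j) | j <- u] = lword xG u'.
    by rewrite /lword -map_comp; congr nprod; apply: eq_map => j /=; case: ifP.
  have iu' : i \notin u'.
    by apply/mapP => -[j _]; case: eqP => [_ /eqP|ji /esym//]; rewrite iN.
  have mu' : mrg n i u' = u.
    rewrite /mrg -map_comp -[RHS]map_id; apply/eq_in_map => j ju; rewrite /= /merge_letter.
    have nj : (j < n)%N by apply: (allP un).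
    by case: (eqVneq j i) => [->|_]; rewrite ?eqxx // ltn_eqF.
  have cu' : count_mem n u' = count_mem i u.
    rewrite count_map; apply: eq_in_count => j ju /=.
    have nj : (j < n)%N by apply: (allP un).
    by case: (eqVneq j i) => [_|_]; rewrite ?eqxx // ltn_eqF.
  have inu' : below n.+1 u'.
    by rewrite /below all_map; apply: sub_all un => j nj /=; case: ifP => // _; apply: ltnW.
  rewrite PE ?inu' //; last by rewrite -size_eq0 size_map size_eq0.
  rewrite /M (@scan_no_old n i u' iu') mu' cu'.
  have [iu|iu] := boolP (i \in u); last first.
    by have /count_memPn -> := iu.
  have : (0 < count_mem i u)%N by rewrite -has_count has_pred1.
  case c : (count_mem i u) => [|[|k]] // _; rewrite ?(lin_fun0 l1) //=.
  by rewrite E ?c // subrr.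
(* [r] is the prefix already expanded, and its state decides the sum over all expansions of the
   rest. From state [0], the next [x i + y] contributes [chi] through [x i] and [chi' - chi] through
   [y], together [chi']. *)
have key u : inn u -> forall r, below n.+1 r -> r ++ u != [::] ->
   Phi (nprod (map xG r ++ [seq (if j == i then xG i + xG n else xG j) | j <- u])) =
   let s := scan n i r in let w := lw (mrg n i r ++ u) in
   if s == 0%N then chi' w else if s == 1%N then chi w else if s == 2 then chi' w - chi w else 0.
  elim: u => [|l u IH].
    move=> _ r rn; rewrite !cats0 => r0 /=; rewrite PE // /M.
    have := @scan_le3 n i r; case s : (scan n i r) => [|[|[|[|]]]] //= _.
    apply: E; first by rewrite -size_eq0 size_map size_eq0.
      rewrite /below all_map; apply/allP => j /(allP rn) /=; rewrite ltnS /merge_letter leq_eqVlt.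
      by case: (eqVneq j n).
    by have /count_memPn -> := scan0 s.
  rewrite /= => /andP[ln un] r rn _.
  have ln' : (l == n) = false by rewrite ltn_eqF.
  have rl : forall j, (j < n.+1)%N -> below n.+1 (rcons r j).
    by move=> j jn; rewrite /below all_rcons jn.
  have r0 j : rcons r j ++ u != [::] by rewrite cat_rcons -size_eq0 size_cat /= addnS.
  have IHl := IH un _ (rl l (ltnW ln)) (r0 l); have IHn := IH un _ (rl n (ltnSn n)) (r0 n).
  have step : forall j, map xG r ++ xG j :: [seq (if j == i then xG i + xG n else xG j) | j <- u] =
      map xG (rcons r j) ++ [seq (if j == i then xG i + xG n else xG j) | j <- u].
    by move=> j; rewrite map_rcons cat_rcons.
  move: IHl IHn; rewrite !scan_rcons !mrg_rcons !cat_rcons /scan_step /merge_letter eqxx ln'.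
  case: (eqVneq l i) => [li|_]; last by rewrite step.
  have := nprod_lin (map xG r) [seq (if j == i then xG i + xG n else xG j) | j <- u] 1 (xG i) (xG n).
  rewrite !scale1r => ->; rewrite (lin_funD lP) !step {}li => -> ->.
  have := @scan_le3 n i r; case: (scan n i r) => [|[|[|[|]]]] //= _; rewrite ?addr0 //.
  by rewrite addrC subrK.
apply: (free_lin_ext fr (lin_fun_comp lP (fext_hom fr _)) l2) => u u0 un /=.
by rewrite fext_lword //; have /= := key u un [::] isT u0.
Qed.

(** After [addconv_expand] only the terms with [om \o kill i] have to be compared. There the slot is
    additive in [x i + y], and the term of [y] vanishes: both of its factors are killed at [i],
    while [v] contains [i]. *)
Lemma addconv_letter chi chi' om i v : lin_fun chi -> lin_fun chi' -> lin_fun om -> (i < n)%N ->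
  (forall u, u != [::] -> inn u -> (count_mem i u <= 1)%N -> chi (lw u) = chi' (lw u)) ->
  v != [::] -> inn v -> (count_mem i v <= 1)%N ->
  star chi om (lw v) = star chi' om (lw v).
Proof.
move=> l1 l2 lo ni E v0 vn cv; have km := kill_mfhom fr i; have hk := proj1 km.
have kE : chi \o kill i = chi' \o kill i.
  apply: kill_agree => // u u0 un iu; apply: E => //.
  by have /count_memPn -> := iu.
case c : (count_mem i v) => [|k].
  have iv : i \notin v by apply/count_memPn.
  have kv : kill i (lw v) = lw v by rewrite (kill_lword fr) // (negbTE iv).
  have H ph : lin_fun ph -> star ph om (lw v) = star (ph \o kill i) (om \o kill i) (lw v).
    by move=> lp; rewrite (addconv_kill hup) //= kv.
  by rewrite (H chi) // (H chi') // kE.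
have {k c cv} c : count_mem i v = 1%N by case: k c cv => // k ->.
rewrite (addconv_expand hup fr l1 lo ni vn c) (addconv_expand hup fr l2 lo ni vn c) kE; congr (_ + _).
have [G [xG frG]] := free_exists FP n.+1 (fun j => if j == n then f i else f j).
have [Phi [lP Px Py Ps]] := fresh_letter_law frG ni l1 l2 E; rewrite -Px -Ps.
have iN : (i == n) = false by rewrite ltn_eqF.
have fG j : (j < n)%N -> mf_face G (f j) (xG j).
  by move=> nj; have := free_letter frG (ltnW nj); rewrite ltn_eqF.
have fGn : mf_face G (f i) (xG n) by have := free_letter frG (ltnSn n); rewrite eqxx.
have mx : mfhom (fext fr xG) by apply: fext_mfhom.
have my : mfhom (fext fr (fun j => if j == i then xG n else xG j)).
  by apply: fext_mfhom => j nj; case: eqP => [->|_]; [exact: fGn | exact: fG].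
have ms : mfhom (fext fr (fun j => if j == i then xG i + xG n else xG j)).
  apply: fext_mfhom => j nj; case: eqP => [->|_]; last exact: fG.
  by apply: face_add => //; apply: fG.
pose U (a : nat -> G) j := fp_in1 (FP G F) (a j) + fp_in2 (FP G F) (kill i (x j)).
have H a : mfhom (fext fr a) -> star (Phi \o fext fr a) (om \o kill i) (lw v) =
    up Phi om (nprod (map (U a) v)).
  move=> ma; rewrite -(addconv_comp hup fr (H := fext fr (U a)) ma km lP lo (fext_hom _ _)).
    by rewrite /= fext_lword.
  by move=> j nj; rewrite !fextE.
have z0 : star (Phi \o fext fr (fun j => if j == i then xG n else xG j)) (om \o kill i) (lw v) = 0.
  have iv : i \in v by rewrite -has_pred1 has_count c.
  rewrite Py (addconv_kill hup) //= (kill_lword fr) // iv.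
  exact: lin_fun0 (addconv_lin hup fr l1 lo).
rewrite (H _ ms) (H _ mx); rewrite (H _ my) in z0.
rewrite (@nprod_letter_sum _ _ (U (fun j => if j == i then xG i + xG n else xG j))
  (U xG) (U (fun j => if j == i then xG n else xG j)) i) //.
- by rewrite (lin_funD (upL lP lo)) z0 addr0.
- rewrite /U eqxx kill_letter // eqxx (nhom0 (fp_hom2 _)) !addr0.
  exact: nhomD (fp_hom1 _) _ _.
by move=> j jv ji; rewrite /U (negbTE ji).
Qed.

(* Letters are treated one after the other, truncating the moments of [chi]. *)
Lemma addconv_multilinear chi chi' om v : lin_fun chi -> lin_fun chi' -> lin_fun om ->
  (forall u, u != [::] -> inn u -> uniq u -> chi (lw u) = chi' (lw u)) ->
  v != [::] -> inn v -> uniq v -> star chi om (lw v) = star chi' om (lw v).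
Proof.
move=> l1 l2 lo E v0 vn uv.
pose ok k (u : seq nat) := all (fun j => (j < k)%N ==> (count_mem j u <= 1)%N) u.
have trunc (ph : F -> C) k : exists ps : F -> C, lin_fun ps /\
    forall u, u != [::] -> inn u -> ps (lw u) = if ok k u then ph (lw u) else 0.
  exact: (free_functional fr (fun u => if ok k u then ph (lw u) else 0)).
have okn u : inn u -> ok n u = uniq u.
  move=> /allP un; apply/allP/idP => [H|uu j ju]; last by rewrite count_uniq_mem // leq_b1 implybT.
  apply: count_mem_uniq => j; have [ju|/count_memPn //] := boolP (j \in u).
  have := H j ju; rewrite un //= => c1; apply/eqP; rewrite eqn_leq c1 /=.
  by rewrite -has_count has_pred1.
have T ph k ps : lin_fun ph -> lin_fun ps -> (k <= n)%N ->
    (forall u, u != [::] -> inn u -> ps (lw u) = if ok k u then ph (lw u) else 0) ->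
    star ph om (lw v) = star ps om (lw v).
  move=> lp; elim: k ps => [|k IH] ps ls kn Es.
    suff -> : ph = ps by [].
    apply: (free_lin_ext fr lp ls) => u u0 un; rewrite Es //.
    by rewrite (_ : ok 0%N u) //; apply/allP.
  have [ps' [ls' Es']] := trunc ph k.
  rewrite (IH ps') ?(ltnW kn) //; apply: (@addconv_letter _ _ _ k) => // [u u0 un cu|].
    rewrite Es // Es' //; suff -> : ok k.+1 u = ok k u by [].
    apply: eq_in_all => j ju; rewrite ltnS leq_eqVlt; case: eqP => [->|//] /=.
    by rewrite cu implybT.
  by rewrite count_uniq_mem // leq_b1.
have [ps [ls Es]] := trunc chi n.
rewrite (T chi n ps) // (T chi' n ps) // => u u0 un.
by rewrite Es // okn //; case: ifP => // uu; apply: E.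
Qed.

End UniqueLetters.

(** ** Convolutions of functionals supported on a single word *)

Section SingleWords.
Variables (R : realType) (Fc : finType) (FP : fpchoice R Fc).
Local Notation C := (complex R).
Variables (n : nat) (f : nat -> Fc) (F : mfalg R Fc) (x : nat -> F) (fr : is_free n f x).
Local Notation lw := (lword x).
Local Notation inn := (below n).
Local Notation kill := (kill fr).

Definition sw (p : seq nat * C) : F -> C :=
  projT1 (cid (free_functional fr (fun v => p.2 * (v == p.1)%:R))).

Lemma sw_lin p : lin_fun (sw p).
Proof. by rewrite /sw; case: cid => ? []. Qed.

Lemma swE p v : v != [::] -> inn v -> sw p (lw v) = p.2 * (v == p.1)%:R.
Proof. by rewrite /sw; case: cid => ? [] /= _; apply. Qed.

Lemma sw_kill p i : sw p \o kill i = if i \in p.1 then fun _ => 0 else sw p.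
Proof.
have hk := proj1 (kill_mfhom fr i).
apply: (free_lin_ext fr (lin_fun_comp (sw_lin p) hk)).
  by case: ifP => _; [apply: lin_fun_cst0 | apply: sw_lin].
move=> v v0 vn /=; rewrite (kill_lword fr) //; case: ifP => iv.
  rewrite (lin_fun0 (sw_lin p)); case: ifP => // /negbT ip; rewrite swE //.
  by case: eqP => [E|_]; rewrite ?mulr0 //; rewrite -E iv in ip.
case: ifP => // ip; rewrite swE //; case: eqP => [E|_]; rewrite ?mulr0 //.
by rewrite -E iv in ip.
Qed.

Section FixedProduct.
Variables (up : UP FP) (hup : sym_univ_prod up).
Local Notation star := (addconv up fr).

Definition convs (L : seq (seq nat * C)) : F -> C := foldr (fun p om => star (sw p) om) (fun _ => 0) L.

Lemma convs_lin L : lin_fun (convs L).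
Proof.
by elim: L => [|p L IH]; [apply: lin_fun_cst0 | apply: (addconv_lin hup fr (sw_lin p) IH)].
Qed.

Lemma convs_cat L1 L2 : convs (L1 ++ L2) = star (convs L1) (convs L2).
Proof.
elim: L1 => [|p L1 IH] /=; first by rewrite (addconv0f hup fr (convs_lin L2)).
by rewrite IH (addconv_assoc hup fr (sw_lin p) (convs_lin L1) (convs_lin L2)).
Qed.

Lemma convs_seq1 p : convs [:: p] = sw p.
Proof. exact: (addconvf0 hup fr (@sw_lin p)). Qed.

Lemma convs_mid L1 p L2 : convs (L1 ++ p :: L2) = convs (p :: L1 ++ L2).
Proof.
rewrite -[p :: L1 ++ L2]cat1s -(cat1s p L2) !convs_cat.
have l1 := convs_lin L1; have lp := convs_lin [:: p]; have l2 := convs_lin L2.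
rewrite -(addconv_assoc hup fr l1 lp l2) -(addconv_assoc hup fr lp l1 l2).
by rewrite (addconv_comm hup fr l1 lp).
Qed.

Lemma convs_kill i L : convs L \o kill i = convs [seq p <- L | i \notin p.1].
Proof.
elim: L => [|p L IH] //.
have E : convs (p :: L) \o kill i = star (sw p \o kill i) (convs L \o kill i).
  by rewrite (addconv_kill hup fr i (sw_lin p) (convs_lin L)).
rewrite E IH sw_kill /=; case: ifP => //= _.
exact: (addconv0f hup fr (@convs_lin _)).
Qed.

Lemma convs_diag s g L : (forall p, p \in L -> sw (g p) = sw p \o diag fr s) ->
  convs (map g L) = convs L \o diag fr s.
Proof.
elim: L => [|p L IH] H //=.
rewrite IH => [|q qL]; last by apply: H; rewrite inE qL orbT.
by rewrite (H p (mem_head _ _)) (addconv_diag hup fr s (sw_lin p) (convs_lin L)).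
Qed.

Definition good (p : seq nat * C) : bool := [&& uniq p.1, p.1 != [::] & inn p.1].

Section Tiling.
Variables (L : seq (seq nat * C)) (v : seq nat).
Hypotheses (Lg : all good L) (v0 : v != [::]) (vn : inn v) (vu : uniq v).
Hypotheses (Lv : forall p i, p \in L -> i \in p.1 -> i \in v).
Hypothesis (Lone : forall i, i \in v -> count (fun p => i \in p.1) L = 1%N).

(** For a letter [i] of [v], the index of the only word of [L] containing it: the words of [L] tile
    the letters of [v]. *)
Definition colr (i : nat) : nat := find (fun p : seq nat * C => i \in p.1) L.
Definition wrd (j : nat) : seq nat * C := nth ([::], 0) L j.

Lemma colr_lt i : i \in v -> (colr i < size L)%N.
Proof. by move=> /Lone c; rewrite -has_find has_count c. Qed.

Lemma colrE i j : i \in v -> (j < size L)%N -> i \in (wrd j).1 -> colr i = j.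
Proof.
move=> iv jL ij; have c := Lone iv; have ck := colr_lt iv.
have ic : i \in (wrd (colr i)).1.
  by rewrite /wrd /colr; apply: (nth_find _ (a := fun p : seq nat * C => i \in p.1)); rewrite has_find.
apply/eqP; apply/negPn/negP => ne.
have H a b : (a < b)%N -> (b < size L)%N -> i \in (wrd a).1 -> i \in (wrd b).1 -> False.
  move=> ab bL ia ib; move: c; rewrite -(cat_take_drop b L) count_cat (drop_nth ([::], 0)) //= -/(wrd b) ib.
  have : (0 < count (fun p => i \in p.1) (take b L))%N.
    rewrite -has_count; apply/hasP; exists (wrd a) => //.
    by rewrite /wrd -(nth_take _ ab) mem_nth // size_takel // ltnW.
  by case: (count _ _) => // m _; rewrite addSn addnS.
move: ne; rewrite neq_ltn => /orP[lt|lt]; first exact: (H _ _ lt jL).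
exact: (H _ _ lt ck).
Qed.

Lemma wrd_good j : (j < size L)%N -> good (wrd j).
Proof. by move=> jL; apply: (allP Lg); apply: mem_nth. Qed.

Lemma wrd_col i j : (j < size L)%N -> i \in (wrd j).1 -> colr i = j.
Proof. by move=> jL ij; apply: colrE => //; apply: Lv ij; apply: mem_nth. Qed.

Definition hd (j : nat) : nat := head 0%N (wrd j).1.

Lemma hd_in j : (j < size L)%N -> hd j \in (wrd j).1.
Proof.
by move=> /wrd_good /and3P[_ w0 _]; rewrite /hd; case: (wrd j).1 w0 => //= a l _; apply: mem_head.
Qed.

Section Scaling.
Variable t : nat -> R.
Local Notation T := (Defs.tower R Fc FP (fun _ => F)).
Local Notation inc := (Defs.incl R Fc FP (fun _ => F)).
Local Notation phi := (fun j => sw (wrd j)).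

(** An entry of [L] does not carry its index; it is recovered as the colour of its first letter. *)
Definition scl (p : seq nat * C) : seq nat * C := (p.1, (t (colr (head 0%N p.1)))%:C%C * p.2).

Lemma nth_scl j : (j < size L)%N -> nth ([::], 0) (map scl L) j = ((wrd j).1, (t j)%:C%C * (wrd j).2).
Proof.
by move=> jL; rewrite (nth_map ([::], 0)) // /scl -/(wrd j) (wrd_col jL) // hd_in.
Qed.

Lemma sw_scl j (h : F -> F) : (j < size L)%N -> nhom h ->
  (forall i, (i < n)%N -> h (x i) = if colr i == j then x i else 0) ->
  (fun z => (t j)%:C%C * sw (wrd j) z) \o h = sw (nth ([::], 0) (map scl L) j).
Proof.
move=> jL hh hE; rewrite nth_scl //.
apply: (free_lin_ext fr (lin_fun_comp (lin_fun_scale _ (sw_lin _)) hh) (sw_lin _)) => u u0 un /=.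
rewrite (nhom_nprod hh) -map_comp swE //=.
have [al|/allPn[i iu ic]] := boolP (all (fun i => colr i == j) u).
  have -> : map (h \o x) u = map x u.
    by apply/eq_in_map => i iu; rewrite /= hE ?(allP un) // (allP al _ iu).
  by rewrite swE //= mulrA.
rewrite nprod_in0; last first.
  by apply/mapP; exists i => //=; rewrite hE ?(allP un) // (negbTE ic).
rewrite (lin_fun0 (sw_lin _)) mulr0; case: eqP => [E|_]; last by rewrite mulr0.
by rewrite (wrd_col jL) ?eqxx // -E in ic.
Qed.

(** Identifies the tower in the definition of highest coefficients with a convolution: [H] sends
    each letter to the copy of [F] of its colour. The [j]th functional is unaffected, since its word
    uses letters of colour [j] only. *)
Lemma tower_convs m : (m < size L)%N ->
  exists H : F -> T m, [/\ mfhom H,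
    forall i, (i < n)%N -> H (x i) = if (colr i <= m)%N then inc m (colr i) (x i) else 0
    & towF R Fc FP up (fun _ => F) (fun j => sw (wrd j)) t m \o H = convs (take m.+1 (map scl L))].
Proof.
have xf i : (i < n)%N -> mf_face F (f i) (x i) by move=> ni; apply: (free_letter fr ni).
have f0 i : mf_face F (f i) 0 by have [] := @mf_face_sub _ _ F (f i).
elim: m => [|m IH] mL.
  pose H := fext fr (fun i => if colr i == 0%N then x i else 0).
  exists H; split.
  - by apply: fext_mfhom => i ni; case: ifP => _; [apply: xf | apply: f0].
  - move=> i ni; rewrite /H fextE // leqn0; case: eqP => //= ->.
    by rewrite (castA_id (As := fun _ => F)).
  have hH : nhom H := fext_hom fr _.
  rewrite (take_nth ([::], 0)) ?size_map // take0 convs_seq1 -(sw_scl mL hH) //.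
  by move=> i ni; rewrite /H fextE.
have [H [mH HE Hst]] := IH (ltnW mL).
pose pr := fext fr (fun i => if colr i == m.+1 then x i else 0).
have mpr : mfhom pr by apply: fext_mfhom => i ni; case: ifP => _; [apply: xf | apply: f0].
pose H' := fext fr (fun i => fp_in1 (FP (T m) F) (H (x i)) + fp_in2 (FP (T m) F) (pr (x i))).
exists H'; split.
- apply: fext_mfhom => i ni; apply: face_add.
    by apply: fp_face1; have [_] := mH; apply; apply: xf.
  by apply: fp_face2; have [_] := mpr; apply; apply: xf.
- move=> i ni; rewrite /H' fextE // HE // /pr fextE // [(_ <= m.+1)%N]leq_eqVlt ltnS.
  case: (eqVneq (colr i) m.+1) => [->|ne] /=.
    by rewrite ltnn (nhom0 (fp_hom1 _)) add0r eqxx (castA_id (As := fun _ => F)).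
  rewrite (nhom0 (fp_hom2 _)) addr0; case: ifP => cm; last by rewrite (nhom0 (fp_hom1 _)).
  by rewrite ltn_eqF.
have lt := @towF_lin _ _ FP (fun _ => F) up (fun j => sw (wrd j)) t.
rewrite (take_nth ([::], 0)) ?size_map // -cats1 convs_cat convs_seq1 -Hst.
rewrite -(sw_scl mL (proj1 mpr)); last by move=> i ni; rewrite /pr fextE.
rewrite -(addconv_comp hup fr (H := H')) //.
- by apply: lt => [|j]; [case: hup => -[] | apply: sw_lin].
- exact: lin_fun_scale (sw_lin _).
- exact: fext_hom.
- by move=> i ni; rewrite /H' fextE.
Qed.
End Scaling.

(** Multiplying a single-word functional by [t_j] is the same as rescaling the first letter of its
    word. Rescaling commutes with convolution, and [v] contains each of these first letters once. *)
Lemma convs_scl t : convs (map (scl t) L) (lw v) = (\prod_(j < size L) (t j)%:C%C) * convs L (lw v).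
Proof.
pose s i : C := if i == hd (colr i) then (t (colr i))%:C%C else 1.
have shd j : (j < size L)%N -> s (hd j) = (t j)%:C%C.
  by move=> jL; rewrite /s (wrd_col jL) ?hd_in // eqxx.
have hs := proj1 (diag_mfhom fr s).
rewrite (@convs_diag s (scl t)) => [|p pL].
  rewrite /= (diag_lword fr) // (lin_funZ (convs_lin L)); congr (_ * _).
  have -> : \prod_(i <- v) s i = \prod_(i <- [seq i <- v | i == hd (colr i)]) s i.
    by rewrite big_filter [RHS]big_mkcond; apply: eq_bigr => i _; rewrite /s; case: eqP.
  rewrite (perm_big (map hd (iota 0 (size L)))) /=.
    have -> : iota 0 (size L) = index_iota 0 (size L) by rewrite /index_iota subn0.
    rewrite big_map big_mkord.
    by apply: eq_bigr => j _; apply: shd.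
  apply: uniq_perm; first exact: filter_uniq.
    rewrite map_inj_in_uniq ?iota_uniq // => j j'; rewrite !mem_iota /= => jL jL' E.
    by rewrite -(wrd_col jL (hd_in jL)) E (wrd_col jL' (hd_in jL')).
  move=> i; rewrite mem_filter; apply/andP/mapP => [[/eqP Ei iv]|[j]].
    by exists (colr i) => //; rewrite mem_iota colr_lt.
  rewrite mem_iota /= => jL ->; rewrite (wrd_col jL (hd_in jL)); split=> //.
  by apply: (Lv (mem_nth _ jL)); apply: hd_in.
have [j jL Ep] : exists2 j, (j < size L)%N & wrd j = p.
  by exists (index p L); rewrite ?index_mem // /wrd nth_index.
have /and3P[wu w0 wn] := wrd_good jL.
apply: (free_lin_ext fr (sw_lin _) (lin_fun_comp (sw_lin p) hs)) => u u0 un /=.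
rewrite (diag_lword fr) // (lin_funZ (sw_lin p)) !swE //= -Ep.
case: eqP => [->|_]; last by rewrite !mulr0.
rewrite !mulr1; congr (_ * _).
rewrite -/(hd j) (wrd_col jL (hd_in jL)) (bigD1_seq (hd j)) ?hd_in //= shd //.
rewrite big_seq_cond big1 ?mulr1 // => i /andP[iw ij].
by rewrite /s (wrd_col jL iw) (negbTE ij).
Qed.

Variable alpha : wts R Fc.

Definition tile_val : C :=
  alpha [ffun l : 'I_(size v) => f (nth 0%N v l)]
    [set [set l : 'I_(size v) | colr (nth 0%N v l) == kappa] | kappa : 'I_(size L)] *
  \prod_(kappa < size L) sw (wrd kappa) (nprod
    [seq Defs.castA R Fc (fun _ => F) kappa (colr (nth 0%N v l)) (x (nth 0%N v l))
       | l : 'I_(size v) <- enum 'I_(size v) & colr (nth 0%N v l) == kappa]).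

(** By [convs_scl] the function to be differentiated is a constant times the product of the [t_j],
    so the constant is its mixed derivative. The right side is free of [up], which is what makes two
    products comparable. *)
Lemma convs_value : has_highest up alpha -> convs L (lw v) = tile_val.
Proof.
move=> hh; have vl (l : 'I_(size v)) : nth 0%N v l \in v by apply: mem_nth.
have [l0 _] : exists l0 : 'I_(size v), true by case: (v) v0 => // a u _; exists ord0.
have k0 : (0 < size L)%N by apply: leq_ltn_trans (colr_lt (vl l0)).
have bon kappa : (kappa < size L)%N -> exists l : 'I_(size v), colr (nth 0%N v l) = kappa.
  move=> kL; have hv : hd kappa \in v by apply: (Lv (mem_nth _ kL)); apply: hd_in.
  have il : (index (hd kappa) v < size v)%N by rewrite index_mem.
  by exists (Ordinal il); rewrite /= nth_index // (wrd_col kL (hd_in kL)).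
have fa (l : 'I_(size v)) : mf_face F ([ffun l : 'I_(size v) => f (nth 0%N v l)] l) (x (nth 0%N v l)).
  by rewrite ffunE; apply: (free_letter fr); apply: (allP vn).
have := hh (size L) (fun _ => F) (fun j => sw (wrd j)) k0 (fun j => @sw_lin _) (size v)
  (fun l => colr (nth 0%N v l)) _ (fun l => x (nth 0%N v l)) (fun l => colr_lt (vl l)) bon fa.
rewrite -/tile_val => H.
pose G := fun t : nat -> R => \sum_(i : 'I_1) convs L (lw v) * \prod_(j < size L) ('X : {poly C}).[(t j)%:C%C].
have sep := @mpd_separable R 'I_1 predT (fun _ => convs L (lw v)) (fun _ _ => 'X) (size L).
rewrite big_ord1 (eq_bigr (fun _ => 1)) in sep; last by move=> j _; rewrite coefX.
rewrite big1_eq mulr1 in sep; apply: mpd_unique sep _.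
move: H; congr mpd; apply/funext => t.
have kL : ((size L).-1 < size L)%N by rewrite prednK.
have [h [[hh0 _] hE hst]] := tower_convs t kL.
have -> : nprod [seq Defs.incl R Fc FP (fun _ => F) (size L).-1 (colr (nth 0%N v l)) (x (nth 0%N v l))
   | l : 'I_(size v) <- enum 'I_(size v)] = h (lw v).
  rewrite (nhom_nprod hh0) -map_comp -[in RHS](mkseq_nth 0%N v) /mkseq -map_comp -val_enum_ord -map_comp.
  congr nprod; apply: eq_map => l /=; rewrite hE ?(allP vn) //.
  by rewrite -ltnS prednK // colr_lt.
rewrite -[LHS]/((towF R Fc FP up (fun _ => F) (fun j => sw (wrd j)) t (size L).-1 \o h) (lw v)) hst prednK //.
rewrite -(size_map (scl t) L) take_size convs_scl size_map big_ord1 mulrC; congr (_ * _).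
by apply: eq_bigr => j _; rewrite hornerX.
Qed.

End Tiling.
End FixedProduct.

Variables (up up' : UP FP) (hup : sym_univ_prod up) (hup' : sym_univ_prod up').
Variables (alpha : wts R Fc) (hh : has_highest up alpha) (hh' : has_highest up' alpha).

(** Induction on the number of words, down to tilings. A word with a letter outside [v] can be
    killed; a letter of [v] in no word makes the value [0]; for a letter in several words,
    [addconv_expand] leaves one sum without [p] and one without the other words containing it. *)
Lemma convs_agree L v : all good L -> v != [::] -> inn v -> uniq v ->
  convs up L (lw v) = convs up' L (lw v).
Proof.
have [m] := ubnP (size L); elim: m L => // m IH L Lm Lg v0 vn vu.
have Fg (a : pred (seq nat * C)) L' : all good L' -> all good [seq p <- L' | a p].
  by move=> g; apply/allP => p; rewrite mem_filter => /andP[_ /(allP g)].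
have K (u : UP FP) (hu : sym_univ_prod u) i L' :
    convs u L' (kill i (lw v)) = convs u [seq p <- L' | i \notin p.1] (lw v).
  by rewrite -(convs_kill hu).
have [/hasP[p pL /hasP[i ip iv]]|/hasPn N1] := boolP (has (fun p : seq nat * C => has (fun i => i \notin v) p.1) L).
  have lt : (size [seq p <- L | i \notin p.1] < size L)%N.
    rewrite size_filter ltn_neqAle count_size andbT -all_count.
    by apply/allPn; exists p => //; rewrite negbK.
  have kv : kill i (lw v) = lw v by rewrite (kill_lword fr) // (negbTE iv).
  rewrite -kv (K _ hup) (K _ hup'); apply: IH => //; last exact: Fg.
  by apply: leq_trans lt _.
have Lv p i : p \in L -> i \in p.1 -> i \in v.
  by move=> pL ip; have := N1 p pL; move=> /hasPn/(_ i ip); rewrite negbK.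
have [/hasP[i iv /eqP c0]|/hasPn N2] := boolP (has (fun i => count (fun p : seq nat * C => i \in p.1) L == 0%N) v).
  have Lf : [seq p <- L | i \notin p.1] = L.
    apply/all_filterP; rewrite -[all _ _]negbK -has_predC has_count.
    by rewrite (eq_count (a2 := fun p => i \in p.1)) ?c0 // => p /=; rewrite negbK.
  have z (u : UP FP) (hu : sym_univ_prod u) : convs u L (lw v) = 0.
    by rewrite -[in LHS]Lf -(K _ hu) (kill_lword fr) // iv (lin_fun0 (convs_lin hu L)).
  by rewrite !z.
have [/hasP[i iv c2]|/hasPn N3] := boolP (has (fun i => (1 < count (fun p : seq nat * C => i \in p.1) L)%N) v).
  have : has (fun p : seq nat * C => i \in p.1) L by rewrite has_count ltnW.
  case/hasP=> p pL ip; have ni : (i < n)%N by apply: (allP vn).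
  case/splitPr: pL Lm Lg c2 {N1 Lv N2} => L1 L2 Lm Lg c2.
  have Lg' : all good (L1 ++ L2) /\ good p.
    by move: Lg; rewrite !all_cat /= => /and3P[-> -> ->].
  have szL : (size (L1 ++ L2) < m)%N by move: Lm; rewrite !size_cat /= addnS ltnS.
  have hc : has (fun p : seq nat * C => i \in p.1) (L1 ++ L2).
    by rewrite has_count count_cat; move: c2; rewrite count_cat /= ip addnCA add1n ltnS.
  have lt : (size [seq q <- L1 ++ L2 | i \notin q.1] < size (L1 ++ L2))%N.
    rewrite size_filter ltn_neqAle count_size andbT -all_count -has_predC.
    by rewrite (eq_has (a2 := fun p => i \in p.1)) // => q /=; rewrite negbK.
  have civ : count_mem i v = 1%N by rewrite count_uniq_mem // iv.
  have ex (u : UP FP) (hu : sym_univ_prod u) : convs u (L1 ++ p :: L2) (lw v) =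
      convs u (p :: [seq q <- L1 ++ L2 | i \notin q.1]) (lw v) + convs u (L1 ++ L2) (lw v).
    rewrite (convs_mid hu) /=.
    rewrite (addconv_expand hu fr (@sw_lin p) (@convs_lin u hu (L1 ++ L2)) ni vn civ).
    rewrite (convs_kill hu) sw_kill ip; congr (_ + _).
    by rewrite (addconv0f hu fr (@convs_lin u hu (L1 ++ L2))).
  rewrite (ex _ hup) (ex _ hup'); case: Lg' => g1 g2; congr (_ + _); apply: IH => //=.
    by apply: leq_ltn_trans lt szL.
  by rewrite g2 Fg.
have Lone i : i \in v -> count (fun p : seq nat * C => i \in p.1) L = 1%N.
  by move=> iv; have := N2 i iv; have := N3 i iv; case: (count _ _) => [|[|c]].
by rewrite (convs_value hup Lg v0 vn vu Lv Lone hh) (convs_value hup' Lg v0 vn vu Lv Lone hh').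
Qed.

End SingleWords.

(** ** Uniqueness *)

Section LetterCumulants.
Variables (R : realType) (Fc : finType) (FP : fpchoice R Fc) (alpha : wts R Fc).
Hypothesis adm : admissible alpha.
Local Notation C := (complex R).
Local Notation cum := (cum alpha).
Local Notation plog := (plog alpha).
Variables (n : nat) (f : nat -> Fc) (F : mfalg R Fc) (x : nat -> F) (fr : is_free n f x).
Local Notation lw := (lword x).
Local Notation inn := (below n).
Local Notation up := (the_up alpha FP).
Local Notation star := (addconv up fr).
Local Notation st := (convs fr up).

Let hup : sym_univ_prod up. Proof. exact: the_up_sym_univ_prod. Qed.

Definition tag (u : seq nat) : seq (Fc * F) := [seq (f i, x i) | i <- u].
Definition lcum (chi : F -> C) (u : seq nat) : C := plog f (chi \o lw) u.

Lemma lcumE chi u : ~~ nilp u -> lcum chi u = cum chi (tag u).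
Proof.
move=> u0; rewrite /cum /tag (@plog_map _ _ _ adm _ _ f) //.
congr (plog _ _ u); apply/funext => w.
by rewrite /mom /= -map_comp.
Qed.

Lemma pexp_lcum chi u : ~~ nilp u -> pexp alpha f (lcum chi) u = chi (lw u).
Proof. exact: pexp_plog. Qed.

Definition ubelow (u : seq nat) : bool := uniq u && inn u.

Lemma ubelow_sub (w : seq nat) (S : {set 'I_(size w)}) : ubelow w -> ubelow (sub (tnth (in_tuple w)) S).
Proof.
move=> /andP[wu wn]; rewrite /ubelow [inn _]all_sub ?andbT //.
rewrite map_inj_in_uniq ?enum_uniq // => i j _ _; rewrite !(tnth_nth 0%N) /= => /eqP.
by rewrite nth_uniq // => /eqP/val_inj.
Qed.

(** Multilinearity expands the cumulant of sums over all choices of copies, and the vanishing of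
    mixed cumulants leaves the two constant choices. *)
Lemma lcum_addconv chi om u : lin_fun chi -> lin_fun om -> ~~ nilp u -> inn u ->
  lcum (star chi om) u = lcum chi u + lcum om u.
Proof.
move=> l1 l2 u0 un; rewrite !lcumE //.
have [lp p1 p2 ip] := the_upP adm FP l1 l2; pose G := FP F F.
pose K := cum (up F F chi om).
pose e (p : bool * nat) : Fc * G := (f p.2, if p.1 then fp_in1 G (x p.2) else fp_in2 G (x p.2)).
pose sums (v : seq nat) : seq (Fc * G) := [seq (f i, fp_in1 G (x i) + fp_in2 G (x i)) | i <- v].
have -> : cum (star chi om) (tag u) = K (sums u).
  have dh := proj1 (delta_mfhom FP fr).
  rewrite /addconv -(cum_hom adm _ dh); last by rewrite /nilp size_map.
  congr (cum _ _); rewrite -map_comp; apply/eq_in_map => i iu /=.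
  by rewrite deltaE // (allP un).
have KL : multilinear_words K by apply: (@multilinear_plog _ _ _ adm _ _ id); apply: multilinear_mom.
have base (r : seq (bool * nat)) : r != [::] -> inn (map snd r) -> K (map e r) =
    (all fst r)%:R * cum chi (tag (map snd r)) + (all (fun p => ~~ p.1) r)%:R * cum om (tag (map snd r)).
  move=> r0 rn; have nr : ~~ nilp (tag (map snd r)) by rewrite /nilp !size_map size_eq0.
  have [at_|nt] := boolP (all fst r).
    have -> : all (fun p => ~~ p.1) r = false.
      by case: (r) r0 at_ => //= -[[] i] r' _.
    rewrite mul1r mul0r addr0 -(cum_mono adm (fp_hom1 G) p1) //; congr (cum _ _).
    rewrite /tag -!map_comp; apply/eq_in_map => p pr.
    by rewrite /e /=; have := allP at_ p pr; case: (p.1).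
  have [af|nf] := boolP (all (fun p => ~~ p.1) r).
    rewrite mul1r mul0r add0r -(cum_mono adm (fp_hom2 G) p2) //; congr (cum _ _).
    rewrite /tag -!map_comp; apply/eq_in_map => p pr.
    by rewrite /e /=; have := allP af p pr; case: (p.1).
  rewrite !mul0r addr0.
  have -> : map e r = uncol [seq (((p.1, f p.2), (e p).2) : (bool * Fc) * G) | p <- r].
    by rewrite /uncol -map_comp.
  apply: ip.
    rewrite all_map; apply/allP => -[b i] pr /=; apply/asboolP.
    have ni : (i < n)%N by apply: (allP rn); apply: (map_f snd pr).
    by case: b pr => pr; exists (x i) => //; apply: (free_letter fr).
  case; rewrite all_map.
    by apply: contra nt; apply: sub_all => p /eqP /=.
  by apply: contra nf; apply: sub_all => p /eqP /= ->.
have key v : inn v -> forall r, inn (map snd r) -> r ++ map (pair true) v != [::] ->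
    K (map e r ++ sums v) = (all fst r)%:R * cum chi (tag (map snd r ++ v)) +
      (all (fun p => ~~ p.1) r)%:R * cum om (tag (map snd r ++ v)).
  elim: v => [|i v IH] vn r rn r0; first by rewrite !cats0 in r0 *; apply: base.
  move: vn => /= /andP[ni vn].
  have := KL (map e r) (sums v) (f i) 1 (fp_in1 G (x i)) (fp_in2 G (x i)).
  rewrite scale1r mul1r => ->.
  have rc b : inn (map snd (rcons r (b, i))) by rewrite map_rcons /below all_rcons ni.
  have rz b : rcons r (b, i) ++ map (pair true) v != [::].
    by rewrite -size_eq0 size_cat size_rcons.
  have step b : map e r ++ e (b, i) :: sums v = map e (rcons r (b, i)) ++ sums v.
    by rewrite map_rcons cat_rcons.
  rewrite (step true) (step false) !IH // !map_rcons !cat_rcons !all_rcons /=.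
  by rewrite !mul0r addr0 add0r.
rewrite -[sums u]/(map e [::] ++ sums u) (key u un [::] isT) /= ?mul1r //.
by rewrite -size_eq0 size_map.
Qed.

Lemma lcum0 u : ~~ nilp u -> inn u -> lcum (fun _ => 0) u = 0.
Proof.
move=> u0 un; have l0 := @lin_fun_cst0 R F; have := lcum_addconv l0 l0 u0 un.
by rewrite (addconv0f hup fr l0) => /eqP; rewrite -subr_eq0 opprD addNKr oppr_eq0 => /eqP.
Qed.

(** On words without repeated letters the cumulants equal the moments: a partition with two blocks
    contributes [0], because disjoint blocks cannot both spell the nonempty word [p.1]. *)
Lemma lcum_sw p u : p.1 != [::] -> ~~ nilp u -> ubelow u -> lcum (sw fr p) u = p.2 * (u == p.1)%:R.
Proof.
move=> p0; move: u.
apply: (pexp_inj adm (fc := f) (P := ubelow) (K := lcum (sw fr p)) (K' := fun u => p.2 * (u == p.1)%:R)).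
  exact: ubelow_sub.
move=> u u0 /andP[uu un]; rewrite pexp_lcum // swE //; last by case: (u) u0.
rewrite /pexp pexpS_top ?setT_neq0 // sub_setT /prest big1 ?addr0 // => q /andP[qS qN].
have [B1 [B2 [B1q B2q B21]]] := partition_two (setT_neq0 u0) qS qN.
suff [B Bq Bp] : exists2 B, B \in q & sub (tnth (in_tuple u)) B != p.1.
  by rewrite (bigD1 B) //= (negbTE Bp) mulr0 mul0r mulr0.
have [E1|] := eqVneq (sub (tnth (in_tuple u)) B1) p.1; last by exists B1.
exists B2 => //; apply/negP => /eqP E2; case: p.1 p0 E1 E2 => // i w _ E1 E2.
have : i \in sub (tnth (in_tuple u)) B1 by rewrite E1 mem_head.
have : i \in sub (tnth (in_tuple u)) B2 by rewrite E2 mem_head.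
move=> /mapP[l2 + Ei] /mapP[l1 + Ei']; rewrite !mem_enum => l2B l1B.
have l12 : l1 = l2.
  apply: val_inj; apply/eqP; rewrite -(nth_uniq 0%N (ltn_ord l1) (ltn_ord l2) uu).
  by rewrite -!(tnth_nth 0%N (in_tuple u)) -Ei -Ei'.
have tr := partition_trivIset qS.
by case/eqP: B21; rewrite -(def_pblock tr B1q l1B) -(def_pblock tr B2q l2B) l12.
Qed.

Lemma lcum_convs L u : all (good n) L -> ~~ nilp u -> ubelow u ->
  lcum (st L) u = \sum_(p <- L) p.2 * (u == p.1)%:R.
Proof.
move=> + u0 uu; have un : inn u by case/andP: uu.
elim: L => [|p L IH] /=; first by rewrite big_nil lcum0.
move=> /andP[/and3P[_ p0 _] gL]; rewrite big_cons -IH // -lcum_sw //.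
by rewrite -lcum_addconv //; [apply: sw_lin | apply: convs_lin].
Qed.

Fixpoint words (k : nat) : seq (seq nat) :=
  if k is k'.+1 then words k' ++ [seq i :: u | i <- iota 0 n, u <- words k'] else [:: [::]].

Lemma mem_words k u : inn u -> (size u <= k)%N -> u \in words k.
Proof.
elim: k u => [|k IH] u un; first by rewrite leqn0 size_eq0 => /eqP->.
rewrite /= mem_cat; case: u un => [|i u] /= un uk; first by rewrite IH.
move: un => /andP[ni un]; apply/orP; right; apply/allpairsP; exists (i, u) => /=.
by rewrite mem_iota ni IH.
Qed.

(* The words without repeated letters, weighted by their letter cumulants. *)
Lemma letter_decomposition chi : lin_fun chi -> exists L, all (good n) L /\
  forall u, u != [::] -> inn u -> uniq u -> chi (lw u) = st L (lw u).
Proof.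
move=> lc; pose W := undup [seq u <- words n | good n (u, 0 : C)].
exists [seq (w, lcum chi w) | w <- W].
have gW w : w \in W -> good n (w, 0 : C) by rewrite mem_undup mem_filter => /andP[].
have gL : all (good n) [seq (w, lcum chi w) | w <- W].
  by rewrite all_map; apply/allP => w /gW.
split=> // u u0 un uu; have nu : ~~ nilp u by case: (u) u0.
have Pu : ubelow u by rewrite /ubelow uu un.
rewrite -!pexp_lcum //; apply: (@eq_pexp_in _ _ alpha _ f ubelow (lcum chi) (lcum (st [seq (w, lcum chi w) | w <- W])) (@ubelow_sub)) Pu.
move=> {un uu nu}u {}u0 Pu; rewrite lcum_convs // big_map /=.
have /andP[uu un] := Pu.
have uW : u \in W.
  rewrite mem_undup mem_filter /good /= uu un !andbT; apply/andP; split; first by case: (u) u0.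
  apply: mem_words => //; rewrite -(size_iota 0 n); apply: uniq_leq_size => // i iu.
  by rewrite mem_iota (allP un).
rewrite (bigD1_seq u) ?undup_uniq //= eqxx mulr1 big1 ?addr0 // => w wu.
by rewrite eq_sym (negbTE wu) mulr0.
Qed.

Lemma addconv_unique (up' : UP FP) chi om v :
  sym_univ_prod up' -> has_highest up' alpha -> lin_fun chi -> lin_fun om ->
  v != [::] -> inn v -> uniq v ->
  addconv up fr chi om (lw v) = addconv up' fr chi om (lw v).
Proof.
move=> hup' hh' l1 l2 v0 vn uv; have hh := the_up_highest adm FP.
have [L1 [g1 E1]] := letter_decomposition l1; have [L2 [g2 E2]] := letter_decomposition l2.
have gen (u : UP FP) (hu : sym_univ_prod u) : has_highest u alpha ->
    addconv u fr chi om (lw v) = convs fr u (L1 ++ L2) (lw v).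
  move=> hhu; rewrite (convs_cat fr hu).
  have s1 := @convs_lin _ _ _ _ _ _ _ fr u hu L1; have s2 := @convs_lin _ _ _ _ _ _ _ fr u hu L2.
  (* The decomposition [E1] refers to convolution by [the_up]; [convs_agree] carries it over to
     [u]. *)
  have A1 w : w != [::] -> inn w -> uniq w -> chi (lw w) = convs fr u L1 (lw w).
    by move=> w0 wn uw; rewrite E1 // (convs_agree fr hup hu hh hhu).
  have A2 w : w != [::] -> inn w -> uniq w -> om (lw w) = convs fr u L2 (lw w).
    by move=> w0 wn uw; rewrite E2 // (convs_agree fr hup hu hh hhu).
  rewrite (addconv_multilinear hu fr l1 s1 l2 A1) // (addconv_comm hu fr s1 l2) (addconv_comm hu fr s1 s2).
  exact: (addconv_multilinear hu fr l2 s2 s1 A2).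
rewrite (gen _ hup hh) (gen _ hup' hh'); apply: (convs_agree fr hup hup' hh hh') => //.
by rewrite all_cat g1 g2.
Qed.

End LetterCumulants.

Theorem theorem8p2 (R : realType) (Fc : finType) (FP : fpchoice R Fc)
    (alpha : wts R Fc) :
  admissible alpha ->
  exists up : UP FP,
    sym_univ_prod up /\ has_highest up alpha /\
    (forall up' : UP FP, sym_univ_prod up' -> has_highest up' alpha ->
       forall (A1 A2 : mfalg R Fc) (phi1 : A1 -> complex R) (phi2 : A2 -> complex R),
         lin_fun phi1 -> lin_fun phi2 ->
         forall z, up A1 A2 phi1 phi2 z = up' A1 A2 phi1 phi2 z).
Proof.
move=> adm; exists (the_up alpha FP).
have hup := the_up_sym_univ_prod adm FP.
split=> //; split; first exact: the_up_highest.
move=> up' hup' hh' A1 A2 phi1 phi2 l1 l2 z; congr (_ z).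
have upL : up_linear (the_up alpha FP) by case: hup => -[].
have upL' : up_linear up' by case: hup' => -[].
apply: (lin_ext_words (@fp_genalg _ _ _ _ (FP A1 A2)) (upL _ _ _ _ l1 l2) (upL' _ _ _ _ l1 l2)) => w w0 wP.
pose G := FP A1 A2.
(* Each entry comes from one factor and is written as a sum over both, the other summand being [0].
   With one free letter per entry, [w] becomes the image of a word without repeated letters under a
   map of the form required by [addconv_comp]. *)
pose spec (t : Fc * A1 * A2) (a : G) := [/\ mf_face A1 t.1.1 t.1.2, mf_face A2 t.1.1 t.2
  & a = fp_in1 G t.1.2 + fp_in2 G t.2].
have ex a : a \in w -> exists t, spec t a.
  move=> /wP[[[] q] [y fy ->]].
    exists (q, y, 0); split=> //=; last by rewrite (nhom0 (fp_hom2 _)) addr0.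
    by have [] := @mf_face_sub _ _ A2 q.
  exists (q, 0, y); split=> //=; last by rewrite (nhom0 (fp_hom1 _)) add0r.
  by have [] := @mf_face_sub _ _ A1 q.
have [a0 a0w] : exists a0, a0 \in w by case: (w) w0 => // a l _; exists a; apply: mem_head.
have [t0 _] := ex a0 a0w.
have /choice[t tP] i : exists t, (i < size w)%N -> spec t (nth a0 w i).
  have [iw|_] := ltnP i (size w); last by exists t0.
  by have [t Ht] := ex _ (mem_nth a0 iw); exists t.
pose n := size w; pose f i := (t i).1.1.
have [F [x fr]] := free_exists FP n f.
pose h1 := fext fr (fun i => (t i).1.2); pose h2 := fext fr (fun i => (t i).2).
have m1 : mfhom h1 by apply: fext_mfhom => i /tP[].
have m2 : mfhom h2 by apply: fext_mfhom => i /tP[].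
pose H := fext fr (fun i => fp_in1 G (t i).1.2 + fp_in2 G (t i).2).
pose v := iota 0 n.
have vn : below n v by apply/allP => i; rewrite mem_iota.
have v0 : v != [::] by rewrite -size_eq0 size_iota size_eq0.
have Hw : H (lword x v) = nprod w.
  rewrite /H fext_lword //; congr nprod; rewrite -[RHS](mkseq_nth a0) /mkseq.
  by apply/eq_in_map => i; rewrite mem_iota => /tP[_ _ ->].
have HE i : (i < n)%N -> H (x i) = fp_in1 G (h1 (x i)) + fp_in2 G (h2 (x i)).
  by move=> ni; rewrite /H /h1 /h2 !fextE.
have E (u : UP FP) (hu : sym_univ_prod u) :
    u A1 A2 phi1 phi2 (nprod w) = addconv u fr (phi1 \o h1) (phi2 \o h2) (lword x v).
  have hH : nhom H := fext_hom fr _.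
  by rewrite -Hw -[LHS]/((_ \o H) _) (addconv_comp hu fr m1 m2 l1 l2 hH HE).
rewrite (E _ hup) (E _ hup'); apply: (addconv_unique adm) => //.
- by case: m1 => hh1 _; apply: lin_fun_comp.
- by case: m2 => hh2 _; apply: lin_fun_comp.
- exact: iota_uniq.
Qed.
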